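(* Let $\mu$ be a nondegenerate Borel probability measure on the kale $\mathcal K$ that is nonsticky and square-integrable, i.e. $\int_{\mathcal K} d(\mathbf 0,q)^2\,d\mu(q)<\infty$. Let $(p_n)_{n\ge1}$ be independent $\mathcal K$-valued random variables with distribution $\mu$ on a probability space $(\Omega,\mathcal A,\mathbb P)$ and let $b_N$ be the barycenter of $p_1,\dots,p_N$. Let $\bar b=(r^*,\theta^* )$ be the mean of $\mu$, let $\kappa$ and $g$ be as in the context, and define for Borel sets $W\subset\mathbb R^2$ $$\tilde\nu_N(W)=\mathbb P\Big(\sqrt N\,\big(e_1\cdot F_{\theta^*}b_N-r^*,\ (1+\kappa)\,e_2\cdot F_{\theta^*}b_N\big)\in W\Big).$$ Then the measures $\tilde\nu_N$ converge weakly to $g$ as $N\to\infty$; that is, for any continuous bounded function $\phi:\mathbb R^2\to\mathbb R$, $$\lim_{N\to\infty}\int_{\mathbb R^2}\phi(z)\,d\tilde\nu_N(z)=\int_{\mathbb R^2}\phi(z)\,dg(z).$$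
   Context: Fix $\alpha>2\pi$. The kale is $\mathcal K=\big((0,\infty)\times(\mathbb R/\alpha\mathbb Z)\big)\cup\{\mathbf 0\}$; points are written $(r,\theta)$ with $r\ge 0$, $\theta\in\mathbb R/\alpha\mathbb Z$, and $(0,\theta)=\mathbf 0$ for every $\theta$. For angles put $|\theta'-\theta|=\min_{n\in\mathbb Z}|n\alpha+\theta'-\theta|$; when $|\theta'-\theta|\le\pi$, the symbol $\theta'-\theta$ denotes the unique representative in $[-\pi,\pi]$. The metric is $d((r_1,\theta_1),(r_2,\theta_2))^2=(r_1+r_2)^2$ if $|\theta_1-\theta_2|\ge\pi$ and $=r_1^2+r_2^2-2r_1r_2\cos|\theta_1-\theta_2|$ if $|\theta_1-\theta_2|\le\pi$; in particular $d(\mathbf 0,(r,\theta))=r$. Folding map: $F_\theta:\mathcal K\to\mathbb R^2$ sends $\mathbf 0$ to $0$ and, in polar coordinates on $\mathbb R^2$, $F_\theta(r',\theta')=(r',\theta'-\theta)$ if $r'>0$, $|\theta'-\theta|\le\pi$, and $F_\theta(r',\theta')=(r',\pi)$ if $r'>0$, $|\theta'-\theta|\ge\pi$. Let $\tilde\mu_\theta=\mu\circ F_\theta^{-1}$ be the pushforward of $\mu$ to $\mathbb R^2$; $e_1,e_2$ is the standard basis of $\mathbb R^2$. The folded first moment is $m_\theta=\int_{\mathcal K}F_\theta(p)\,d\mu(p)=(m_{\theta,1},m_{\theta,2})\in\mathbb R^2$ (cartesian coordinates). Let $K=\{\theta: m_{\theta,1}\ge 0\}$. The measure $\mu$ is nonsticky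 if $K$ has non-empty interior and $m_{\theta,1}>0$ on $\mathrm{int}(K)$. In this case the mean of $\mu$ is $\bar b=(r^*,\theta^* )$, where $\theta^*$ is the unique maximizer of $\theta\mapsto m_{\theta,1}$ and $r^*=m_{\theta^*,1}>0$; in cartesian coordinates $F_{\theta^*}\bar b=(r^*,0)$. Nondegenerate means: $\mu(R_{\theta,\theta'})<1$ for all angles $\theta,\theta'$ with $|\theta-\theta'|\ge\pi$, where $R_{\theta,\theta'}=\{(r,\theta):r\ge 0\}\cup\{(r,\theta'):r\ge 0\}$. Barycenter of points: $b_N=\operatorname{arg\,min}_{p\in\mathcal K}\frac1{2N}\sum_{n=1}^N d(p,p_n)^2$ (the minimizer exists and is unique). Shadows with half boundary: $\mathcal I_\theta^+=\mathcal K\setminus\{(r,\theta'): r>0,\ -\pi\le\theta'-\theta<\pi\}$ and $\mathcal I_\theta^-=\mathcal K\setminus\{(r,\theta'): r>0,\ -\pi<\theta'-\theta\le\pi\}$ (so $\mathcal I^\pm_\theta$ consists of $\mathbf 0$, all points at angle $\theta'$ with $|\theta'-\theta|>\pi$, and the ray at angle $\theta\pm\pi$). Put $w^\pm(\theta)=\int_{\mathcal I_\theta^\pm}d(\mathbf 0,p)\,d\mu(p)$. The random variable $\kappa$ (depending on $N$) is $\kappa=w^+(\theta^* )/r^*$ if $e_2\cdot F_{\theta^*}b_N<0$; $\kappa=w^-(\theta^* )/r^*$ if $e_2\cdot F_{\theta^*}b_N>0$; $\kappa=0$ otherwise. $g$ is the law of the (possibly degenerate) normal random vector in $\mathbb R^2$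 with zero mean and covariance matrix $\Sigma=\int_{\mathbb R^2}(y-F_{\theta^*}\bar b)(y-F_{\theta^*}\bar b)^T\,d\tilde\mu_{\theta^*}(y)$. *)

(* Defs.v *)
From HB Require Import structures.
From mathcomp Require Import all_boot all_order all_algebra.
From mathcomp Require Import all_classical all_reals all_analysis.

Set Implicit Arguments.
Unset Strict Implicit.
Unset Printing Implicit Defensive.

Import Order.TTheory GRing.Theory Num.Theory.
Import numFieldNormedType.Exports.

Local Open Scope classical_set_scope.
Local Open Scope ring_scope.

Section Angles.
Context {R : realType}.
Implicit Types (alpha x : R).

(* Angles in R / alpha Z are given by real representatives. *)
Definition angle_abs alpha x : R :=
  inf (range (fun n : int => `|n%:~R * alpha + x|)).

Definition angle_repr alpha x y := exists n : int, y = n%:~R * alpha + x.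

(* For 2 * pi < alpha and angle_abs alpha x <= pi, the set is a singleton. *)
Definition angle_val alpha x : R :=
  xget 0 [set y | - pi <= y <= pi /\ angle_repr alpha x y].

End Angles.

Section Kale.
Context {R : realType}.
Variable alpha : R.

(* Canonical coordinates: r > 0 with 0 <= theta < alpha, or (0, 0) for the
   origin. *)
Definition kale_coord : pred (R * R) := fun x =>
  (0 < x.1) && (0 <= x.2 < alpha) || (x == (0, 0)).

Record kale := Kale { kcoords : R * R; _ : kale_coord kcoords }.
HB.instance Definition _ := [isSub for kcoords].
HB.instance Definition _ := [Choice of kale by <:].

Lemma kale_coord0 : kale_coord (0, 0).
Proof. by rewrite /kale_coord eqxx orbT. Qed.

Definition korigin : kale := Kale kale_coord0.
HB.instance Definition _ := isPointed.Build kale korigin.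

Definition krad (p : kale) : R := (kcoords p).1.
Definition kang (p : kale) : R := (kcoords p).2.

(* For 0 < alpha and 0 <= r, the default value of insubd is used only if r = 0. *)
Definition polar (r theta : R) : kale :=
  insubd korigin (r, theta - (Num.floor (theta / alpha))%:~R * alpha).

Definition kdist (p q : kale) : R :=
  let r1 := krad p in let r2 := krad q in
  let t := angle_abs alpha (kang p - kang q) in
  if pi <= t then r1 + r2
  else Num.sqrt (r1 ^+ 2 + r2 ^+ 2 - 2 * r1 * r2 * cos t).

Definition kopen : set (set kale) := [set U | forall p, U p ->
  exists2 e : R, 0 < e & forall q, kdist p q < e -> U q].

HB.instance Definition _ :=
  Measurable.copy kale (g_sigma_algebraType kopen).

Definition folding (theta : R) (p : kale) : R * R :=
  let t := kang p - theta in
  let phi := if angle_abs alpha t <= pi then angle_val alpha t else pi in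
  (krad p * cos phi, krad p * sin phi).

Definition kray (theta : R) : set kale :=
  [set polar r theta | r in [set r | 0 <= r]].

Definition shadow_plus (theta : R) : set kale :=
  ~` [set p | exists r theta', [/\ p = polar r theta', 0 < r &
    exists2 y, angle_repr alpha (theta' - theta) y & - pi <= y < pi]].

Definition shadow_minus (theta : R) : set kale :=
  ~` [set p | exists r theta', [/\ p = polar r theta', 0 < r &
    exists2 y, angle_repr alpha (theta' - theta) y & - pi < y <= pi]].

Definition frechet (N : nat) (x : nat -> kale) (p : kale) : R :=
  (2 * N%:R)^-1 * \sum_(n < N) kdist p (x n) ^+ 2.

(* The points p_1, ..., p_N are x 0, ..., x N.-1. *)
Definition barycenter (N : nat) (x : nat -> kale) : kale :=
  xget korigin [set p | forall q, frechet N x p <= frechet N x q].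

End Kale.

Section KaleMeasure.
Context {R : realType} (alpha : R) (mu : probability (kale alpha) R).

Definition kale_nondegenerate := forall theta theta' : R,
  pi <= angle_abs alpha (theta - theta') ->
  (mu (kray theta `|` kray theta') < 1)%E.

Definition kale_square_integrable :=
  (\int[mu]_q (kdist (korigin alpha) q ^+ 2)%:E < +oo)%E.

Definition folded_moment (theta : R) : R * R :=
  (\int[mu]_p (folding theta p).1, \int[mu]_p (folding theta p).2).

Definition kale_nonsticky :=
  let K := [set theta | 0 <= (folded_moment theta).1] in
  K^° !=set0 /\ forall theta, K^° theta -> 0 < (folded_moment theta).1.

(* When mu is nonsticky, the maximizer exists and is unique modulo alpha. *)
Definition mean_ang : R :=
  xget 0 [set theta | forall theta',
    (folded_moment theta').1 <= (folded_moment theta).1].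

Definition mean_rad : R := (folded_moment mean_ang).1.

Definition kale_mean : kale alpha := polar alpha mean_rad mean_ang.

Definition w_plus (theta : R) : R :=
  \int[mu]_(p in shadow_plus theta) kdist (korigin alpha) p.

Definition w_minus (theta : R) : R :=
  \int[mu]_(p in shadow_minus theta) kdist (korigin alpha) p.

Definition kappa (b : kale alpha) : R :=
  let y := (folding mean_ang b).2 in
  if y < 0 then w_plus mean_ang / mean_rad
  else if 0 < y then w_minus mean_ang / mean_rad
  else 0.

Definition plane_coord (z : R * R) (i : 'I_2) : R := if i == 0 then z.1 else z.2.

Definition mean_cov : 'M[R]_2 := \matrix_(i, j)
  fine (\int[pushforward mu (folding mean_ang)]_y
    (plane_coord (y - folding mean_ang kale_mean) i *
     plane_coord (y - folding mean_ang kale_mean) j)%:E)%E.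

End KaleMeasure.

Section Normal.
Context {R : realType}.

Definition mx_app (A : 'M[R]_2) (z : R * R) : R * R :=
  (A 0 0 * z.1 + A 0 1 * z.2, A 1 0 * z.1 + A 1 1 * z.2).

(* g is the law of A Z with Z standard normal in R^2 and A A^T = Sigma; the
   matrix A may be singular. *)
Definition centered_normal (Sigma : 'M[R]_2) (g : probability (R * R)%type R) :=
  exists2 A : 'M[R]_2, A *m A^T = Sigma &
    forall W : set (R * R), measurable W ->
      g W = pushforward (normal_prob 0 1 \x normal_prob 0 1)%E (mx_app A) W.

Lemma measurable_mx_app (A : 'M[R]_2) :
  measurable_fun [set: R * R] (mx_app A).
Proof.
apply/measurable_fun_pairP; split => /=;
  by apply: measurable_realfun.measurable_funD;
    apply: measurable_realfun.measurable_funM.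
Qed.

Lemma centered_normal_exists (Sigma : 'M[R]_2) :
  Sigma 0 1 = Sigma 1 0 -> 0 <= Sigma 0 0 -> 0 <= Sigma 1 1 ->
  Sigma 0 1 ^+ 2 <= Sigma 0 0 * Sigma 1 1 ->
  exists g, centered_normal Sigma g.
Proof.
move=> sym S00 S11 cs.
pose a := Num.sqrt (Sigma 0 0); pose b := Sigma 0 1 / a.
pose c := Num.sqrt (Sigma 1 1 - b ^+ 2).
pose A : 'M[R]_2 := \matrix_(i, j)
  if i == 0 then (if j == 0 then a else 0) else (if j == 0 then b else c).
have a2 : a * a = Sigma 0 0 by rewrite -expr2 sqr_sqrtr.
have ab : a * b = Sigma 0 1.
  rewrite /b; have [a0|a0] := eqVneq a 0; last by rewrite mulrC divfK.
  rewrite a0 mul0r; move: cs; rewrite -a2 a0 !mul0r => cs.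
  by apply/esym/eqP; rewrite -sqrf_eq0 eq_le cs sqr_ge0.
have bS : b ^+ 2 <= Sigma 1 1.
  have [a0|a0] := eqVneq a 0; first by rewrite /b a0 invr0 mulr0 expr0n.
  have a2_gt0 : 0 < Sigma 0 0 by rewrite -a2 -expr2 exprn_even_gt0.
  by rewrite expr_div_n [a ^+ 2]expr2 a2 ler_pdivrMr// (mulrC (Sigma 1 1)).
have c2 : b * b + c * c = Sigma 1 1.
  by rewrite -!expr2 [c ^+ 2]sqr_sqrtr ?subr_ge0// addrC subrK.
have AS : A *m A^T = Sigma.
  apply/matrixP => i j; rewrite !mxE big_ord_recr big_ord1 /= !mxE.
  have ord2 (k : 'I_2) : k = 0 \/ k = 1.
    by case: k => -[|[|//]] ?; [left|right]; exact/val_inj.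
  case: (ord2 i) => ->; case: (ord2 j) => -> /=.
  - by rewrite mul0r addr0.
  - by rewrite mul0r addr0.
  - by rewrite mulr0 addr0 mulrC ab.
  - exact: c2.
pose P0 : probability (measurableTypeR R) R := normal_prob 0 1.
have mA : @measurable_fun _ _ (measurableTypeR R * measurableTypeR R)%type
  (R * R)%type setT (mx_app A) by exact: measurable_mx_app.
pose f : {mfun (measurableTypeR R * measurableTypeR R)%type >-> (R * R)%type} :=
  HB.pack (mx_app A) (isMeasurableFun.Build _ _ _ _ _ mA).
exists (distribution (P0 \x P0)%E f : probability (R * R)%type R); exists A => //.
Qed.

End Normal.

Section Sampling.
Context {R : realType} {d d' : measure_display}
  {Omega : measurableType d} {T : measurableType d'}.

Definition mutually_independent (P : probability Omega R) (X : nat -> Omega -> T) :=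
  forall (s : seq nat) (A : nat -> set T), uniq s ->
    (forall n, measurable (A n)) ->
    P (\bigcap_(n in [set` s]) X n @^-1` A n) =
      (\prod_(n <- s) P (X n @^-1` A n))%E.

Definition identically_distributed (P : probability Omega R)
    (X : nat -> {RV P >-> T}) (mu : probability T R) :=
  forall n (A : set T), measurable A -> distribution P (X n) A = mu A.

End Sampling.

Section RescaledLaw.
Context {R : realType} (alpha : R) (mu : probability (kale alpha) R)
  {d : measure_display} {Omega : measurableType d} (P : probability Omega R).

Definition rescaled (p : nat -> Omega -> kale alpha) (N : nat) (w : Omega) : R * R :=
  let b := barycenter N (fun n => p n w) in
  let f := folding (mean_ang mu) b in
  (Num.sqrt N%:R * (f.1 - mean_rad mu),
   Num.sqrt N%:R * ((1 + kappa mu b) * f.2)).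

Definition rescaled_law (p : nat -> Omega -> kale alpha) (N : nat) :
    set (R * R) -> \bar R :=
  pushforward P (rescaled p N).

End RescaledLaw.

(* Main.v *)
(* The Frechet function of p_1, ..., p_N at (r, t) is r^2/2 - r M_N(t) + const,
   where M_N is the first coordinate of the folded moment of the empirical
   measure, so b_N = (max M_N, argmax M_N) as soon as max M_N > 0. Let m1, m2 be
   the empirical folded moments at theta^*, r_N the radius of b_N and psi the
   deviation of its angle from theta^*. Folding at theta^* + psi instead of
   theta^* rotates the plane by -psi, except that the shadow of theta^* stays on
   the negative first axis. The second folded moment vanishes at a maximizer of
   M_N, hence m2 = (m1 + w) sin psi + o(|psi|), where w is w^-(theta^* ) or
   w^+(theta^* ) according to the sign of psi. As m1 and r_N tend to r^* and
   psi = O(|m2|) = O(N^(-1/2)) in probability,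
   (1 + kappa) e_2.F b_N = (1 + kappa) r_N sin psi = m2 + o(N^(-1/2)),
   so the rescaled barycenter is asymptotic to the normalized sum of the i.i.d.
   centered plane vectors F_{theta^*} p_n - (r^*, 0), to which the central limit
   theorem applies. The latter is proved with the moments E cos(c + <t, V_N>):
   smoothing by a small Gaussian density bounds the lower limit of the integral
   of a nonnegative Lipschitz function, and this yields weak convergence. *)
From HB Require Import structures.
Require Import Defs.
From mathcomp Require Import all_boot all_order all_algebra.
From mathcomp Require Import all_classical all_reals all_analysis.
From mathcomp Require Import measurable_realfun ring lra.
Import Order.TTheory GRing.Theory Num.Theory.
Import numFieldNormedType.Exports.

Local Open Scope classical_set_scope.
Local Open Scope ring_scope.

Set Implicit Arguments.
Unset Strict Implicit.
Unset Printing Implicit Defensive.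

(** * Bounded measurable functions and Gaussian integrals *)

(** The kale carries the sigma-algebra generated by the [kdist]-open sets, on which 1-Lipschitz
    functions are evidently measurable. The first folded coordinate is 1-Lipschitz, so the second
    coordinate, the shadows and the angles near their boundary are all rewritten through first
    coordinates. The barycenter is a chosen minimizer; its measurability comes from the quadratic
    growth of the Frechet function, which controls the minima of slightly tilted functions. The
    geometry enters through one inequality: folding does not increase angular distances, so turning
    the folding angle by psi gives at most the first coordinate of the rotated plane. It survives
    sums and integrals, hence [kale_profile] treats [mu] and the empirical measures alike. The
    second moment has different one-sided slopes when a boundary ray of the shadow has mass. This
    accounts for the two weights, and for the punctured neighbourhoods of these rays that carry the
    error: their mass tends to 0 even if the rays are charged. The phase c in the cosine moments
    encodes the real and the imaginary part of a characteristic function at once and lets summands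
    be split off one by one. *)

Section BoundedMeasurable.
Context {d : measure_display} {T : measurableType d} {R : realType}.

Definition bounded_measurable (f : T -> R) :=
  measurable_fun setT f /\ exists M : R, forall x, `|f x| <= M.

Lemma bounded_measurable_cst (c : R) : bounded_measurable (cst c).
Proof. by split => //; exists `|c|. Qed.

Lemma bounded_measurableD (f g : T -> R) :
  bounded_measurable f -> bounded_measurable g ->
  bounded_measurable (fun x => f x + g x).
Proof.
move=> [mf [M fM]] [mg [N gN]]; split; first exact: measurable_funD.
by exists (M + N) => x; rewrite (le_trans (ler_normD _ _))// lerD.
Qed.

Lemma bounded_measurableM (f g : T -> R) :
  bounded_measurable f -> bounded_measurable g ->
  bounded_measurable (fun x => f x * g x).
Proof.
move=> [mf [M fM]] [mg [N gN]]; split; first exact: measurable_funM.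
by exists (M * N) => x; rewrite normrM ler_pM.
Qed.

Lemma bounded_measurableN (f : T -> R) :
  bounded_measurable f -> bounded_measurable (fun x => - f x).
Proof.
move=> [mf [M fM]]; split; first exact: measurable_funN.
by exists M => x; rewrite normrN.
Qed.

Lemma bounded_measurableB (f g : T -> R) :
  bounded_measurable f -> bounded_measurable g ->
  bounded_measurable (fun x => f x - g x).
Proof. by move=> bf bg; apply: bounded_measurableD => //; exact: bounded_measurableN. Qed.

Lemma bounded_measurable_cos (f : T -> R) :
  measurable_fun setT f -> bounded_measurable (fun x => cos (f x)).
Proof.
move=> mf; split; last by exists 1 => x; exact: cos_max.
by apply: (measurableT_comp _ mf); apply: continuous_measurable_fun; exact: continuous_cos.
Qed.

Lemma bounded_measurable_sin (f : T -> R) :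
  measurable_fun setT f -> bounded_measurable (fun x => sin (f x)).
Proof.
move=> mf; split; last by exists 1 => x; exact: sin_max.
by apply: (measurableT_comp _ mf); apply: continuous_measurable_fun; exact: continuous_sin.
Qed.

End BoundedMeasurable.

Section BoundedIntegral.
Context {d : measure_display} {T : measurableType d} {R : realType}.
Variable m : probability T R.

Lemma bounded_measurable_integrable (f : T -> R) :
  bounded_measurable f -> m.-integrable setT (EFin \o f).
Proof.
move=> [mf [M fM]]; apply: measurable_bounded_integrable => //.
  by rewrite [X in (X < _)%E]probability_setT ltry.
exists M; split; first exact: num_real.
by move=> x Mx y _; apply: (le_trans (fM y)); exact: ltW.
Qed.

Lemma EFin_Rintegral (f : T -> R) : m.-integrable setT (EFin \o f) ->
  (\int[m]_x f x)%:E = (\int[m]_x (f x)%:E)%E.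
Proof. by move=> fi; rewrite /Rintegral fineK//; exact: integrable_fin_num. Qed.

Lemma Rintegral_probability_cst (c : R) : \int[m]_x c = c.
Proof. by rewrite Rintegral_cst// [X in fine X]probability_setT mulr1. Qed.

Lemma Rintegral_le_bound (f : T -> R) (M : R) : measurable_fun setT f ->
  (forall x, `|f x| <= M) -> `|\int[m]_x f x| <= M.
Proof.
move=> mf fM.
have fi : m.-integrable setT (EFin \o f).
  by apply: bounded_measurable_integrable; split => //; exists M.
apply: (le_trans (le_normr_Rintegral _ fi)) => //.
rewrite -[leRHS]Rintegral_probability_cst; apply: le_Rintegral => //; first exact: integrable_norm.
by apply: bounded_measurable_integrable; exact: bounded_measurable_cst.
Qed.

Lemma bounded_convergence (f : nat -> T -> R) (g : T -> R) (M : R) :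
  (forall n, measurable_fun setT (f n)) ->
  (forall n x, `|f n x| <= M) ->
  (forall x, f n x @[n --> \oo] --> g x) ->
  \int[m]_x f n x @[n --> \oo] --> \int[m]_x g x.
Proof.
move=> mf fM fg; apply: fine_cvg.
have gM x : `|g x| <= M.
  by apply: (cvgr_to_le (cvg_norm (fg x))); exact: nearW.
have mg : measurable_fun setT g by apply: measurable_fun_cvg mf _ => x _; exact: fg.
rewrite fineK; last first.
  apply: integrable_fin_num => //.
  by apply: bounded_measurable_integrable; split => //; exists M.
apply: (@dominated_cvg _ _ _ m setT _ _ _ (EFin \o cst M)) => //.
- by move=> n; exact/measurable_EFinP.
- by move=> x _; apply: cvg_EFin; [exact: nearW|exact: fg].
- by apply: bounded_measurable_integrable; exact: bounded_measurable_cst.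
- by move=> n x _; rewrite lee_fin.
Qed.

End BoundedIntegral.

Section BoundedFubini.
Context {d1 d2 : measure_display} {T1 : measurableType d1}
  {T2 : measurableType d2} {R : realType}.
Variables (m1 : probability T1 R) (m2 : probability T2 R).
Variable f : T1 * T2 -> R.
Hypothesis bf : bounded_measurable f.

Lemma bounded_measurable_pair1 x : bounded_measurable (fun y => f (x, y)).
Proof.
case: bf => mf [M fM]; split; last by exists M => y; exact: fM.
exact: (measurableT_comp mf (measurable_pair1 _)).
Qed.

Lemma bounded_measurable_pair2 y : bounded_measurable (fun x => f (x, y)).
Proof.
case: bf => mf [M fM]; split; last by exists M => x; exact: fM.
exact: (measurableT_comp mf (measurable_pair2 _)).
Qed.

Lemma bounded_prod_integrable :
  (m1 \x m2)%E.-integrable setT (EFin \o f).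
Proof.
have mT : ((m1 \x m2)%E setT < +oo)%E.
  rewrite -setXTT product_measure1E// [X in (X * _)%E]probability_setT.
  by rewrite [X in (_ * X)%E]probability_setT mule1 ltry.
case: bf => mf [M fM]; apply: measurable_bounded_integrable => //.
exists M; split; first exact: num_real.
by move=> x Mx y _; apply: (le_trans (fM y)); exact: ltW.
Qed.

(** [m1] serves to phrase integrability on the product, from which Fubini yields measurability in
    the parameter. Where the first factor has no natural measure, a Gaussian law is passed. *)
Lemma bounded_measurable_Rintegral :
  bounded_measurable (fun x => \int[m2]_y f (x, y)).
Proof.
case: (bf) => mf [M fM]; split; last first.
  exists M => x; apply: Rintegral_le_bound => [|y]; last exact: fM.
  by have [] := bounded_measurable_pair1 x.
apply/measurable_EFinP.
rewrite (_ : EFin \o _ = fubini_F m2 (EFin \o f)).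
  by apply: measurable_fubini_F; exact: bounded_prod_integrable.
apply/funext => x /=; rewrite EFin_Rintegral//.
by apply: bounded_measurable_integrable; exact: bounded_measurable_pair1.
Qed.

Lemma bounded_Fubini :
  \int[m1]_x \int[m2]_y f (x, y) = \int[m2]_y \int[m1]_x f (x, y).
Proof.
rewrite /Rintegral; congr fine.
transitivity (\int[m1]_x \int[m2]_y (EFin \o f) (x, y))%E.
  apply: eq_integral => x _; rewrite fineK//.
  apply: integrable_fin_num => //.
  by apply: bounded_measurable_integrable; exact: bounded_measurable_pair1.
rewrite Fubini; last exact: bounded_prod_integrable.
apply: eq_integral => y _; rewrite fineK//.
apply: integrable_fin_num => //.
by apply: bounded_measurable_integrable; exact: bounded_measurable_pair2.
Qed.

End BoundedFubini.

(** * Normal densities and their first moments *)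

Section NormalDensity.
Context {R : realType}.
Local Notation lambda := (@lebesgue_measure R).

(** Change of variables along the Radon-Nikodym derivative, which agrees with [normal_pdf] almost
    everywhere because both have the same integrals over measurable sets. *)
Lemma Rintegral_normal_prob (m s : R) (f : R -> R) : s != 0 ->
  bounded_measurable (f : measurableTypeR R -> R) ->
  \int[normal_prob m s]_x f x = \int[lambda]_x (f x * normal_pdf m s x).
Proof.
move=> s0 bf; have [mf _] := bf; rewrite /Rintegral; congr fine.
under [RHS]eq_integral do rewrite EFinM.
rewrite -(Radon_Nikodym_change_of_variables (normal_prob_dominates m s))//=;
  last exact: (bounded_measurable_integrable (normal_prob m s) bf).
apply: ae_eq_integral => //.
- apply: emeasurable_funM; first exact/measurable_EFinP.
  apply: (measurable_int lambda).
  by apply: Radon_Nikodym_integrable; exact: normal_prob_dominates.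
- apply: emeasurable_funM; first exact/measurable_EFinP.
  by apply/measurable_EFinP; exact: measurable_normal_pdf.
- apply: ae_eqe_mul2l => /=.
  rewrite Radon_NikodymE//=; first exact: normal_prob_dominates.
  move=> abmu; case: cid => /= h [h1 h2 h3].
  apply: integral_ae_eq => //=.
  + by apply/measurable_EFinP; exact: measurable_normal_pdf.
  + by move=> E E01 mE; rewrite -h3.
Qed.

Lemma norm_le_expR_sqr (u : R) : `|u| <= expR (u ^+ 2 / 4).
Proof.
apply: (@le_trans _ _ (1 + u ^+ 2 / 4)); last exact: expR_ge1Dx.
rewrite -(real_normK (num_real u)) -subr_ge0.
rewrite (_ : _ - _ = (`|u| / 2 - 1) ^+ 2); last by field.
exact: sqr_ge0.
Qed.

(** Doubling the variance absorbs a linear factor: with u = (y - m) / s, |u| exp(- u^2 / 2) is at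
    most exp(- u^2 / 4). First moments, majorants and the decay at infinity are all read off from
    the wider density. *)
Lemma normal_pdf_first_moment (m s y : R) : 0 < s ->
  `|y - m| * normal_pdf m s y <= Num.sqrt 2 * s * normal_pdf m (Num.sqrt 2 * s) y.
Proof.
move=> s0; have t0 : 0 < Num.sqrt 2 * s :> R by rewrite mulr_gt0// sqrtr_gt0.
rewrite !normal_pdfE ?gt_eqF// /normal_peak /normal_fun.
rewrite exprMn sqr_sqrtr//.
rewrite (_ : 2 * s ^+ 2 * pi *+ 2 = 2 * (s ^+ 2 * pi *+ 2)); last by ring.
rewrite sqrtrM// invfM.
set p := (Num.sqrt (s ^+ 2 * pi *+ 2))^-1.
rewrite (_ : Num.sqrt 2 * s * _ = s * p * expR (- (y - m) ^+ 2 / (2 * s ^+ 2 *+ 2))); last first.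
  by field; rewrite gt_eqF// sqrtr_gt0.
rewrite mulrCA -mulrA [s * _]mulrCA ler_wpM2l ?invr_ge0 ?sqrtr_ge0//.
have -> : y - m = s * ((y - m) / s) by field; rewrite gt_eqF.
set u := (y - m) / s; rewrite normrM gtr0_norm// -mulrA ler_wpM2l ?(ltW s0)//.
rewrite (_ : - _ / _ = - (u ^+ 2 / 4) - (u ^+ 2 / 4)); last by field; rewrite gt_eqF.
rewrite expRD (_ : - (s * u) ^+ 2 / _ = - (u ^+ 2 / 4)); last by field; rewrite gt_eqF.
rewrite mulrA ler_piMl ?expR_ge0// expRN.
by rewrite ler_pdivrMr ?expR_gt0// mul1r norm_le_expR_sqr.
Qed.

End NormalDensity.

(** * The Fourier transform of the normal law *)

Section NormalFourier.
Context {R : realType}.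
Variable c : R.
Local Notation lambda := (@lebesgue_measure R).
Local Notation g := (@normal_pdf R 0 1).

Let gE x : g x = normal_peak 1 * expR (- x ^+ 2 / 2).
Proof.
by rewrite normal_pdfE ?oner_neq0// /normal_fun subr0 expr1n.
Qed.

Let mg : measurable_fun setT g. Proof. exact: measurable_normal_pdf. Qed.

Let xg_integrable : lambda.-integrable setT (fun x => (`|x| * g x)%:E).
Proof.
apply: (@le_integrable _ _ _ lambda setT _ _
  (fun x => (Num.sqrt 2)%:E * (normal_pdf 0 (Num.sqrt 2) x)%:E)%E) => //.
- by apply/measurable_EFinP; apply: measurable_funM => //; exact: measurableT_comp.
- move=> x _; rewrite /= lee_fin ger0_norm ?mulr_ge0 ?normal_pdf_ge0//.
  apply: le_trans (ler_norm _).
  by have := @normal_pdf_first_moment R 0 1 x ltr01; rewrite !subr0 mulr1.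
- by apply: integrableZl => //; exact: integrable_normal_pdf.
Qed.

Let gM_integrable (f : R -> R) : bounded_measurable (f : measurableTypeR R -> R) ->
  lambda.-integrable setT (fun x => (f x * g x)%:E).
Proof.
move=> [mf [M fM]].
apply: (@le_integrable _ _ _ lambda setT _ _ (fun x => M%:E * (g x)%:E)%E) => //.
- by apply/measurable_EFinP; exact: measurable_funM.
- move=> x _; rewrite /= lee_fin !normrM ler_wpM2r//.
  exact: le_trans (fM x) (ler_norm _).
- by apply: integrableZl => //; exact: integrable_normal_pdf.
Qed.

Let xgM_integrable (f : R -> R) : bounded_measurable (f : measurableTypeR R -> R) ->
  lambda.-integrable setT (fun x => (f x * (x * g x))%:E).
Proof.
move=> [mf [M fM]].
apply: (@le_integrable _ _ _ lambda setT _ _ (fun x => M%:E * (`|x| * g x)%:E)%E) => //.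
- by apply/measurable_EFinP; apply: measurable_funM => //; exact: measurable_funM.
- move=> x _; rewrite /= lee_fin !normrM normr_id ler_wpM2r// ?mulr_ge0//.
  exact: le_trans (fM x) (ler_norm _).
- exact: integrableZl.
Qed.

Let bcos t : bounded_measurable ((fun x : R => cos (c + t * x)) : measurableTypeR R -> R).
Proof. by apply: bounded_measurable_cos; apply: measurable_funD => //; exact: measurable_funM. Qed.

Let bsin t : bounded_measurable ((fun x : R => sin (c + t * x)) : measurableTypeR R -> R).
Proof. by apply: bounded_measurable_sin; apply: measurable_funD => //; exact: measurable_funM. Qed.

Let is_derive_g (x : R) : is_derive x 1 g (- x * g x).
Proof.
rewrite (_ : g = fun x => normal_peak 1 * expR (- x ^+ 2 / 2)); last exact/funext/gE.
by apply: is_derive_eq; rewrite /GRing.scale/=; field.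
Qed.

(** A sequence with absolute values n + 1 covers both endpoints of the growing intervals in [ibp].
    The decay of order 1 / n comes from [normal_pdf_first_moment]. *)
Let g_vanish (F : R -> R) : (forall x, `|F x| <= g x) ->
  forall e : nat -> R, (forall n, `|e n| = n.+1%:R) ->
  F (e n) @[n --> \oo] --> (0 : R).
Proof.
move=> Fg e en.
pose C := Num.sqrt 2 * normal_peak (Num.sqrt 2) : R.
have H n : `|F (e n)| <= C * n.+1%:R^-1.
  rewrite ler_pdivlMr// mulrC -(en n).
  apply: (@le_trans _ _ (`|e n| * g (e n))); first by rewrite ler_wpM2l.
  have := @normal_pdf_first_moment R 0 1 (e n) ltr01; rewrite !subr0 mulr1.
  move/le_trans; apply; rewrite /C ler_wpM2l//; apply: normal_pdf_ub.
  by rewrite gt_eqF// sqrtr_gt0.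
apply: norm_cvg0.
apply: (@squeeze_cvgr _ _ _ _ (cst 0) (fun n => C * n.+1%:R^-1)).
- by apply: nearW => n; rewrite normr_ge0 H.
- exact: cvg_cst.
- rewrite -(mulr0 C); apply: cvgM; first exact: cvg_cst.
  exact: cvg_harmonic.
Qed.

(** Integration by parts: since g' = - x g, the difference of the integrands is the derivative of
    sin (c + t x) g x, whose boundary terms vanish at infinity. *)
Let ibp t : t * \int[lambda]_x (cos (c + t * x) * g x) =
  \int[lambda]_x (sin (c + t * x) * (x * g x)).
Proof.
pose f x := t * (cos (c + t * x) * g x) - sin (c + t * x) * (x * g x).
pose F x := sin (c + t * x) * g x.
have dF (x : R) : is_derive x 1 F (f x).
  have ds : is_derive x 1 (fun y : R => sin (c + t * y)) (t * cos (c + t * x)).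
    by apply: is_derive_eq; rewrite /GRing.scale/=; ring.
  have h := is_deriveM ds (is_derive_g x).
  suff -> : f x = sin (c + t * x) *: (- x * g x) + g x *: (t * cos (c + t * x)) by exact: h.
  by rewrite /f /GRing.scale/=; ring.
have Fg x : `|F x| <= g x.
  rewrite /F normrM [X in _ * X]ger0_norm ?normal_pdf_ge0//.
  by rewrite ler_piMl ?normal_pdf_ge0// sin_max.
have fi : lambda.-integrable setT (EFin \o f).
  rewrite /comp; under eq_fun do rewrite /f EFinB.
  apply: integrableB => //; last exact: xgM_integrable.
  by under eq_fun do rewrite EFinM; apply: integrableZl => //; exact: gM_integrable.
have cf : continuous f.
  have cl (h : R -> R) : continuous h -> continuous (fun x => h (c + t * x)).
    move=> ch x; apply: continuous_comp; last exact: ch.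
    by apply: cvgD; [exact: cvg_cst|exact: mulrl_continuous].
  have cg : continuous g by apply: continuous_normal_pdf; exact: oner_neq0.
  move=> x; apply: cvgB.
    by apply: cvgM; [exact: cvg_cst|apply: cvgM; [exact/cl/continuous_cos|exact: cg]].
  apply: cvgM; first exact/cl/continuous_sin.
  by apply: cvgM; [exact: cvg_id|exact: cg].
have I0 : (\int[lambda]_x (f x)%:E = 0)%E.
  pose D n : set R := `[- n.+1%:R, n.+1%:R]%classic.
  have FTC n : (\int[lambda]_(x in D n) (f x)%:E)%E =
     (F n.+1%:R - F (- n.+1%:R))%:E.
    rewrite (@continuous_FTC2 _ f F) ?EFinB//.
    - by rewrite gtrN.
    - by apply: continuous_subspaceT.
    - split.
      + by move=> x _; have [] := dF x.
      + apply: cvg_at_right_filter; apply: differentiable_continuous.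
        by apply/derivable1_diffP; have [] := dF (- n.+1%:R).
      + apply: cvg_at_left_filter; apply: differentiable_continuous.
        by apply/derivable1_diffP; have [] := dF (n.+1%:R).
    - by move=> x _; rewrite derive1E; have [_ ->] := dF x.
  have L1 : (\int[lambda]_(x in D n) (f x)%:E)%E @[n --> \oo] --> (\int[lambda]_x (f x)%:E)%E.
    under eq_fun do rewrite integral_mkcond.
    apply: (@dominated_cvg _ _ _ lambda setT _ _ _ (fun x => `|f x|%:E)) => //.
    - move=> n; apply/(measurable_restrictT _ _).1 => //; first exact: measurable_itv.
      by apply: measurable_funTS; exact: (measurable_int lambda).
    - move=> x _; apply: cvg_near_cst; near=> n.
      rewrite patchE mem_set// /D/= in_itv/= -ler_norml.
      rewrite (@le_trans _ _ n%:R) ?ler_nat//.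
      by near: n; exact: nbhs_infty_ger.
    - exact: integrable_norm.
    - by move=> n x _; rewrite patchE; case: ifP => // _; rewrite abse0 lee_fin.
  have L2 : (\int[lambda]_(x in D n) (f x)%:E)%E @[n --> \oo] --> 0%E.
    under eq_fun do rewrite FTC.
    apply: cvg_EFin; first exact: nearW.
    rewrite -(subr0 (0 : R)); apply: cvgB.
      by apply: g_vanish => // n; rewrite ger0_norm.
    by apply: g_vanish => // n; rewrite normrN ger0_norm.
  exact: cvg_unique L1 L2.
apply/eqP; rewrite -subr_eq0; apply/eqP.
rewrite -RintegralZl//; last exact: gM_integrable.
rewrite -RintegralB//.
- by rewrite /Rintegral I0.
- by rewrite /comp; under eq_fun do rewrite EFinM; apply: integrableZl => //; exact: gM_integrable.
- exact: xgM_integrable.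
Unshelve. all: end_near. Qed.


Let phi t := \int[lambda]_x (cos (c + t * x) * g x).

(** Differentiating under the integral, with majorant |y| g y, produces the right side of [ibp],
    which closes up into a linear differential equation. *)
Let is_derive_phi (t : R) : is_derive t 1 phi (- (t * phi t)).
Proof.
pose f (t x : R) := cos (c + t * x) * g x.
have df (u y : R) : is_derive u 1 (f ^~ y) (- (sin (c + u * y) * (y * g y))).
  have dc : is_derive u 1 (fun v : R => cos (c + v * y)) (- (y * sin (c + u * y))).
    by apply: is_derive_eq; rewrite /GRing.scale/=; ring.
  have dg : is_derive u 1 (cst (g y)) 0 by exact: is_derive_cst.
  have h := is_deriveM dc dg.
  suff -> : - (sin (c + u * y) * (y * g y)) =
    cos (c + u * y) *: 0 + g y *: - (y * sin (c + u * y)) by exact: h.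
  by rewrite /GRing.scale/=; ring.
have It : `]t - 1, t + 1[%classic t by rewrite /= in_itv/= gtrBl ltrDl ltr01.
have I1 (u : R) : `]t - 1, t + 1[%classic u -> lambda.-integrable setT (EFin \o f u).
  by move=> _; exact: gM_integrable.
have I2 (u y : R) : `]t - 1, t + 1[%classic u -> setT y -> derivable (f ^~ y) u 1.
  by move=> _ _; have [] := df u y.
have p1E u y : partial1of2 f u y = - (sin (c + u * y) * (y * g y)).
  by rewrite partial1of2E; have [_ ->] := df u y.
have G0 y : 0 <= `|y| * g y by rewrite mulr_ge0// normal_pdf_ge0.
have G1 (u y : R) : `]t - 1, t + 1[%classic u -> setT y ->
    `|partial1of2 f u y| <= `|y| * g y.
  move=> _ _; rewrite p1E normrN !normrM [`|g y|]ger0_norm ?normal_pdf_ge0//.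
  by rewrite ler_piMl// sin_max.
apply: DeriveDef.
  exact: (derivable_under_integral measurableT It I1 I2 G0 xg_integrable G1).
rewrite -derive1E (differentiation_under_integral measurableT It I1 I2 G0 xg_integrable G1).
rewrite /phi ibp -mulN1r -RintegralZl//; last exact: xgM_integrable.
by apply: eq_Rintegral => y _; rewrite p1E mulN1r.
Qed.

(** By the equation phi' = - t phi the product phi(t) exp(t^2 / 2) is constant, and its value at 0
    is cos c. *)
Lemma normal_cos_moment (t : R) :
  \int[normal_prob 0 1]_x cos (c + t * x) = cos c * expR (- (t ^+ 2 / 2)).
Proof.
rewrite Rintegral_normal_prob ?oner_neq0//.
rewrite -/(phi t) expRN; apply: (canRL (mulfK _)); first by rewrite gt_eqF// expR_gt0.
pose h (u : R) := phi u * expR (u ^+ 2 / 2).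
have dh (u : R) : is_derive u 1 h 0.
  have de : is_derive u 1 (fun v : R => expR (v ^+ 2 / 2)) (u * expR (u ^+ 2 / 2)).
    by apply: is_derive_eq; rewrite /GRing.scale/=; field.
  have k := is_deriveM (is_derive_phi u) de.
  suff -> : 0 = phi u *: (u * expR (u ^+ 2 / 2)) + expR (u ^+ 2 / 2) *: - (u * phi u)
    by exact: k.
  by rewrite /GRing.scale/=; ring.
transitivity (h 0); first exact: is_derive_0_is_cst.
rewrite /h expr0n mul0r expR0 mulr1 /phi /Rintegral.
under eq_integral do rewrite mul0r addr0 EFinM.
by rewrite integralZl//; [rewrite integral_normal_pdf mule1|exact: integrable_normal_pdf].
Qed.

End NormalFourier.

(** * Lebesgue measure and normal densities in the plane *)

Section PlaneLebesgue.
Context {R : realType}.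
Local Notation RR := (measurableTypeR R * measurableTypeR R)%type.

Definition lebesgue_square : set RR -> \bar R :=
  (@lebesgue_measure R \x @lebesgue_measure R)%E.

HB.instance Definition _ := Measure.on lebesgue_square.

Lemma lebesgue_square_sigma_finite : sigma_finite setT lebesgue_square.
Proof.
pose I n : set R := `[- n%:R, n%:R]%classic.
exists (fun n => I n `*` I n).
  apply/esym; rewrite -subTset => -[x y] _.
  pose n := (Num.truncn (Num.max `|x| `|y|)).+1.
  have h z : `|z| <= Num.max `|x| `|y| -> I n z.
    move=> zm; rewrite /I/= in_itv/= -ler_norml (le_trans zm)//.
    by apply/ltW/truncnS_gt.
  by exists n => //; split; apply: h; rewrite le_max lexx ?orbT.
move=> n; split; first by apply: measurableX; exact: measurable_itv.
have E : (lebesgue_measure (I n) < +oo)%E.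
  by rewrite /I lebesgue_measure_itv/=; case: ifP => _; rewrite ltry.
rewrite /lebesgue_square product_measure1E; [|exact: measurable_itv..].
by rewrite lte_mul_pinfty// ge0_fin_numE.
Qed.

HB.instance Definition _ :=
  Measure_isSigmaFinite.Build _ _ _ lebesgue_square lebesgue_square_sigma_finite.

Definition plane_lebesgue : {sigma_finite_measure set RR -> \bar R} :=
  lebesgue_square.

Lemma ge0_integral_plane_lebesgue_prod (a b : R -> R) :
  measurable_fun setT a -> measurable_fun setT b ->
  (forall x, 0 <= a x) -> (forall x, 0 <= b x) ->
  (\int[plane_lebesgue]_y (a y.1 * b y.2)%:E =
   (\int[lebesgue_measure]_x (a x)%:E) * \int[lebesgue_measure]_x (b x)%:E)%E.
Proof.
move=> ma mb a0 b0.
rewrite (@fubini_tonelli1 _ _ _ _ _ _ _ (fun y : RR => (a y.1 * b y.2)%:E))/=; first last.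
- by move=> y; rewrite lee_fin mulr_ge0.
- apply/measurable_EFinP; apply: measurable_funM.
    exact: (measurableT_comp ma measurable_fst).
  exact: (measurableT_comp mb measurable_snd).
rewrite /fubini_F/= -ge0_integralZr//; last first.
- by apply: integral_ge0 => x _; rewrite lee_fin.
- by move=> x _; rewrite lee_fin.
- exact/measurable_EFinP.
apply: eq_integral => x _; under eq_integral do rewrite EFinM.
rewrite ge0_integralZl ?lee_fin//; first exact/measurable_EFinP.
by move=> y _; rewrite lee_fin.
Qed.

End PlaneLebesgue.

Section PlaneNormal.
Context {R : realType}.
Local Notation RR := (measurableTypeR R * measurableTypeR R)%type.

Definition plane_normal_pdf (s : R) (m y : R * R) : R :=
  normal_pdf m.1 s y.1 * normal_pdf m.2 s y.2.

Lemma plane_normal_pdf_ge0 s m y : 0 <= plane_normal_pdf s m y.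
Proof. by rewrite mulr_ge0 ?normal_pdf_ge0. Qed.

Lemma integral_plane_normal_pdf s m :
  (\int[plane_lebesgue]_y (plane_normal_pdf s m y)%:E = 1)%E.
Proof.
rewrite ge0_integral_plane_lebesgue_prod ?integral_normal_pdf ?mule1//;
  by [exact: measurable_normal_pdf|exact: normal_pdf_ge0].
Qed.

Lemma integral_norm_normal_pdf (m s : R) : 0 < s ->
  (\int[lebesgue_measure]_y (`|y - m| * normal_pdf m s y)%:E <= (Num.sqrt 2 * s)%:E)%E.
Proof.
move=> s0.
apply: (@le_trans _ _ (\int[lebesgue_measure]_y ((Num.sqrt 2 * s)%:E * (normal_pdf m (Num.sqrt 2 * s) y)%:E))%E).
  apply: ge0_le_integral => //.
  - by move=> x _; rewrite lee_fin mulr_ge0// normal_pdf_ge0.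
  - apply/measurable_EFinP; apply: measurable_funM; last exact: measurable_normal_pdf.
    by apply: measurableT_comp => //; exact: measurable_funB.
  - by apply/measurable_EFinP; apply: measurable_funM => //; exact: measurable_normal_pdf.
  - by move=> x _; rewrite -EFinM lee_fin normal_pdf_first_moment.
rewrite ge0_integralZl ?integral_normal_pdf ?mule1// ?lee_fin//.
- by apply/measurable_EFinP; exact: measurable_normal_pdf.
- by move=> y _; rewrite lee_fin normal_pdf_ge0.
- by rewrite mulr_ge0// ltW.
Qed.

Lemma integral_norm_plane_normal_pdf (s : R) (m : R * R) : 0 < s ->
  (\int[plane_lebesgue]_y
    ((`|y.1 - m.1| + `|y.2 - m.2|) * plane_normal_pdf s m y)%:E
    <= (2 * Num.sqrt 2 * s)%:E)%E.
Proof.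
move=> s0.
have mn (c : R) : measurable_fun setT (fun x : R => `|x - c| * normal_pdf c s x).
  apply: measurable_funM; last exact: measurable_normal_pdf.
  by apply: measurableT_comp => //; exact: measurable_funB.
have mp (c : R) : measurable_fun setT (normal_pdf c s) by exact: measurable_normal_pdf.
have E (y : RR) : ((`|y.1 - m.1| + `|y.2 - m.2|) * plane_normal_pdf s m y)%:E =
    ((`|y.1 - m.1| * normal_pdf m.1 s y.1 * normal_pdf m.2 s y.2)%:E +
    (normal_pdf m.1 s y.1 * (`|y.2 - m.2| * normal_pdf m.2 s y.2))%:E)%E.
  by rewrite -EFinD /plane_normal_pdf; congr EFin; ring.
under eq_integral do rewrite E.
have p0 (c x : R) : 0 <= normal_pdf c s x by exact: normal_pdf_ge0.
have q0 (c x : R) : 0 <= `|x - c| * normal_pdf c s x by rewrite mulr_ge0.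
rewrite ge0_integralD//.
- have /= -> := ge0_integral_plane_lebesgue_prod (mn m.1) (mp m.2) (q0 _) (p0 _).
  have /= -> := ge0_integral_plane_lebesgue_prod (mp m.1) (mn m.2) (p0 _) (q0 _).
  rewrite !integral_normal_pdf mule1 mul1e.
  rewrite (_ : (2 * _ * _)%:E = (Num.sqrt 2 * s)%:E + (Num.sqrt 2 * s)%:E)%E; last first.
    by rewrite -EFinD; congr EFin; ring.
  by apply: leeD; exact: integral_norm_normal_pdf.
- by move=> y _; rewrite lee_fin mulr_ge0.
- apply/measurable_EFinP; apply: measurable_funM.
    exact: (measurableT_comp (mn m.1) measurable_fst).
  exact: (measurableT_comp (mp m.2) measurable_snd).
- by move=> y _; rewrite lee_fin mulr_ge0.
- apply/measurable_EFinP; apply: measurable_funM.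
    exact: (measurableT_comp (mp m.1) measurable_fst).
  exact: (measurableT_comp (mn m.2) measurable_snd).
Qed.

Definition plane_gauss : probability (measurableTypeR R * measurableTypeR R)%type R :=
  (normal_prob 0 1 \x normal_prob 0 1)%E.

(** The one-dimensional formula applies twice because, for a fixed first coordinate, a z.1 joins the
    phase. *)
Lemma plane_gauss_cos_moment (c a b : R) :
  \int[plane_gauss]_z cos (c + (a * z.1 + b * z.2)) =
  cos c * expR (- ((a ^+ 2 + b ^+ 2) / 2)).
Proof.
pose f (z : RR) : R := cos (c + (a * z.1 + b * z.2)).
have bf : bounded_measurable f.
  apply: bounded_measurable_cos; apply: measurable_funD => //.
  by apply: measurable_funD; apply: measurable_funM.
transitivity (\int[normal_prob 0 1]_x \int[normal_prob 0 1]_y f (x, y)).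
  rewrite /Rintegral; congr fine.
  rewrite -(@integral12_prod_meas1 _ _ _ _ _ (normal_prob 0 1) (normal_prob 0 1) (EFin \o f)).
    apply: eq_integral => x _; rewrite /fubini_F fineK//.
    apply: integrable_fin_num => //.
    exact: bounded_measurable_integrable (bounded_measurable_pair1 bf x).
  exact: bounded_prod_integrable.
rewrite /f/=.
under eq_Rintegral do (under eq_Rintegral do rewrite addrA; rewrite normal_cos_moment).
rewrite RintegralZr//; last first.
  apply: bounded_measurable_integrable; apply: bounded_measurable_cos.
  by apply: measurable_funD => //; exact: measurable_funM.
by rewrite normal_cos_moment -mulrA -expRD; congr (_ * expR _); ring.
Qed.

(** The Gaussian is its own Fourier transform up to scaling, which gives inversion by direct
    computation. The center m occurs on the right inside a cosine only, so that averaging over m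
    produces cosine moments. *)
Lemma plane_normal_pdf_fourier (s : R) (m y : R * R) : 0 < s ->
  plane_normal_pdf s m y = normal_peak s ^+ 2 *
    \int[plane_gauss]_z cos (- (y.1 / s * z.1 + y.2 / s * z.2) +
      (z.1 / s * m.1 + z.2 / s * m.2)).
Proof.
move=> s0.
have E (z : RR) : - (y.1 / s * z.1 + y.2 / s * z.2) + (z.1 / s * m.1 + z.2 / s * m.2) =
   0 + ((m.1 - y.1) / s * z.1 + (m.2 - y.2) / s * z.2).
  by field; rewrite gt_eqF.
under eq_Rintegral do rewrite E.
rewrite plane_gauss_cos_moment cos0 mul1r /plane_normal_pdf !normal_pdfE ?gt_eqF//.
rewrite /normal_fun mulrACA -expr2 -expRD; congr (_ * expR _).
by field; rewrite gt_eqF.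
Qed.

End PlaneNormal.

(** * Weak convergence from cosine moments *)

Section LipschitzPlane.
Context {R : realType}.

Definition plane_lipschitz (L : R) (phi : R * R -> R) := forall x y : R * R,
  `|phi x - phi y| <= L * (`|x.1 - y.1| + `|x.2 - y.2|).

End LipschitzPlane.

(** * Gaussian smoothing of Lipschitz functions and of laws *)

Section Smoothing.
Context {R : realType}.
Local Notation RR := (measurableTypeR R * measurableTypeR R)%type.

Lemma normal_pdf_shift (m s x : R) : s != 0 ->
  normal_pdf m s x = normal_pdf 0 s (x - m).
Proof. by move=> s0; rewrite !normal_pdfE// /normal_fun subr0. Qed.

Lemma measurable_plane_shift_product d (T : measurableType d) (k : R -> R)
    (u v : T -> RR) : measurable_fun setT k ->
  measurable_fun setT u -> measurable_fun setT v ->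
  measurable_fun setT (fun w => k ((v w).1 - (u w).1) * k ((v w).2 - (u w).2)).
Proof.
move=> mk mu mv; apply: measurable_funM; apply: (measurableT_comp mk); apply: measurable_funB.
- exact: (measurableT_comp measurable_fst mv).
- exact: (measurableT_comp measurable_fst mu).
- exact: (measurableT_comp measurable_snd mv).
- exact: (measurableT_comp measurable_snd mu).
Qed.

Lemma bounded_measurable_plane_normal_pdf d (T : measurableType d) (s : R)
    (u v : T -> R * R) : s != 0 ->
  measurable_fun setT (u : T -> RR) -> measurable_fun setT (v : T -> RR) ->
  bounded_measurable (fun w => plane_normal_pdf s (u w) (v w)).
Proof.
move=> s0 mu mv; split; last first.
  exists (normal_peak s * normal_peak s) => w.
  rewrite ger0_norm ?plane_normal_pdf_ge0// ler_pM ?normal_pdf_ge0//;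
    exact: normal_pdf_ub.
rewrite (_ : (fun w => _) = fun w => normal_pdf 0 s ((v w).1 - (u w).1) *
    normal_pdf 0 s ((v w).2 - (u w).2)); last first.
  by apply/funext => w; rewrite /plane_normal_pdf (normal_pdf_shift (u w).1)// (normal_pdf_shift (u w).2).
exact: (measurable_plane_shift_product (measurable_normal_pdf 0 s) mu mv).
Qed.

Variables (phi : R * R -> R) (L s : R).
Hypotheses (L0 : 0 <= L) (s0 : 0 < s).
Hypotheses (mphi : measurable_fun setT (phi : RR -> R)) (phi0 : forall x, 0 <= phi x).
Hypothesis phiL : plane_lipschitz L phi.

Let mK m : measurable_fun setT (plane_normal_pdf s m : RR -> R).
Proof.
by apply: (bounded_measurable_plane_normal_pdf (u := cst m) _ _ _).1; rewrite ?gt_eqF.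
Qed.

Let mdist (m : R * R) :
  measurable_fun setT ((fun y => `|y.1 - m.1| + `|y.2 - m.2|) : RR -> R).
Proof.
apply: measurable_funD; apply: measurableT_comp => //; apply: measurable_funB => //.
Qed.

(** Common form of [smoothing_le] and [smoothing_ge]: [phi] and the constant [phi m] take the places
    of a and b in either order. *)
Let smooth_dist (a b : RR -> R) (m : R * R) :
  measurable_fun setT a -> measurable_fun setT b ->
  (forall y, 0 <= a y) -> (forall y, 0 <= b y) ->
  (forall y, a y <= b y + L * (`|y.1 - m.1| + `|y.2 - m.2|)) ->
  (\int[plane_lebesgue]_y (a y * plane_normal_pdf s m y)%:E <=
   (\int[plane_lebesgue]_y (b y * plane_normal_pdf s m y)%:E)
     + (L * (2 * Num.sqrt 2 * s))%:E)%E.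
Proof.
move=> ma mb a0 b0 ab.
have K0 := plane_normal_pdf_ge0 s m.
have D0 (y : RR) : 0 <= (`|y.1 - m.1| + `|y.2 - m.2|) * plane_normal_pdf s m y.
  by rewrite mulr_ge0// addr_ge0.
apply: (@le_trans _ _ (\int[plane_lebesgue]_y ((b y * plane_normal_pdf s m y)%:E +
  L%:E * ((`|y.1 - m.1| + `|y.2 - m.2|) * plane_normal_pdf s m y)%:E))%E).
  apply: ge0_le_integral => //.
  - by move=> y _; rewrite lee_fin mulr_ge0.
  - by apply/measurable_EFinP; exact: measurable_funM.
  - apply/measurable_EFinP; apply: measurable_funD; first exact: measurable_funM.
    by apply: measurable_funM => //; apply: measurable_funM.
  - move=> y _; rewrite -EFinM -EFinD lee_fin [L * (_ * plane_normal_pdf _ _ _)]mulrA -mulrDl ler_wpM2r//.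
rewrite ge0_integralD//; last 4 first.
- by move=> y _; rewrite lee_fin mulr_ge0.
- by apply/measurable_EFinP; exact: measurable_funM.
- by move=> y _; rewrite -EFinM lee_fin mulr_ge0.
- apply/measurable_EFinP; apply: measurable_funM => //; exact: measurable_funM.
rewrite leeD2l// ge0_integralZl//; last 2 first.
- by apply/measurable_EFinP; exact: measurable_funM.
- by move=> y _; rewrite lee_fin.
by rewrite EFinM lee_wpmul2l ?lee_fin// integral_norm_plane_normal_pdf.
Qed.

Let smooth_cst (c : R) (m : R * R) : 0 <= c ->
  (\int[plane_lebesgue]_y (c * plane_normal_pdf s m y)%:E = c%:E)%E.
Proof.
move=> c0; under eq_integral do rewrite EFinM.
rewrite ge0_integralZl ?lee_fin ?integral_plane_normal_pdf ?mule1//.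
- exact/measurable_EFinP.
- by move=> y _; rewrite lee_fin plane_normal_pdf_ge0.
Qed.

Lemma smoothing_le (m : R * R) :
  (\int[plane_lebesgue]_y (phi y * plane_normal_pdf s m y)%:E <=
   (phi m)%:E + (L * (2 * Num.sqrt 2 * s))%:E)%E.
Proof.
rewrite -[X in (X + _)%E](smooth_cst m (phi0 m)).
apply: smooth_dist => // y; rewrite -lerBlDl.
exact: le_trans (ler_norm _) (phiL y m).
Qed.

Lemma smoothing_ge (m : R * R) :
  ((phi m)%:E <= (\int[plane_lebesgue]_y (phi y * plane_normal_pdf s m y)%:E)
   + (L * (2 * Num.sqrt 2 * s))%:E)%E.
Proof.
rewrite -[leLHS](smooth_cst m (phi0 m)).
apply: smooth_dist => // y; rewrite -lerBlDl.
apply: le_trans (ler_norm _) _; rewrite (le_trans (phiL m y))//.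
by rewrite (distrC m.1) (distrC m.2).
Qed.

Section Mixture.
Context {d : measure_display} {T : measurableType d}.
Variables (P : probability T R) (V : T -> R * R).
Hypothesis mV : measurable_fun setT (V : T -> RR).

(** Density of the law of [V] convolved with the centered normal law of covariance s^2 times the
    identity. *)
Definition smoothed_density (y : R * R) : R :=
  \int[P]_w plane_normal_pdf s (V w) y.

Lemma smoothed_density_ge0 y : 0 <= smoothed_density y.
Proof. by apply: Rintegral_ge0 => w _; exact: plane_normal_pdf_ge0. Qed.

Let bK y : bounded_measurable (fun w => plane_normal_pdf s (V w) y).
Proof.
by apply: (bounded_measurable_plane_normal_pdf (v := cst y)); rewrite ?gt_eqF.
Qed.

Let bKK : bounded_measurable
  (fun z : RR * T => plane_normal_pdf s (V z.2) z.1).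
Proof.
apply: (bounded_measurable_plane_normal_pdf (u := V \o snd) (v := fst)).
- by rewrite gt_eqF.
- exact: (measurableT_comp mV measurable_snd).
- exact: measurable_fst.
Qed.

Lemma measurable_smoothed_density : measurable_fun setT (smoothed_density : RR -> R).
Proof. by have [] := bounded_measurable_Rintegral plane_gauss P bKK. Qed.

Lemma integral_smoothed_density :
  (\int[plane_lebesgue]_y (phi y * smoothed_density y)%:E =
   \int[P]_w \int[plane_lebesgue]_y (phi y * plane_normal_pdf s (V w) y)%:E)%E.
Proof.
rewrite -(@fubini_tonelli _ _ RR T R plane_lebesgue P
  (fun z : RR * T => (phi z.1 * plane_normal_pdf s (V z.2) z.1)%:E))/=; last first.
- by move=> z; rewrite lee_fin mulr_ge0// plane_normal_pdf_ge0.
- apply/measurable_EFinP; apply: measurable_funM; last by case: bKK.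
  exact: (measurableT_comp mphi measurable_fst).
apply: eq_integral => y _; rewrite EFinM /smoothed_density.
rewrite EFin_Rintegral; last exact: bounded_measurable_integrable (bK y).
under [RHS]eq_integral do rewrite EFinM.
rewrite ge0_integralZl ?lee_fin//.
- by apply/measurable_EFinP; have [] := bK y.
- by move=> w _; rewrite lee_fin plane_normal_pdf_ge0.
Qed.

Let mS : measurable_fun setT
  (fun w => \int[plane_lebesgue]_y (phi y * plane_normal_pdf s (V w) y)%:E)%E.
Proof.
apply: (@measurable_fun_fubini_tonelli_F _ _ T RR R plane_lebesgue
  (fun z : T * RR => (phi z.2 * plane_normal_pdf s (V z.1) z.2)%:E)).
  apply/measurable_EFinP; apply: measurable_funM.
    exact: (measurableT_comp mphi measurable_snd).
  apply: (bounded_measurable_plane_normal_pdf (u := V \o fst) (v := snd) _ _ _).1.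
  - by rewrite gt_eqF.
  - exact: (measurableT_comp mV measurable_fst).
  - exact: measurable_snd.
by move=> z; rewrite lee_fin mulr_ge0// plane_normal_pdf_ge0.
Qed.

Let mphiV : measurable_fun setT (phi \o V).
Proof. exact: measurableT_comp mphi mV. Qed.

Let integralD_cst (f : T -> \bar R) (c : R) : measurable_fun setT f ->
  (forall w, 0 <= f w)%E -> 0 <= c ->
  (\int[P]_w (f w + c%:E) = \int[P]_w f w + c%:E)%E.
Proof.
move=> mf f0 c0; rewrite ge0_integralD//.
by rewrite integral_cst// [X in (_ * X)%E]probability_setT mule1.
Qed.

Let e0 : 0 <= L * (2 * Num.sqrt 2 * s).
Proof. by rewrite mulr_ge0// mulr_ge0 ?mulr_ge0 ?sqrtr_ge0// ltW. Qed.

Lemma integral_smoothed_density_le :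
  (\int[plane_lebesgue]_y (phi y * smoothed_density y)%:E <=
   (\int[P]_w (phi (V w))%:E) + (L * (2 * Num.sqrt 2 * s))%:E)%E.
Proof.
rewrite integral_smoothed_density -integralD_cst//.
- apply: ge0_le_integral => //.
  + by move=> w _; apply: integral_ge0 => y _; rewrite lee_fin mulr_ge0// plane_normal_pdf_ge0.
  + apply: emeasurable_funD => //; exact/measurable_EFinP.
  + by move=> w _; exact: smoothing_le.
- exact/measurable_EFinP.
- by move=> w; rewrite lee_fin.
Qed.

Lemma integral_smoothed_density_ge :
  (\int[P]_w (phi (V w))%:E <=
   (\int[plane_lebesgue]_y (phi y * smoothed_density y)%:E)
     + (L * (2 * Num.sqrt 2 * s))%:E)%E.
Proof.
have S0 w : (0 <= \int[plane_lebesgue]_y (phi y * plane_normal_pdf s (V w) y)%:E)%E.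
  by apply: integral_ge0 => y _; rewrite lee_fin mulr_ge0// plane_normal_pdf_ge0.
rewrite integral_smoothed_density -integralD_cst//.
apply: ge0_le_integral => //.
- by move=> w _; rewrite lee_fin.
- exact/measurable_EFinP.
- by apply: emeasurable_funD.
- by move=> w _; exact: smoothing_ge.
Qed.

End Mixture.
End Smoothing.

(** * Lower limits from the convergence of cosine moments *)

Section LevyLiminf.
Context {R : realType}.
Local Notation RR := (measurableTypeR R * measurableTypeR R)%type.

Section Fourier.
Context {d : measure_display} {T : measurableType d}.
Variables (P : probability T R) (V : T -> R * R).
Hypothesis mV : measurable_fun setT (V : T -> RR).

Let m1 : measurable_fun setT (fun w => (V w).1).
Proof. exact: (measurableT_comp measurable_fst mV). Qed.

Let m2 : measurable_fun setT (fun w => (V w).2).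
Proof. exact: (measurableT_comp measurable_snd mV). Qed.

(** Fubini moves the expectation inside the Gaussian average, so the smoothed density depends on [V]
    through its cosine moments alone. These are bounded by 1, so their pointwise convergence passes
    to the densities. *)
Lemma smoothed_density_fourier (s : R) (y : R * R) : 0 < s ->
  smoothed_density s P V y = normal_peak s ^+ 2 *
    \int[plane_gauss]_z \int[P]_w cos (- (y.1 / s * z.1 + y.2 / s * z.2) +
      (z.1 / s * (V w).1 + z.2 / s * (V w).2)).
Proof.
move=> s0; rewrite /smoothed_density.
under eq_Rintegral do rewrite plane_normal_pdf_fourier//.
pose f (x : T * RR) : R := cos (- (y.1 / s * x.2.1 + y.2 / s * x.2.2) +
      (x.2.1 / s * (V x.1).1 + x.2.2 / s * (V x.1).2)).
have m21 : measurable_fun setT (fun x : T * RR => x.2.1).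
  exact: (measurableT_comp measurable_fst measurable_snd).
have m22 : measurable_fun setT (fun x : T * RR => x.2.2).
  exact: (measurableT_comp measurable_snd measurable_snd).
have mV1 : measurable_fun setT (fun x : T * RR => (V x.1).1).
  exact: (measurableT_comp m1 measurable_fst).
have mV2 : measurable_fun setT (fun x : T * RR => (V x.1).2).
  exact: (measurableT_comp m2 measurable_fst).
have bf : bounded_measurable f.
  apply: bounded_measurable_cos; apply: measurable_funD.
    by apply: measurable_funN; apply: measurable_funD; apply: measurable_funM.
  by apply: measurable_funD; apply: measurable_funM => //; apply: measurable_funM.
rewrite RintegralZl//; last first.
  exact: bounded_measurable_integrable (bounded_measurable_Rintegral P plane_gauss bf).
by congr (_ * _); exact: (bounded_Fubini P plane_gauss bf).
Qed.

Lemma bounded_measurable_plane_cf (s : R) (y : R * R) : bounded_measurable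
  (fun z : RR => \int[P]_w cos (- (y.1 / s * z.1 + y.2 / s * z.2) +
      (z.1 / s * (V w).1 + z.2 / s * (V w).2))).
Proof.
pose f (x : RR * T) : R := cos (- (y.1 / s * x.1.1 + y.2 / s * x.1.2) +
      (x.1.1 / s * (V x.2).1 + x.1.2 / s * (V x.2).2)).
have m21 : measurable_fun setT (fun x : RR * T => x.1.1).
  exact: (measurableT_comp measurable_fst measurable_fst).
have m22 : measurable_fun setT (fun x : RR * T => x.1.2).
  exact: (measurableT_comp measurable_snd measurable_fst).
have mV1 : measurable_fun setT (fun x : RR * T => (V x.2).1).
  exact: (measurableT_comp m1 measurable_snd).
have mV2 : measurable_fun setT (fun x : RR * T => (V x.2).2).
  exact: (measurableT_comp m2 measurable_snd).
have bf : bounded_measurable f.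
  apply: bounded_measurable_cos; apply: measurable_funD.
    by apply: measurable_funN; apply: measurable_funD; apply: measurable_funM.
  by apply: measurable_funD; apply: measurable_funM => //; apply: measurable_funM.
exact: (bounded_measurable_Rintegral plane_gauss P bf).
Qed.

End Fourier.

Context {d : measure_display} {Omega : measurableType d} (P : probability Omega R).
Context {d' : measure_display} {S : measurableType d'} (Q : probability S R).
Variables (V : nat -> Omega -> R * R) (U : S -> R * R).
Hypothesis mV : forall n, measurable_fun setT (V n : Omega -> RR).
Hypothesis mU : measurable_fun setT (U : S -> RR).
Hypothesis cvg_cos : forall c a b : R,
  \int[P]_w cos (c + (a * (V n w).1 + b * (V n w).2)) @[n --> \oo] -->
  \int[Q]_w cos (c + (a * (U w).1 + b * (U w).2)).

Lemma cvg_smoothed_density (s : R) (y : R * R) : 0 < s ->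
  smoothed_density s P (V n) y @[n --> \oo] --> smoothed_density s Q U y.
Proof.
move=> s0; rewrite smoothed_density_fourier//.
under eq_fun do rewrite smoothed_density_fourier//.
apply: cvgM; first exact: cvg_cst.
apply: (@bounded_convergence _ _ _ plane_gauss _ _ 1).
- by move=> n; have [] := bounded_measurable_plane_cf P (mV n) s y.
- move=> n z; apply: Rintegral_le_bound; last by move=> w; exact: cos_max.
  apply: (bounded_measurable_cos _).1; apply: measurable_funD => //.
  apply: measurable_funD; apply: measurable_funM => //.
    exact: (measurableT_comp measurable_fst (mV n)).
  exact: (measurableT_comp measurable_snd (mV n)).
- by move=> z; exact: cvg_cos.
Qed.

(** Smoothing costs at most e / 3 under each law, and the smoothed densities converge pointwise.
    Part of the mass of [P] might still escape to infinity at this stage, hence the one-sided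
    claim. *)
Lemma lipschitz_liminf (phi : R * R -> R) (L M : R) : 0 <= L ->
  measurable_fun setT (phi : RR -> R) ->
  (forall x, 0 <= phi x <= M) -> plane_lipschitz L phi ->
  forall e, 0 < e ->
  \forall n \near \oo, \int[Q]_w phi (U w) - e <= \int[P]_w phi (V n w).
Proof.
move=> L0 mphi phiM phiL e e0.
have phi0 x : 0 <= phi x by have /andP[] := phiM x.
have bphi : bounded_measurable (phi : RR -> R).
  split => //; exists M => x; rewrite ger0_norm//.
  by have /andP[] := phiM x.
have iphi d1 (T1 : measurableType d1) (m : probability T1 R) (X : T1 -> R * R) :
    measurable_fun setT (X : T1 -> RR) -> m.-integrable setT (EFin \o (phi \o X)).
  move=> mX; apply: bounded_measurable_integrable.
  case: bphi => _ [K phiK]; split; first exact: measurableT_comp mphi mX.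
  by exists K => x; exact: phiK.
have Eiphi d1 (T1 : measurableType d1) (m : probability T1 R) (X : T1 -> R * R) :
    measurable_fun setT (X : T1 -> RR) ->
    (\int[m]_w phi (X w))%:E = (\int[m]_w (phi (X w))%:E)%E.
  by move=> mX; apply: EFin_Rintegral; exact: iphi.
pose C := L * (2 * Num.sqrt 2).
have C0 : 0 <= C by rewrite !mulr_ge0.
(* The scale makes the smoothing error C s at most e / 3; the added 1 keeps the denominator positive
   when L = 0. *)
pose s := e / 3 / (C + 1).
have s0 : 0 < s by rewrite !divr_gt0// ltr_wpDl.
have Cs : L * (2 * Num.sqrt 2 * s) <= e / 3.
  rewrite mulrA -/C /s mulrA ler_pdivrMr ?ltr_wpDl// mulrC ler_wpM2l ?lerDl//.
  by rewrite divr_ge0// ltW.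
pose p n := smoothed_density s P (V n).
pose q := smoothed_density s Q U.
have q0 y : 0 <= q y by exact: smoothed_density_ge0.
have p0 n y : 0 <= p n y by exact: smoothed_density_ge0.
have mq : measurable_fun setT (q : RR -> R) by exact: measurable_smoothed_density.
have mp n : measurable_fun setT (p n : RR -> R) by exact: measurable_smoothed_density.
have iq : plane_lebesgue.-integrable setT (fun y => (phi y * q y)%:E).
  apply/integrableP; split.
    by apply/measurable_EFinP; exact: measurable_funM.
  under eq_integral do rewrite gee0_abs ?lee_fin ?mulr_ge0//.
  apply: (le_lt_trans (integral_smoothed_density_le L0 s0 mphi phi0 phiL Q mU)).
  by rewrite -(Eiphi _ _ _ _ mU) ltry.
(* As in Scheffe's lemma: the minimum with [q] tends to [q] and is dominated by it, and as it lies
   below [p n] its limit bounds the integrals of [p n] from below. *)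
pose a n := (\int[plane_lebesgue]_y (phi y * Num.min (p n y) (q y))%:E)%E.
pose b := (\int[plane_lebesgue]_y (phi y * q y)%:E)%E.
have ab : a n @[n --> \oo] --> b.
  apply: (@dominated_cvg _ _ _ plane_lebesgue setT _ _ _ (fun y => (phi y * q y)%:E)) => //.
  - move=> n; apply/measurable_EFinP; apply: measurable_funM => //.
    exact: measurable_minr.
  - move=> y _; apply: cvg_EFin; first exact: nearW.
    apply: cvgM; first exact: cvg_cst.
    apply/cvgrPdist_lt => r r0; have /cvgrPdist_lt/(_ r r0) := @cvg_smoothed_density s y s0.
    apply: filterS => n; apply: le_lt_trans; rewrite -/(q y) -/(p n y).
    by case: (leP (p n y) (q y)) => // _; rewrite subrr normr0.
  - move=> n y _; rewrite lee_fin ger0_norm; last by rewrite mulr_ge0// le_min p0 q0.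
    by rewrite ler_wpM2l// ge_min lexx orbT.
have bfin : b \is a fin_num by exact: integrable_fin_num.
have ub : (\int[Q]_w phi (U w) <= fine b + e / 3).
  rewrite -lee_fin EFinD (fineK bfin) (Eiphi _ _ _ _ mU).
  apply: (le_trans (integral_smoothed_density_ge L0 s0 mphi phi0 phiL Q mU)).
  by rewrite leeD2l// lee_fin.
have aub n : (a n <= (\int[P]_w phi (V n w) + e / 3)%:E)%E.
  rewrite EFinD (Eiphi _ _ _ _ (mV n)).
  apply: (@le_trans _ _ (\int[plane_lebesgue]_y (phi y * p n y)%:E)%E).
    apply: ge0_le_integral => //.
    - by move=> y _; rewrite lee_fin mulr_ge0// le_min p0 q0.
    - by apply/measurable_EFinP; apply: measurable_funM => //; exact: measurable_minr.
    - by apply/measurable_EFinP; apply: measurable_funM.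
    - by move=> y _; rewrite lee_fin ler_wpM2l// ge_min lexx.
  apply: (le_trans (integral_smoothed_density_le L0 s0 mphi phi0 phiL P (mV n))).
  by rewrite leeD2l// lee_fin.
have afin n : a n \is a fin_num.
  rewrite ge0_fin_numE; first exact: le_lt_trans (aub n) (ltry _).
  by apply: integral_ge0 => y _; rewrite lee_fin mulr_ge0// le_min p0 q0.
have : (fine \o a) n @[n --> \oo] --> fine b by apply: fine_cvg; rewrite fineK.
move=> /cvgr_gt /(_ (fine b - e / 3)).
rewrite ltrBlDr ltrDl divr_gt0// => /(_ isT); apply: filterS => n /=.
have := aub n; rewrite -[a n]fineK// lee_fin; move: ub; lra.
Qed.

End LevyLiminf.

(** * Lipschitz envelopes of continuous functions *)

Section LipschitzEnvelope.
Context {R : realType}.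
Local Notation RR := (measurableTypeR R * measurableTypeR R)%type.

Definition plane_dist (x y : R * R) : R := `|x.1 - y.1| + `|x.2 - y.2|.

(** Enumerates the pairs of rationals; numbers that code no pair go to the origin, which is harmless
    because only the density of the range matters. *)
Definition rational_point (n : nat) : R * R :=
  let q := odflt (0, 0) (unpickle n : option (rat * rat)) in (ratr q.1, ratr q.2).

Lemma rational_point_dense (x : R * R) (e : R) : 0 < e ->
  exists n, `|x.1 - (rational_point n).1| < e /\ `|x.2 - (rational_point n).2| < e.
Proof.
move=> e0.
have h (y : R) : exists q : rat, `|y - ratr q| < e.
  have [q] := @rat_in_itvoo _ (y - e) (y + e) ltac:(lra).
  rewrite in_itv/= => /andP[q1 q2]; exists q; rewrite ltr_norml; apply/andP; split; lra.
have [q1 hq1] := h x.1; have [q2 hq2] := h x.2.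
by exists (pickle (q1, q2)); rewrite /rational_point pickleK.
Qed.

Variables (phi : R * R -> R) (M : R).
Hypothesis cphi : continuous phi.
Hypothesis phiM : forall x, 0 <= phi x <= M.

Let phi0 x : 0 <= phi x. Proof. by have /andP[] := phiM x. Qed.

Let cphiP (x : R * R) (e : R) : 0 < e -> exists2 r : R, 0 < r &
  forall y : R * R, `|x.1 - y.1| < r -> `|x.2 - y.2| < r -> `|phi x - phi y| < e.
Proof.
move=> e0; have /cvgrPdist_lt/(_ e e0)/nbhs_ballP[r /= r0 h] := @cphi x.
by exists r => // y y1 y2; apply: h.
Qed.

(** Infimal convolution of [phi] with k times the l1 distance. Restricting the infimum to rational
    points makes it countable, hence measurable, and continuity of [phi] keeps it below [phi]. *)
Definition lipschitz_envelope (k : R) (x : R * R) : R :=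
  inf (range (fun n => phi (rational_point n) + k * plane_dist x (rational_point n))).

Let dist_ge0 x y : 0 <= plane_dist x y. Proof. by rewrite addr_ge0. Qed.

Let term_ge0 k x n : 0 <= k ->
  0 <= phi (rational_point n) + k * plane_dist x (rational_point n).
Proof. by move=> k0; rewrite addr_ge0// mulr_ge0. Qed.

Let lb k x : 0 <= k -> has_lbound
  (range (fun n => phi (rational_point n) + k * plane_dist x (rational_point n))).
Proof. by move=> k0; exists 0 => _ [n _ <-]; exact: term_ge0. Qed.

Let ne k x : range (fun n => phi (rational_point n) +
  k * plane_dist x (rational_point n)) !=set0.
Proof. by eexists; exists 0%N. Qed.

Lemma lipschitz_envelope_ge0 k x : 0 <= k -> 0 <= lipschitz_envelope k x.
Proof.
by move=> k0; apply: lb_le_inf; [exact: ne|move=> _ [n _ <-]; exact: term_ge0].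
Qed.

Lemma lipschitz_envelope_le k x : 0 <= k -> lipschitz_envelope k x <= phi x.
Proof.
move=> k0; apply/ler_addgt0Pr => e e0.
have [r r0 h] := cphiP x (divr_gt0 e0 (@ltr0n R 2 : 0 < 2)).
have k1 : 0 < k + 1 by lra.
pose r' := Num.min r (e / 4 / (k + 1)).
have r'0 : 0 < r' by rewrite lt_min r0 !divr_gt0.
have [n [n1 n2]] := rational_point_dense x r'0.
apply: (@le_trans _ _ (phi (rational_point n) + k * plane_dist x (rational_point n))).
  by apply: ge_inf; [exact: lb|exists n].
have rr : r' <= r by rewrite ge_min lexx.
have := h _ (lt_le_trans n1 rr) (lt_le_trans n2 rr).
rewrite ltr_norml => /andP[h1 h2].
have d1 : plane_dist x (rational_point n) <= e / 2 / (k + 1).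
  have re : r' <= e / 4 / (k + 1) by rewrite ge_min lexx orbT.
  rewrite (_ : e / 2 / (k + 1) = e / 4 / (k + 1) + e / 4 / (k + 1)).
    by rewrite /plane_dist lerD// ltW// (lt_le_trans _ re).
  by field; rewrite gt_eqF.
have : k * plane_dist x (rational_point n) <= e / 2.
  apply: (@le_trans _ _ ((k + 1) * (e / 2 / (k + 1)))).
    by apply: ler_pM => //; rewrite lerDl.
  by rewrite mulrC divfK// gt_eqF.
lra.
Qed.

Lemma lipschitz_envelope_lipschitz k : 0 <= k -> plane_lipschitz k (lipschitz_envelope k).
Proof.
move=> k0.
have h x y : lipschitz_envelope k x <= lipschitz_envelope k y + k * plane_dist x y.
  rewrite -lerBlDr; apply: lb_le_inf; first exact: ne.
  move=> _ [n _ <-]; rewrite lerBlDr.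
  apply: (@le_trans _ _ (phi (rational_point n) + k * plane_dist x (rational_point n))).
    by apply: ge_inf; [exact: lb|exists n].
  rewrite -addrA lerD2l -mulrDr ler_wpM2l// /plane_dist.
  have := ler_distD y.1 x.1 (rational_point n).1.
  have := ler_distD y.2 x.2 (rational_point n).2; lra.
move=> x y; rewrite -/(plane_dist x y) ler_norml; have := h x y; have := h y x.
rewrite (_ : plane_dist y x = plane_dist x y); last by rewrite /plane_dist distrC (distrC y.2).
by move=> *; apply/andP; split; lra.
Qed.

Lemma measurable_lipschitz_envelope k : 0 <= k ->
  measurable_fun setT (lipschitz_envelope k : RR -> R).
Proof.
move=> k0.
pose h n (x : RR) := phi (rational_point n) + k * plane_dist x (rational_point n).
rewrite (_ : (lipschitz_envelope k : RR -> R) = fun x => infs (h ^~ x) 0).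
  apply: measurable_fun_infs => [x _|n]; first exact: lb.
  apply: measurable_funD => //; apply: measurable_funM => //; apply: measurable_funD;
    by apply: measurableT_comp => //; exact: measurable_funB.
apply/funext => x; rewrite /infs /lipschitz_envelope; congr inf.
by apply/seteqP; split => _ [n _ <-]; exists n.
Qed.

Lemma cvg_lipschitz_envelope x : lipschitz_envelope k%:R x @[k --> \oo] --> phi x.
Proof.
apply/cvgrPdist_le => e e0; have [r r0 h] := cphiP x e0.
have M0 : 0 <= M by have /andP[] := phiM x; exact: le_trans.
near=> k.
(* With this k, a point outside the r-box around x pays a penalty of at least M, which already
   exceeds phi x; inside the box continuity takes over. *)
have kr : M <= k%:R * r.
  rewrite -ler_pdivrMr//; near: k; exact: nbhs_infty_ger.
rewrite ger0_norm ?subr_ge0 ?lipschitz_envelope_le// lerBlDr -lerBlDl.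
apply: lb_le_inf; first exact: ne.
move=> _ [n _ <-].
have d0 := dist_ge0 x (rational_point n).
have k0 : 0 <= k%:R :> R by [].
have [/andP[h1 h2]|] := boolP ((`|x.1 - (rational_point n).1| < r) &&
  (`|x.2 - (rational_point n).2| < r)).
  have := h _ h1 h2; rewrite ltr_norml => /andP[_].
  have := mulr_ge0 k0 d0; lra.
move=> hn; have rd : r <= plane_dist x (rational_point n).
  move: hn; rewrite negb_and -!leNgt /plane_dist => /orP[] /le_trans; apply.
    by rewrite lerDl.
  by rewrite lerDr.
have : k%:R * r <= k%:R * plane_dist x (rational_point n) by rewrite ler_wpM2l.
have /andP[_] := phiM x; have := phi0 (rational_point n); lra.
Unshelve. all: end_near. Qed.

(** Measurability for the product sigma-algebra passes to the limit from the envelopes, which are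
    countable infima of measurable functions. *)
Lemma ge0_continuous_plane_measurable : measurable_fun setT (phi : RR -> R).
Proof.
apply: (@measurable_fun_cvg _ _ _ _ (fun k => lipschitz_envelope k%:R : RR -> R)).
  by move=> k; exact: measurable_lipschitz_envelope.
by move=> x _; exact: cvg_lipschitz_envelope.
Qed.

End LipschitzEnvelope.

(** * From lower limits to weak convergence *)

Section WeakConvergence.
Context {R : realType}.
Local Notation RR := (measurableTypeR R * measurableTypeR R)%type.

Lemma bounded_continuous_plane (phi : R * R -> R) : continuous phi ->
  (exists M, forall x, `|phi x| <= M) -> bounded_measurable (phi : RR -> R).
Proof.
move=> cphi [M phiM]; split; last by exists M.
rewrite (_ : (phi : RR -> R) = fun x => (phi x + M) - M); last first.
  by apply/funext => x; rewrite addrK.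
apply: measurable_funB => //.
apply: (@ge0_continuous_plane_measurable _ (fun x => phi x + M) (M + M)).
  by move=> x; apply: cvgD; [exact: cphi|exact: cvg_cst].
by move=> x; have := phiM x; rewrite ler_norml => /andP[h1 h2]; apply/andP; split; lra.
Qed.

Context {d : measure_display} {Omega : measurableType d} (P : probability Omega R).
Context {d' : measure_display} {S : measurableType d'} (Q : probability S R).
Variables (X : nat -> Omega -> R * R) (U : S -> R * R).
Hypothesis mX : forall n, measurable_fun setT (X n : Omega -> RR).
Hypothesis mU : measurable_fun setT (U : S -> RR).
Hypothesis lip_liminf : forall (phi : R * R -> R) (L M : R), 0 <= L ->
  measurable_fun setT (phi : RR -> R) ->
  (forall x, 0 <= phi x <= M) -> plane_lipschitz L phi ->
  forall e, 0 < e ->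
  \forall n \near \oo, \int[Q]_w phi (U w) - e <= \int[P]_w phi (X n w).

Let bcomp d1 (T : measurableType d1) (Y : T -> R * R) (phi : R * R -> R) :
  measurable_fun setT (Y : T -> RR) -> bounded_measurable (phi : RR -> R) ->
  bounded_measurable (fun w => phi (Y w)).
Proof.
move=> mY [mphi [M phiM]]; split; last by exists M => x; exact: phiM.
exact: measurableT_comp mphi mY.
Qed.

(** A single envelope below [phi] is enough: under [Q] it loses at most e / 2 by bounded
    convergence, and under [P] the inequality between it and [phi] has the right direction. *)
Lemma continuous_liminf (phi : R * R -> R) (M : R) : continuous phi ->
  (forall x, 0 <= phi x <= M) -> forall e, 0 < e ->
  \forall n \near \oo, \int[Q]_w phi (U w) - e <= \int[P]_w phi (X n w).
Proof.
move=> cphi phiM e e0.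
have M0 : 0 <= M by have /andP[] := phiM (0, 0); exact: le_trans.
have nk k : 0 <= k%:R :> R by [].
have psiM k x : 0 <= lipschitz_envelope phi k%:R x <= M.
  rewrite (lipschitz_envelope_ge0 phiM)//=.
  rewrite (le_trans (lipschitz_envelope_le cphi phiM _ _))//.
  by have /andP[] := phiM x.
have mpsi k : measurable_fun setT (lipschitz_envelope phi k%:R : RR -> R).
  exact: measurable_lipschitz_envelope.
have bpsi k : bounded_measurable (lipschitz_envelope phi k%:R : RR -> R).
  by split => //; exists M => x; have /andP[? ?] := psiM k x; rewrite ger0_norm.
have bphi : bounded_measurable (phi : RR -> R).
  apply: bounded_continuous_plane => //; exists M => x.
  by have /andP[? ?] := phiM x; rewrite ger0_norm.
have cv : \int[Q]_w lipschitz_envelope phi k%:R (U w) @[k --> \oo] -->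
    \int[Q]_w phi (U w).
  apply: (@bounded_convergence _ _ _ _ _ _ M).
  - by move=> k; exact: measurableT_comp (mpsi k) mU.
  - by move=> k w; have /andP[? ?] := psiM k (U w); rewrite ger0_norm.
  - by move=> w; exact: cvg_lipschitz_envelope.
have e2 : 0 < e / 2 by rewrite divr_gt0.
have /cvgrPdist_le/(_ _ e2)[k _ /(_ k (leqnn k))] := cv.
rewrite /= ler_norml => /andP[_ hk].
have := lip_liminf (nk k) (mpsi k) (psiM k) (lipschitz_envelope_lipschitz phiM (nk k)) e2.
apply: filterS => n hn.
have : \int[P]_w lipschitz_envelope phi k%:R (X n w) <= \int[P]_w phi (X n w).
  apply: le_Rintegral => //.
  - by apply: bounded_measurable_integrable; exact: bcomp.
  - by apply: bounded_measurable_integrable; exact: bcomp.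
  - by move=> w _; exact: lipschitz_envelope_le.
lra.
Qed.

(** Lower bounds for the two nonnegative functions [phi + M] and [M - phi] are a lower and an upper
    bound for [phi]. *)
Lemma weak_convergence (phi : R * R -> R) : continuous phi ->
  (exists M, forall x, `|phi x| <= M) ->
  \int[P]_w phi (X n w) @[n --> \oo] --> \int[Q]_w phi (U w).
Proof.
move=> cphi bphi; have bm := bounded_continuous_plane cphi bphi.
case: bphi => M phiM.
have Mle x : - M <= phi x <= M by rewrite -ler_norml.
have intD d1 (T : measurableType d1) (m : probability T R) (Y : T -> R * R) :
    measurable_fun setT (Y : T -> RR) ->
    \int[m]_w (phi (Y w) + M) = \int[m]_w phi (Y w) + M.
  move=> mY; rewrite RintegralD ?Rintegral_probability_cst//.
  - by apply: bounded_measurable_integrable; exact: bcomp.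
  - by apply: bounded_measurable_integrable; exact: bounded_measurable_cst.
have intB d1 (T : measurableType d1) (m : probability T R) (Y : T -> R * R) :
    measurable_fun setT (Y : T -> RR) ->
    \int[m]_w (M - phi (Y w)) = M - \int[m]_w phi (Y w).
  move=> mY; rewrite RintegralB ?Rintegral_probability_cst//.
  - by apply: bounded_measurable_integrable; exact: bounded_measurable_cst.
  - by apply: bounded_measurable_integrable; exact: bcomp.
apply/cvgrPdist_le => e e0.
have h1 : \forall n \near \oo,
    \int[Q]_w (phi (U w) + M) - e <= \int[P]_w (phi (X n w) + M).
  apply: (@continuous_liminf (fun x => phi x + M) (M + M)) => // x.
    by apply: cvgD; [exact: cphi|exact: cvg_cst].
  by have := Mle x; lra.
have h2 : \forall n \near \oo,
    \int[Q]_w (M - phi (U w)) - e <= \int[P]_w (M - phi (X n w)).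
  apply: (@continuous_liminf (fun x => M - phi x) (M + M)) => // x.
    by apply: cvgB; [exact: cvg_cst|exact: cphi].
  by have := Mle x; lra.
apply: filterS2 h1 h2 => n; rewrite !intD// !intB// => g1 g2.
by rewrite ler_norml; apply/andP; split; lra.
Qed.

End WeakConvergence.

(** * The central limit theorem *)

Section PartialSums.
Context {R : realType} {d d' : measure_display}
  {Omega : measurableType d} {T : measurableType d'}.
Variables (P : probability Omega R) (mu : probability T R).
Variable X : nat -> {RV P >-> T}.
Hypothesis indep : mutually_independent P X.
Hypothesis law : identically_distributed X mu.
Variable f : T -> R.
Hypothesis mf : measurable_fun setT f.
Local Notation Rm := (measurableTypeR R).

Definition partial_sum (n : nat) (w : Omega) : R := \sum_(i < n) f (X i w).

Lemma measurable_partial_sum n : measurable_fun setT (partial_sum n : Omega -> Rm).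
Proof.
by apply: measurable_sum => i; exact: measurableT_comp.
Qed.

Lemma measurable_sum_next n :
  measurable_fun setT (fun w => (partial_sum n w, X n w) : Rm * T).
Proof. by apply: measurable_fun_pair => //; exact: measurable_partial_sum. Qed.

Definition cylinder (s : seq nat) (B : nat -> set T) : set Omega :=
  \bigcap_(j in [set` s]) X j @^-1` B j.

Lemma measurable_cylinder s B : (forall n, measurable (B n)) -> measurable (cylinder s B).
Proof.
move=> mB; apply: bigcap_measurableType => j _.
by rewrite -[X in measurable X]setTI; exact: (measurable_funP (X j)).
Qed.

Lemma probability_cylinder s B : uniq s -> (forall n, measurable (B n)) ->
  P (cylinder s B) = (\prod_(j <- s) mu (B j))%E.
Proof.
move=> us mB; rewrite /cylinder indep//; apply: eq_bigr => j _.
by rewrite -(law j (mB j)).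
Qed.

Let cylinder_cons n s B : cylinder (n :: s) B = (X n @^-1` B n) `&` cylinder s B.
Proof.
apply/seteqP; split => w /= h.
  split; first by apply: h; rewrite /= mem_head.
  by move=> j /= js; apply: h; rewrite /= in_cons js orbT.
move=> j /=; rewrite in_cons => /orP[/eqP ->|js]; first by case: h.
by case: h => _; apply.
Qed.

Let cylinder_nil B : cylinder [::] B = setT.
Proof. by apply/seteqP; split => w // _ j. Qed.

Let prod_fin (s : seq nat) (B : nat -> set T) : (forall j, measurable (B j)) ->
  (\prod_(j <- s) mu (B j))%E \is a fin_num.
Proof.
move=> mB; elim: s => [|j s ih]; first by rewrite big_nil.
rewrite big_cons fin_numM//; exact: fin_num_measure.
Qed.


Definition partial_sum_rv (n : nat) : {mfun Omega >-> Rm} :=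
  HB.pack (partial_sum n) (isMeasurableFun.Build _ _ _ _ _ (measurable_partial_sum n)).

Definition sum_law (n : nat) : probability Rm R := distribution P (partial_sum_rv n).

(** Inductive step of [partial_sum_cylinder], with the induction hypothesis as a premise. On
    rectangles the condition on X_n is moved into the cylinder; uniqueness of the product measure
    extends the identity to all measurable C. *)
Let split_law n (s : seq nat) (B : nat -> set T) :
  (forall A : set Rm, measurable A -> forall (s : seq nat) (B : nat -> set T),
    uniq s -> all (leq n) s -> (forall j, measurable (B j)) ->
    P (partial_sum n @^-1` A `&` cylinder s B) =
      (sum_law n A * \prod_(j <- s) mu (B j))%E) ->
  uniq s -> all (ltn n) s -> (forall j, measurable (B j)) ->
  forall C : set (Rm * T), measurable C ->
  P ((fun w => (partial_sum n w, X n w)) @^-1` C `&` cylinder s B) =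
  ((sum_law n \x mu) C * \prod_(j <- s) mu (B j))%E.
Proof.
move=> IH us ns mB C mC.
have mF := measurable_cylinder s mB.
set c := (\prod_(j <- s) mu (B j))%E.
have cfin : c \is a fin_num by exact: prod_fin.
have c0 : (0 <= c)%E by apply: prode_ge0 => j _; exact: measure_ge0.
(* Puts a set at the index n, which does not occur in s, so that a condition on X_n becomes one more
   condition of the cylinder. *)
pose B' A j := if j == n then A else B j.
have mB' A j : measurable A -> measurable (B' A j) by move=> mA; rewrite /B'; case: ifP.
have nns : n \notin s.
  by apply/negP => /(allP ns) /=; rewrite ltnn.
have cB' A : cylinder s (B' A) = cylinder s B.
  apply: eq_bigcapr => j /= js; rewrite /B'; case: eqP => // jn.
  by move: nns; rewrite -jn js.
have pB' A : (\prod_(j <- s) mu (B' A j) = c)%E.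
  rewrite /c big_seq [RHS]big_seq; apply: eq_bigr => j js; rewrite /B'; case: eqP => // jn.
  by move: nns; rewrite -jn js.
have rect (A : set Rm) (D : set T) : measurable A -> measurable D ->
    P ((fun w => (partial_sum n w, X n w)) @^-1` (A `*` D) `&` cylinder s B) =
    (sum_law n A * mu D * c)%E.
  move=> mA mD.
  rewrite (_ : _ `&` _ = partial_sum n @^-1` A `&` cylinder (n :: s) (B' D)); last first.
    rewrite cylinder_cons cB' {1}/B' eqxx; apply/seteqP.
    by split => w /= => [[[? ?] ?]|[? [? ?]]].
  rewrite IH//; first by rewrite big_cons pB' {1}/B' eqxx muleA.
  - by rewrite /= nns us.
  - by rewrite /= leqnn; apply: sub_all ns => j; exact: ltnW.
  - by move=> j; exact: mB'.
(* The law of the pair (S_n, X_n) restricted to the cylinder; divided by the probability c of the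
   cylinder it is to be the product law. *)
pose m' : measure (Rm * T)%type R :=
  measure_function_pushforward__canonical__measure_function_Measure
    (mrestr P mF) (measurable_sum_next n).
have m'E D : m' D = P ((fun w => (partial_sum n w, X n w)) @^-1` D `&` cylinder s B).
  by [].
(* Normalization is impossible for c = 0, but the cylinder is then a null set and both sides
   vanish. *)
have [cz|cnz] := eqVneq c 0%E.
  rewrite cz mule0; apply/eqP; rewrite -measure_le0 -[leRHS]cz.
  rewrite /c -probability_cylinder//; apply: le_measure; rewrite ?inE//.
  apply: measurableI => //; rewrite -[X in measurable X]setTI.
  exact: measurable_sum_next.
have cr : 0 < fine c.
  by rewrite fine_gt0// lt_def cnz c0 ltey_eq cfin.
pose k : {nonneg R} := NngNum (ltW (divr_gt0 ltr01 cr)).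
have ck : (c * k%:num%:E = 1)%E.
  by rewrite -[c]fineK// -EFinM /= mul1r mulfV// gt_eqF.
have H : ((sum_law n \x mu) C = mscale k m' C)%E.
  apply: product_measure_unique => // A D mA mD.
  transitivity (k%:num%:E * (sum_law n A * mu D * c))%E; first by rewrite -rect.
  by rewrite muleC -muleA ck mule1.
have -> : ((sum_law n \x mu) C = k%:num%:E * m' C)%E by rewrite H.
by rewrite muleC muleA ck mul1e.
Qed.

(** Independence of S_n from the later variables, in the form that the induction can carry: the list
    s of later indices stays arbitrary because X_n is taken out of it at each step. *)
Lemma partial_sum_cylinder n (A : set Rm) : measurable A ->
  forall (s : seq nat) (B : nat -> set T),
  uniq s -> all (leq n) s -> (forall j, measurable (B j)) ->
  P (partial_sum n @^-1` A `&` cylinder s B) =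
    (sum_law n A * \prod_(j <- s) mu (B j))%E.
Proof.
elim: n A => [|n IH] A mA s B us ns mB.
  have S0 : partial_sum 0 = cst 0 by apply/funext => w; rewrite /partial_sum big_ord0.
  have -> : sum_law 0 A = P (partial_sum 0 @^-1` A) by [].
  rewrite S0 preimage_cst.
  case: ifPn => _; last by rewrite set0I !measure0 mul0e.
  by rewrite setTI probability_cylinder// [X in (X * _)%E]probability_setT mul1e.
pose C := [set z : Rm * T | A (z.1 + f z.2)].
have mC : measurable C.
  rewrite -[X in measurable X]setTI.
  suff h : measurable_fun setT (fun z : Rm * T => z.1 + f z.2 : Rm) by exact: h.
  apply: measurable_funD; first exact: measurable_fst.
  exact: (measurableT_comp mf measurable_snd).
have SE : partial_sum n.+1 @^-1` A = (fun w => (partial_sum n w, X n w)) @^-1` C.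
  apply/seteqP; rewrite /partial_sum.
  by split => w; rewrite /C /= big_ord_recr.
have -> : sum_law n.+1 A = P (partial_sum n.+1 @^-1` A) by [].
rewrite SE split_law//; congr (_ * _)%E.
have := @split_law n [::] (fun=> setT) IH isT isT (fun=> measurableT) C mC.
by rewrite big_nil mule1 => <-; rewrite cylinder_nil setIT.
Qed.

Lemma partial_sum_next_law n (C : set (Rm * T)) : measurable C ->
  P ((fun w => (partial_sum n w, X n w)) @^-1` C) = (sum_law n \x mu)%E C.
Proof.
move=> mC.
have := @split_law n [::] (fun=> setT) (@partial_sum_cylinder n) isT isT
  (fun=> measurableT) C mC.
by rewrite big_nil mule1 => <-; rewrite cylinder_nil setIT.
Qed.

Lemma ge0_integral_partial_sum_next n (Psi : Rm * T -> \bar R) :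
  measurable_fun setT Psi -> (forall z, 0 <= Psi z)%E ->
  (\int[P]_w Psi (partial_sum n w, X n w) =
   \int[P]_w \int[mu]_x Psi (partial_sum n w, x))%E.
Proof.
move=> mPsi Psi0.
pose Z : {mfun Omega >-> (Rm * T)%type} := HB.pack (fun w => (partial_sum n w, X n w))
  (isMeasurableFun.Build _ _ _ _ _ (measurable_sum_next n)).
transitivity (\int[distribution P Z]_z Psi z)%E.
  by rewrite ge0_integral_distribution.
transitivity (\int[sum_law n \x mu]_z Psi z)%E.
  apply: eq_measure_integral => C mC _; exact: partial_sum_next_law.
rewrite fubini_tonelli1// /fubini_F.
rewrite (@ge0_integral_distribution _ _ _ _ _ P (partial_sum_rv n))//.
  exact: measurable_fun_fubini_tonelli_F.
by move=> y; apply: integral_ge0.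
Qed.

End PartialSums.

(** * Taylor bounds for cosine, sine and exponential *)

Section TaylorBounds.
Context {R : realType}.

(** Integrates an inequality from 0. Starting with cos <= 1 and sin <= 1, repeated use yields the
    bounds below one order at a time. *)
Lemma ge0_from_derive (g dg : R -> R) :
  (forall x : R, is_derive x 1 g (dg x)) -> (forall x, 0 <= x -> 0 <= dg x) ->
  0 <= g 0 -> forall x, 0 <= x -> 0 <= g x.
Proof.
move=> dgP dg0 g0 x; rewrite le_eqVlt => /predU1P[<-//|x0].
have [|c] := @MVT _ g dg _ _ x0 (fun y _ => dgP y).
  apply: continuous_subspaceT => y; apply: differentiable_continuous.
  by apply/derivable1_diffP; have [] := dgP y.
rewrite in_itv/= => /andP[c0 _] E.
have := mulr_ge0 (dg0 c (ltW c0)) (ltW x0); move: E; rewrite subr0 => <-.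
by rewrite subr_ge0; exact: le_trans.
Qed.

Let sin_ub (x : R) : 0 <= x -> 0 <= x - sin x.
Proof.
apply: (@ge0_from_derive (fun x => x - sin x) (fun x => 1 - cos x)).
- by move=> y _; rewrite subr_ge0 cos_le1.
- by rewrite sin0 subr0.
Qed.

Let cos_lb (x : R) : 0 <= x -> 0 <= cos x - 1 + x ^+ 2 / 2.
Proof.
apply: (@ge0_from_derive (fun x => cos x - 1 + x ^+ 2 / 2) (fun x => x - sin x)).
- by move=> y; apply: is_derive_eq; rewrite /GRing.scale/=; field.
- exact: sin_ub.
- by rewrite cos0 subrr expr0n mul0r addr0.
Qed.

Let sin_lb (x : R) : 0 <= x -> 0 <= sin x - x + x ^+ 3 / 6.
Proof.
apply: (@ge0_from_derive (fun x => sin x - x + x ^+ 3 / 6) (fun x => cos x - 1 + x ^+ 2 / 2)).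
- by move=> y; apply: is_derive_eq; rewrite /GRing.scale/=; field.
- exact: cos_lb.
- by rewrite sin0 subrr expr0n mul0r addr0.
Qed.

Let cos_lb1 (x : R) : 0 <= x -> 0 <= x - 1 + cos x.
Proof.
apply: (@ge0_from_derive (fun x => x - 1 + cos x) (fun x => 1 - sin x)).
- by move=> y; apply: is_derive_eq; rewrite /GRing.scale/=; ring.
- by move=> y _; rewrite subr_ge0 sin_le1.
- by rewrite cos0 sub0r addNr.
Qed.

Let sin_lb2 (x : R) : 0 <= x -> 0 <= x ^+ 2 / 2 - x + sin x.
Proof.
apply: (@ge0_from_derive (fun x => x ^+ 2 / 2 - x + sin x) (fun x => x - 1 + cos x)).
- by move=> y; apply: is_derive_eq; rewrite /GRing.scale/=; field.
- exact: cos_lb1.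
- by rewrite sin0 expr0n mul0r subrr addr0.
Qed.

Let cos_ub3 (x : R) : 0 <= x -> 0 <= x ^+ 3 / 6 - (cos x - 1 + x ^+ 2 / 2).
Proof.
apply: (@ge0_from_derive (fun x => x ^+ 3 / 6 - (cos x - 1 + x ^+ 2 / 2))
  (fun x => x ^+ 2 / 2 - x + sin x)).
- by move=> y; apply: is_derive_eq; rewrite /GRing.scale/=; field.
- exact: sin_lb2.
- by rewrite cos0 !expr0n/=; lra.
Qed.

(** The quadratic bound is a majorant under second moments, and the cubic one gives the pointwise
    limit; [scaled_cvg0] uses the two together, for cosine and for sine. *)
Lemma cos_taylor2 (x : R) : `|cos x - 1 + x ^+ 2 / 2| <= x ^+ 2 / 2.
Proof.
rewrite -cos_norm -(real_normK (num_real x)) (ger0_norm (cos_lb (normr_ge0 x))).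
by have := cos_le1 `|x|; lra.
Qed.

Lemma cos_taylor3 (x : R) : `|cos x - 1 + x ^+ 2 / 2| <= `|x| ^+ 3 / 6.
Proof.
rewrite -cos_norm -(real_normK (num_real x)) (ger0_norm (cos_lb (normr_ge0 x))).
by rewrite -subr_ge0; exact: cos_ub3.
Qed.

Let sin_odd_norm (x : R) : `|sin x - x| = `|x| - sin `|x|.
Proof.
have [x0|/ltW x0] := leP 0 x.
  by rewrite (ger0_norm x0) distrC ger0_norm// sin_ub.
have := @sin_ub (- x); rewrite oppr_ge0 => /(_ x0); rewrite sinN opprK => h.
by rewrite (ler0_norm x0) sinN opprK addrC ger0_norm.
Qed.

Lemma sin_taylor2 (x : R) : `|sin x - x| <= x ^+ 2 / 2.
Proof.
rewrite sin_odd_norm -(real_normK (num_real x)).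
by have := sin_lb2 (normr_ge0 x); lra.
Qed.

Lemma sin_taylor3 (x : R) : `|sin x - x| <= `|x| ^+ 3 / 6.
Proof. by rewrite sin_odd_norm; have := sin_lb (normr_ge0 x); lra. Qed.

Lemma expRN_taylor2 (x : R) : 0 <= x -> `|expR (- x) - 1 + x| <= x ^+ 2 / 2.
Proof.
move=> x0; rewrite ger0_norm; last by have := expR_ge1Dx (- x); lra.
suff : 0 <= x ^+ 2 / 2 - (expR (- x) - 1 + x) by lra.
apply: (@ge0_from_derive (fun x => x ^+ 2 / 2 - (expR (- x) - 1 + x))
  (fun x => x - 1 + expR (- x))) => //.
- by move=> y; apply: is_derive_eq; rewrite /GRing.scale/=; field.
- by move=> y _; have := expR_ge1Dx (- y); lra.
Qed.

End TaylorBounds.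

Section DominatedRintegral.
Context {R : realType} {d : measure_display} {T : measurableType d}.
Variable m : {measure set T -> \bar R}.

Lemma dominated_Rintegral_cvg (f : nat -> T -> R) (g G : T -> R) :
  (forall n, measurable_fun setT (f n)) ->
  m.-integrable setT (EFin \o G) ->
  (forall n x, `|f n x| <= G x) ->
  (forall x, f n x @[n --> \oo] --> g x) ->
  \int[m]_x f n x @[n --> \oo] --> \int[m]_x g x.
Proof.
move=> mf iG fG fg; apply: fine_cvg.
have gG x : `|g x| <= G x by apply: (cvgr_to_le (cvg_norm (fg x))); exact: nearW.
have mg : measurable_fun setT g by apply: measurable_fun_cvg mf _ => x _; exact: fg.
rewrite fineK; last first.
  apply: integrable_fin_num => //.
  apply: (le_integrable _ _ _ iG) => //; first exact/measurable_EFinP.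
  by move=> x _; rewrite /= lee_fin (le_trans (gG x))// ler_norm.
apply: (@dominated_cvg _ _ _ m setT _ _ _ (EFin \o G)) => //.
- by move=> n; exact/measurable_EFinP.
- by move=> x _; apply: cvg_EFin; [exact: nearW|exact: fg].
- by move=> n x _; rewrite lee_fin.
Qed.

End DominatedRintegral.

(** * Cosine moments of normalized partial sums *)

Section PartialSumsCLT.
Context {R : realType} {d d' : measure_display}
  {Omega : measurableType d} {T : measurableType d'}.
Variables (P : probability Omega R) (mu : probability T R).
Variable X : nat -> {RV P >-> T}.
Hypothesis indep : mutually_independent P X.
Hypothesis law : identically_distributed X mu.
Variable f : T -> R.
Hypothesis mf : measurable_fun setT f.
Local Notation Rm := (measurableTypeR R).
Local Notation S := (partial_sum X f).

Lemma Rintegral_partial_sum_next n (Psi : Rm * T -> R) : bounded_measurable Psi ->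
  \int[P]_w Psi (S n w, X n w) = \int[P]_w \int[mu]_x Psi (S n w, x).
Proof.
move=> bPsi; have [mPsi [M PsiM]] := bPsi.
have bnext : bounded_measurable (fun w => Psi (S n w, X n w)).
  split; last by exists M => w; exact: PsiM.
  by apply: (measurableT_comp mPsi); exact: measurable_sum_next.
have bS (s : R) : bounded_measurable (fun x => Psi (s, x)).
  exact: (bounded_measurable_pair1 bPsi).
have bI : bounded_measurable (fun w => \int[mu]_x Psi (S n w, x)).
  have [mI [K IK]] := bounded_measurable_Rintegral (normal_prob 0 1) mu bPsi.
  split; last by exists K => w; exact: IK.
  by apply: (measurableT_comp mI); exact: measurable_partial_sum.
have iC d1 (T1 : measurableType d1) (m : probability T1 R) :
  m.-integrable setT (EFin \o cst M).
  by apply: bounded_measurable_integrable; exact: bounded_measurable_cst.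
have addM d1 (T1 : measurableType d1) (m : probability T1 R) (h : T1 -> R) :
    bounded_measurable h -> \int[m]_w (h w + M) = \int[m]_w h w + M.
  move=> bh; rewrite RintegralD ?Rintegral_probability_cst//.
  - exact: bounded_measurable_integrable.
  - exact: iC.
(* Adding the bound makes the integrand nonnegative, as the Tonelli form of the law of (S_n, X_n)
   demands. *)
apply: (addIr M); rewrite -!addM//.
have E w : \int[mu]_x Psi (S n w, x) + M = \int[mu]_x (Psi (S n w, x) + M).
  by rewrite addM.
under [RHS]eq_Rintegral do rewrite E.
rewrite /Rintegral; congr fine.
rewrite (@ge0_integral_partial_sum_next _ _ _ _ _ _ _ _ indep law _ mf n
  (fun z => (Psi z + M)%:E)).
- apply: eq_integral => w _; rewrite fineK//.
  apply: integrable_fin_num => //; apply: bounded_measurable_integrable.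
  by apply: bounded_measurableD => //; exact: bounded_measurable_cst.
- by apply/measurable_EFinP; exact: measurable_funD.
- move=> z; rewrite lee_fin; have := PsiM z; rewrite ler_norml => /andP[]; lra.
Qed.

Hypothesis f2 : mu.-integrable setT (fun x => (f x ^+ 2)%:E).
Hypothesis f1 : mu.-integrable setT (EFin \o f).
Hypothesis f0 : \int[mu]_x f x = 0.

Let v := \int[mu]_x (f x ^+ 2).

Lemma second_moment_partial_sum n :
  (\int[P]_w (S n w ^+ 2)%:E = (n%:R * v)%:E)%E.
Proof.
elim: n => [|n IH].
  rewrite mul0r; under eq_integral do rewrite /partial_sum big_ord0 expr0n.
  exact: integral0.
have -> : (\int[P]_w (S n.+1 w ^+ 2)%:E =
    \int[P]_w ((S n w + f (X n w)) ^+ 2)%:E)%E.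
  by apply: eq_integral => w _; rewrite /partial_sum big_ord_recr.
rewrite (@ge0_integral_partial_sum_next _ _ _ _ _ _ _ _ indep law _ mf n
  (fun z => ((z.1 + f z.2) ^+ 2)%:E))/=; last 2 first.
- apply/measurable_EFinP; apply: measurable_funX; apply: measurable_funD.
    exact: measurable_fst.
  exact: (measurableT_comp mf measurable_snd).
- by move=> z; rewrite lee_fin sqr_ge0.
have E (s : R) : (\int[mu]_x ((s + f x) ^+ 2)%:E = (s ^+ 2)%:E + v%:E)%E.
  have Ex x : (s + f x) ^+ 2 = s ^+ 2 + (2 * s * f x + f x ^+ 2) by ring.
  have i1 : mu.-integrable setT (EFin \o (fun x => 2 * s * f x)).
    by rewrite /comp; under eq_fun do rewrite EFinM; exact: integrableZl.
  have i2 : mu.-integrable setT (EFin \o (fun x => 2 * s * f x + f x ^+ 2)).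
    by rewrite /comp; under eq_fun do rewrite EFinD; exact: integrableD.
  have i0 : mu.-integrable setT (EFin \o (fun x : T => s ^+ 2)).
    by apply: bounded_measurable_integrable; exact: bounded_measurable_cst.
  rewrite -EFin_Rintegral; last first.
    rewrite /comp; under eq_fun do rewrite Ex EFinD; exact: integrableD.
  under eq_Rintegral do rewrite Ex.
  by rewrite !RintegralD// RintegralZl// f0 mulr0 add0r Rintegral_probability_cst.
under eq_integral do rewrite E.
have v0 : 0 <= v by apply: Rintegral_ge0 => x _; exact: sqr_ge0.
have mS : measurable_fun setT (S n) by exact: measurable_partial_sum.
rewrite ge0_integralD//.
- rewrite IH integral_cst// [X in (_ * X)%E]probability_setT mule1 -EFinD.
  by rewrite -natr1 mulrDl mul1r.
- by move=> w _; rewrite lee_fin sqr_ge0.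
- by apply/measurable_EFinP; exact: measurable_funX.
Qed.

Let bcosu (u x : R) : bounded_measurable (fun w => cos (x + u * f w)).
Proof.
by apply: bounded_measurable_cos; apply: measurable_funD => //; exact: measurable_funM.
Qed.

Let ccos (u : R) := \int[mu]_x cos (u * f x).
Let csin (u : R) := \int[mu]_x sin (u * f x).

(** Real form of the estimate |a^n - q^n| <= n |a - q| for characteristic functions: one more
    summand multiplies the cosine moment by q up to a fixed error, and q <= 1 keeps the earlier
    errors from growing. The sine term appears because a is complex in general. *)
Lemma cos_partial_sum_bound (u x q : R) n : 0 <= q <= 1 ->
  `|\int[P]_w cos (x + u * S n w) - q ^+ n * cos x| <=
  n%:R * (`|ccos u - q| + `|csin u|).
Proof.
move=> /andP[q0 q1]; set delta := `|ccos u - q| + `|csin u|.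
have bS k y : bounded_measurable (fun w => cos (y + u * S k w)).
  apply: bounded_measurable_cos; apply: measurable_funD => //.
  by apply: measurable_funM => //; exact: measurable_partial_sum.
elim: n => [|n IH].
  rewrite expr0 mul1r mul0r; under eq_Rintegral do rewrite /partial_sum big_ord0 mulr0 addr0.
  by rewrite Rintegral_probability_cst subrr normr0.
have bz : bounded_measurable (fun z : Rm * T => cos (x + u * (z.1 + f z.2))).
  apply: bounded_measurable_cos; apply: measurable_funD => //; apply: measurable_funM => //.
  apply: measurable_funD; first exact: measurable_fst.
  exact: (measurableT_comp mf measurable_snd).
have E1 : \int[P]_w cos (x + u * S n.+1 w) =
    \int[P]_w \int[mu]_y cos (x + u * (S n w + f y)).
  transitivity (\int[P]_w cos (x + u * (S n w + f (X n w)))).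
    by apply: eq_Rintegral => w _; rewrite /partial_sum big_ord_recr.
  exact: (Rintegral_partial_sum_next n bz).
have b1 : bounded_measurable (fun y => cos (u * f y)).
  by apply: bounded_measurable_cos; exact: measurable_funM.
have b2 : bounded_measurable (fun y => sin (u * f y)).
  by apply: bounded_measurable_sin; exact: measurable_funM.
have E2 (s : R) : \int[mu]_y cos (x + u * (s + f y)) =
    cos (x + u * s) * ccos u - sin (x + u * s) * csin u.
  have Ey y : cos (x + u * (s + f y)) =
      cos (x + u * s) * cos (u * f y) - sin (x + u * s) * sin (u * f y).
    by rewrite -cosD; congr cos; ring.
  under eq_Rintegral do rewrite Ey.
  have i1 := bounded_measurable_integrable mu b1.
  have i2 := bounded_measurable_integrable mu b2.
  rewrite RintegralB//; first by rewrite !RintegralZl.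
  - by rewrite /comp; under eq_fun do rewrite EFinM; exact: integrableZl.
  - by rewrite /comp; under eq_fun do rewrite EFinM; exact: integrableZl.
have E3 : \int[P]_w cos (x + u * S n.+1 w) - q * \int[P]_w cos (x + u * S n w) =
    \int[P]_w (cos (x + u * S n w) * (ccos u - q) - sin (x + u * S n w) * csin u).
  rewrite E1 -RintegralZl//; last exact: bounded_measurable_integrable.
  rewrite -RintegralB//.
  - by apply: eq_Rintegral => w _; rewrite E2; ring.
  - apply: bounded_measurable_integrable.
    have [mI [K IK]] := bounded_measurable_Rintegral (normal_prob 0 1) mu bz.
    split; last by exists K => w; exact: IK.
    exact: (measurableT_comp mI (measurable_partial_sum X mf n)).
  - apply: bounded_measurable_integrable; apply: bounded_measurableM => //.
    exact: bounded_measurable_cst.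
have mS : measurable_fun setT (fun w => x + u * S n w).
  by apply: measurable_funD => //; apply: measurable_funM => //; exact: measurable_partial_sum.
have E4 : `|\int[P]_w cos (x + u * S n.+1 w) - q * \int[P]_w cos (x + u * S n w)| <= delta.
  rewrite E3; apply: Rintegral_le_bound.
    apply: measurable_funB; apply: measurable_funM => //.
      by have [] := bounded_measurable_cos mS.
    by have [] := bounded_measurable_sin mS.
  move=> w; apply: (le_trans (ler_normB _ _)); rewrite !normrM lerD// ler_piMl//.
    exact: cos_max.
  exact: sin_max.
rewrite exprS -mulrA (_ : \int[P]_w _ - _ =
  (\int[P]_w cos (x + u * S n.+1 w) - q * \int[P]_w cos (x + u * S n w)) +
  q * (\int[P]_w cos (x + u * S n w) - q ^+ n * cos x)); last by ring.
apply: (le_trans (ler_normD _ _)); rewrite -natr1 mulrDl mul1r addrC lerD//.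
rewrite normrM (ger0_norm q0); apply: le_trans IH.
by rewrite ler_piMl.
Qed.

Let u (n : nat) : R := (Num.sqrt n.+1%:R)^-1.

Let u2 n : u n ^+ 2 = n.+1%:R^-1.
Proof. by rewrite /u exprVn sqr_sqrtr. Qed.

Let u0 n : 0 <= u n. Proof. by rewrite /u invr_ge0. Qed.

Let cvg_u : u n @[n --> \oo] --> (0 : R).
Proof.
rewrite (_ : u = fun n => Num.sqrt n.+1%:R^-1); last first.
  by apply/funext => n; rewrite /u sqrtrV.
rewrite -[X in _ --> X]sqrtr0; apply: continuous_cvg; first exact: sqrt_continuous.
exact: cvg_harmonic.
Qed.

(** As (n + 1) u_n^2 = 1, the scaled integrand is at most f^2 / 2 and also at most u_n |f|^3 / 6.
    The latter vanishes pointwise in the limit, so dominated convergence applies with second moments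
    only. *)
Let scaled_cvg0 (h : R -> R) : continuous h ->
  (forall x, `|h x| <= x ^+ 2 / 2) -> (forall x, `|h x| <= `|x| ^+ 3 / 6) ->
  n.+1%:R * \int[mu]_x h (u n * f x) @[n --> \oo] --> (0 : R).
Proof.
move=> ch h2 h3.
have mh n : measurable_fun setT (fun x => h (u n * f x)).
  apply: measurableT_comp; first exact: continuous_measurable_fun.
  exact: measurable_funM.
have if2 : mu.-integrable setT (EFin \o (fun x => f x ^+ 2 / 2)).
  by rewrite /comp; under eq_fun do rewrite EFinM; exact: integrableZr.
have hb n x : `|n.+1%:R * h (u n * f x)| <= f x ^+ 2 / 2.
  rewrite normrM ger0_norm//.
  apply: (@le_trans _ _ (n.+1%:R * ((u n * f x) ^+ 2 / 2))); first by rewrite ler_wpM2l.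
  by rewrite exprMn u2 -mulrA mulVKf.
rewrite (_ : (fun n => _) = fun n => \int[mu]_x (n.+1%:R * h (u n * f x))); last first.
  apply/funext => n; rewrite RintegralZl//.
  apply: (le_integrable _ _ _ if2) => //; first exact/measurable_EFinP.
  move=> x _; rewrite /= lee_fin; apply: (le_trans (h2 _)).
  apply: le_trans (ler_norm _); rewrite exprMn u2 -mulrA ler_piMl ?divr_ge0 ?sqr_ge0//.
  by rewrite invf_le1// ler1n.
rewrite -[X in _ --> X](Rintegral_probability_cst mu 0); apply: (dominated_Rintegral_cvg _ if2 hb) => [n|x].
  exact: measurable_funM.
apply: norm_cvg0.
apply: (@squeeze_cvgr _ _ _ _ (cst 0) (fun n => u n * (`|f x| ^+ 3 / 6))).
- apply: nearW => n; rewrite normr_ge0/= normrM ger0_norm//.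
  apply: (@le_trans _ _ (n.+1%:R * (`|u n * f x| ^+ 3 / 6))); first by rewrite ler_wpM2l.
  rewrite normrM (ger0_norm (u0 n)) exprMn exprS u2 le_eqVlt; apply/orP; left.
  by apply/eqP; field; rewrite addrC natr1 pnatr_eq0.
- exact: cvg_cst.
- by rewrite -(mul0r (`|f x| ^+ 3 / 6)); apply: cvgM; [exact: cvg_u|exact: cvg_cst].
Qed.

Lemma cos_partial_sum_cvg (x : R) :
  \int[P]_w cos (x + (Num.sqrt n%:R)^-1 * S n w) @[n --> \oo] -->
  cos x * expR (- (v / 2)).
Proof.
rewrite -cvg_shiftS /=.
(* Chosen so that its power n + 1 is the Gaussian factor exactly. The index has been shifted by one
   to stay away from the inverse of 0. *)
pose q n := expR (- (v / 2 / n.+1%:R)).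
have v0 : 0 <= v by apply: Rintegral_ge0 => y _; exact: sqr_ge0.
have qn n : q n ^+ n.+1 = expR (- (v / 2)).
  by rewrite /q -expRM_natl -mulr_natl mulrN mulrC divfK.
have q01 n : 0 <= q n <= 1.
  by rewrite expR_ge0/= -[leRHS]expR0 ler_expR oppr_le0 !divr_ge0.
have n0 n : n.+1%:R != 0 :> R by rewrite pnatr_eq0.
have cc : n.+1%:R * (ccos (u n) - q n) @[n --> \oo] --> (0 : R).
  have ch : continuous (fun x : R => cos x - 1 + x ^+ 2 / 2).
    move=> y; apply: cvgD; first by apply: cvgB; [exact: continuous_cos|exact: cvg_cst].
    by apply: cvgM; [exact: sqr_continuous|exact: cvg_cst].
  have h1 := scaled_cvg0 ch (@cos_taylor2 R) (@cos_taylor3 R).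
  (* Subtracting the second-order expansions of cosine and exponential changes nothing, because
     their quadratic terms have the same integral v / (2 (n + 1)). *)
  have E n : n.+1%:R * (ccos (u n) - q n) =
      n.+1%:R * \int[mu]_x (cos (u n * f x) - 1 + (u n * f x) ^+ 2 / 2) -
      n.+1%:R * (q n - 1 + v / 2 / n.+1%:R).
    have i1 : mu.-integrable setT (EFin \o (fun x => cos (u n * f x) - 1)).
      apply: bounded_measurable_integrable; apply: bounded_measurableB.
        by apply: bounded_measurable_cos; exact: measurable_funM.
      exact: bounded_measurable_cst.
    have i0 : mu.-integrable setT (EFin \o (fun x => cos (u n * f x))).
      by apply: bounded_measurable_integrable; apply: bounded_measurable_cos; exact: measurable_funM.
    have ic : mu.-integrable setT (EFin \o (fun x : T => 1 : R)).
      by apply: bounded_measurable_integrable; exact: bounded_measurable_cst.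
    have E2 y : (u n * f y) ^+ 2 / 2 = (n.+1%:R^-1 / 2) * f y ^+ 2.
      by rewrite exprMn u2; ring.
    have i2 : mu.-integrable setT (EFin \o (fun x => (u n * f x) ^+ 2 / 2)).
      by rewrite /comp; under eq_fun do rewrite E2 EFinM; exact: integrableZl.
    have E3 : \int[mu]_x ((u n * f x) ^+ 2 / 2) = n.+1%:R^-1 / 2 * v.
      by under eq_Rintegral do rewrite E2; rewrite RintegralZl.
    rewrite RintegralD// RintegralB// Rintegral_probability_cst.
    by rewrite E3 -/(ccos (u n)); ring.
  under eq_fun do rewrite E.
  rewrite -(subr0 (0 : R)); apply: cvgB; first exact: h1.
  apply: norm_cvg0.
  apply: (@squeeze_cvgr _ _ _ _ (cst 0) (fun n => v ^+ 2 / 8 * n.+1%:R^-1)).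
  - apply: nearW => n; rewrite normr_ge0/= normrM ger0_norm//.
    have vn : 0 <= v / 2 / n.+1%:R by rewrite !divr_ge0.
    apply: (@le_trans _ _ (n.+1%:R * ((v / 2 / n.+1%:R) ^+ 2 / 2))).
      by rewrite ler_wpM2l// expRN_taylor2.
    rewrite le_eqVlt; apply/orP; left; apply/eqP; field.
    by rewrite addrC natr1 pnatr_eq0.
  - exact: cvg_cst.
  - by rewrite -(mulr0 (v ^+ 2 / 8)); apply: cvgM; [exact: cvg_cst|exact: cvg_harmonic].
have cs : n.+1%:R * csin (u n) @[n --> \oo] --> (0 : R).
  have ch : continuous (fun x : R => sin x - x).
    by move=> y; apply: cvgB; [exact: continuous_sin|exact: cvg_id].
  have h1 := scaled_cvg0 ch (@sin_taylor2 R) (@sin_taylor3 R).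
  have E n : csin (u n) = \int[mu]_x (sin (u n * f x) - u n * f x).
    rewrite RintegralB//.
    - by rewrite RintegralZl// f0 mulr0 subr0.
    - by apply: bounded_measurable_integrable; apply: bounded_measurable_sin; exact: measurable_funM.
    - by rewrite /comp; under eq_fun do rewrite EFinM; exact: integrableZl.
  by under eq_fun do rewrite E.
apply/subr_cvg0; apply: norm_cvg0.
apply: (@squeeze_cvgr _ _ _ _ (cst 0)
  (fun n => `|n.+1%:R * (ccos (u n) - q n)| + `|n.+1%:R * csin (u n)|)).
- apply: nearW => n; rewrite normr_ge0/= !normrM ger0_norm// -mulrDr -(qn n).
  by rewrite (mulrC (cos x)); exact: cos_partial_sum_bound.
- exact: cvg_cst.
- rewrite -(addr0 (0 : R)) -[X in X + _](@normr0 R R) -[X in _ + X](@normr0 R R).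
  by apply: cvgD; exact: cvg_norm.
Qed.

End PartialSumsCLT.

(** * Events of large probability and Slutsky's argument *)

Section HighProbability.
Context {R : realType} {d : measure_display} {Omega : measurableType d}.
Variable P : probability Omega R.

(* The events are only required to contain measurable ones of large probability. *)
Definition eventually_likely (eta : R) (G : nat -> set Omega) :=
  \forall n \near \oo, exists A, [/\ measurable A, A `<=` G n & (P (~` A) <= eta%:E)%E].

Definition with_high_probability (G : nat -> set Omega) :=
  forall eta, 0 < eta -> eventually_likely eta G.

Lemma eventually_likelyS eta (G H : nat -> set Omega) :
  (\forall n \near \oo, G n `<=` H n) ->
  eventually_likely eta G -> eventually_likely eta H.
Proof.
by apply: filterS2 => n GH [A [mA AG PA]]; exists A; split => //; exact: subset_trans GH.
Qed.

Lemma eventually_likelyI eta eta' (G H : nat -> set Omega) :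
  eventually_likely eta G -> eventually_likely eta' H ->
  eventually_likely (eta + eta') (fun n => G n `&` H n).
Proof.
apply: filterS2 => n [A [mA AG PA]] [B [mB BH PB]]; exists (A `&` B); split.
- exact: measurableI.
- by move=> w [/AG ? /BH].
- rewrite setCI EFinD; apply: (le_trans (measureU2 _ _ _)); rewrite ?leeD//;
    exact: measurableC.
Qed.

Lemma with_high_probabilityI (G H : nat -> set Omega) :
  with_high_probability G -> with_high_probability H ->
  with_high_probability (fun n => G n `&` H n).
Proof.
move=> hG hH eta eta0; rewrite (splitr eta).
by apply: eventually_likelyI; [apply: hG|apply: hH]; rewrite divr_gt0.
Qed.

Lemma markov_ge0 (h : Omega -> R) (c : R) : measurable_fun setT h ->
  (forall w, 0 <= h w) -> 0 < c ->
  (P (~` [set w | (h w < c)%R]) <= (c^-1)%:E * \int[P]_w (h w)%:E)%E.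
Proof.
move=> mh h0 c0; set A := ~` _.
have AE : A = [set w | c <= h w].
  by rewrite /A; apply/seteqP; split => w /=; [move/negP; rewrite -leNgt|rewrite leNgt => /negP].
have mA : measurable A.
  rewrite AE -[X in measurable X]setTI -(_ : h @^-1` `[c, +oo[ = [set w | c <= h w]).
    exact: mh.
  by apply/seteqP; split => w /=; rewrite in_itv/= andbT.
rewrite lee_pdivlMl//.
apply: (@le_trans _ _ (\int[P]_(w in A) (h w)%:E)%E); last first.
  apply: ge0_subset_integral => //; first exact/measurable_EFinP.
  by move=> w _; rewrite lee_fin.
rewrite -integral_cst//; apply: ge0_le_integral => //.
- by move=> w _; rewrite lee_fin ltW.
- by apply: measurable_funTS; exact/measurable_EFinP.
- by move=> w; rewrite AE/= lee_fin.
Qed.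

End HighProbability.

Section Slutsky.
Context {R : realType} {d : measure_display} {Omega : measurableType d}.
Variable P : probability Omega R.
Local Notation RR := (measurableTypeR R * measurableTypeR R)%type.
Variables V X : nat -> Omega -> R * R.
Hypothesis mV : forall n, measurable_fun setT (V n : Omega -> RR).
Hypothesis mX : forall n, measurable_fun setT (X n : Omega -> RR).
Hypothesis close : forall e, 0 < e -> with_high_probability P
  (fun n => [set w | `|(X n w).1 - (V n w).1| < e /\ `|(X n w).2 - (V n w).2| < e]).

(** Working with lower limits of Lipschitz functions lets closeness in probability enter directly:
    on the good event [phi] changes by at most e / 3, and the bad event costs M times its
    probability. *)
Lemma slutsky_liminf (phi : R * R -> R) (L M c : R) : 0 <= L ->
  measurable_fun setT (phi : RR -> R) ->
  (forall x, 0 <= phi x <= M) -> plane_lipschitz L phi ->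
  (forall e, 0 < e -> \forall n \near \oo, c - e <= \int[P]_w phi (V n w)) ->
  forall e, 0 < e -> \forall n \near \oo, c - e <= \int[P]_w phi (X n w).
Proof.
move=> L0 mphi phiM phiL hV e e0.
have M0 : 0 <= M by have /andP[] := phiM (0, 0); exact: le_trans.
have e3 : 0 < e / 3 by rewrite divr_gt0.
pose dl := e / 3 / 2 / (L + 1).
have dl0 : 0 < dl by rewrite !divr_gt0// ltr_wpDl.
have Ldl : L * (dl + dl) <= e / 3.
  rewrite (_ : dl + dl = e / 3 / (L + 1)); last by rewrite /dl; field; rewrite gt_eqF// ltr_wpDl.
  by rewrite mulrA ler_pdivrMr ?ltr_wpDl// mulrC ler_wpM2l ?lerDl// ltW.
have eta0 : 0 < e / 3 / (M + 1) by rewrite !divr_gt0// ltr_wpDl.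
have := close dl0 eta0; apply: filterS2 (hV _ e3) => n hn [A [mA Agood PA]].
have bX (Y : Omega -> R * R) : measurable_fun setT (Y : Omega -> RR) ->
    bounded_measurable (fun w => phi (Y w)).
  move=> mY; split; first exact: measurableT_comp mphi mY.
  by exists M => w; have /andP[? ?] := phiM (Y w); rewrite ger0_norm.
have bA : bounded_measurable (\1_(~` A) : Omega -> R).
  split; first by apply: measurable_indic; exact: measurableC.
  by exists 1 => w; rewrite ger0_norm// indicE; case: (_ \in _).
(* On the complement of [A] the summand M alone dominates, since [phi] takes values between 0 and
   M. *)
have pt w : phi (V n w) <= phi (X n w) + (e / 3 + M * \1_(~` A) w).
  rewrite indicE; have [wA|wA] := pselect (A w).
    rewrite memNset/=; last by move/(_ wA).
    have [h1 h2] := Agood _ wA; rewrite mulr0 addr0.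
    have := phiL (V n w) (X n w); rewrite (distrC (V n w).1) (distrC (V n w).2).
    move=> /(le_trans (ler_norm _)); rewrite lerBlDl; move/le_trans; apply.
    rewrite lerD2l; apply: le_trans Ldl; rewrite ler_wpM2l// ltW// ltrD//.
  rewrite mem_set//= mulr1; have /andP[_] := phiM (V n w); have /andP[] := phiM (X n w).
  by move=> h1 _ h3; rewrite (le_trans h3)//; lra.
have iA : \int[P]_w (M * \1_(~` A) w) <= e / 3.
  rewrite RintegralZl//; last exact: bounded_measurable_integrable.
  rewrite [X in _ * X](_ : _ = fine (P (~` A))); last first.
    by rewrite /Rintegral integral_indic ?setIT//; exact: measurableC.
  have : fine (P (~` A)) <= e / 3 / (M + 1).
    by rewrite -lee_fin fineK// fin_num_measure//; exact: measurableC.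
  move=> h; apply: (@le_trans _ _ (M * (e / 3 / (M + 1)))); first by rewrite ler_wpM2l.
  by rewrite mulrA ler_pdivrMr ?ltr_wpDl// mulrC ler_wpM2l ?lerDl// ltW.
have bsum : bounded_measurable (fun w => e / 3 + M * \1_(~` A) w).
  apply: bounded_measurableD; first exact: bounded_measurable_cst.
  by apply: bounded_measurableM => //; exact: bounded_measurable_cst.
have : \int[P]_w phi (V n w) <= \int[P]_w (phi (X n w) + (e / 3 + M * \1_(~` A) w)).
  have i1 := bounded_measurable_integrable P (bX _ (mV n)).
  have i2 := bounded_measurable_integrable P (bounded_measurableD (bX _ (mX n)) bsum).
  by apply: le_Rintegral i1 i2 _ => // w _; exact: pt.
rewrite RintegralD//; last 2 first.
- by apply: bounded_measurable_integrable; exact: bX.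
- exact: bounded_measurable_integrable.
rewrite RintegralD//; last 2 first.
- by apply: bounded_measurable_integrable; exact: bounded_measurable_cst.
- apply: bounded_measurable_integrable; apply: bounded_measurableM => //.
  exact: bounded_measurable_cst.
rewrite Rintegral_probability_cst; lra.
Qed.

End Slutsky.

(** * Weak law, tightness and cosine moments in the plane *)

Section LimitTheorems.
Context {R : realType} {d d' : measure_display}
  {Omega : measurableType d} {T : measurableType d'}.
Variables (P : probability Omega R) (mu : probability T R).
Variable X : nat -> {RV P >-> T}.
Hypothesis indep : mutually_independent P X.
Hypothesis law : identically_distributed X mu.

Definition square_integrable (f : T -> R) :=
  measurable_fun setT f /\ mu.-integrable setT (fun x => (f x ^+ 2)%:E).

Lemma square_integrable_integrable f : square_integrable f ->
  mu.-integrable setT (EFin \o f).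
Proof.
move=> [mf f2].
apply: (@le_integrable _ _ _ mu setT _ _ (fun x => (1 + f x ^+ 2)%:E)) => //.
- exact/measurable_EFinP.
- move=> x _; rewrite /= lee_fin; apply: le_trans (ler_norm _).
  rewrite -(real_normK (num_real (f x))) -subr_ge0.
  rewrite (_ : _ - _ = (`|f x| - 1 / 2) ^+ 2 + 3 / 4); last by field.
  by have := sqr_ge0 (`|f x| - 1 / 2); lra.
- under eq_fun do rewrite EFinD; apply: integrableD => //.
  by apply: (bounded_measurable_integrable mu); exact: bounded_measurable_cst.
Qed.

Lemma square_integrable_mul f g : square_integrable f -> square_integrable g ->
  mu.-integrable setT (fun x => (f x * g x)%:E).
Proof.
move=> [mf f2] [mg g2].
apply: (@le_integrable _ _ _ mu setT _ _ (fun x => (f x ^+ 2 + g x ^+ 2)%:E)) => //.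
- by apply/measurable_EFinP; exact: measurable_funM.
- move=> x _; rewrite /= lee_fin; apply: le_trans (ler_norm _).
  rewrite normrM -(real_normK (num_real (f x))) -(real_normK (num_real (g x))).
  rewrite -subr_ge0 (_ : _ - _ = (`|f x| - `|g x| / 2) ^+ 2 + 3 / 4 * `|g x| ^+ 2); last by field.
  by have := sqr_ge0 (`|f x| - `|g x| / 2); have := sqr_ge0 `|g x|; lra.
- by under eq_fun do rewrite EFinD; exact: integrableD.
Qed.

Lemma square_integrableD f g : square_integrable f -> square_integrable g ->
  square_integrable (fun x => f x + g x).
Proof.
move=> sf sg; have [mf f2] := sf; have [mg g2] := sg.
split; first exact: measurable_funD.
rewrite (_ : (fun x => _) = (fun x => (f x ^+ 2)%:E + ((2 * (f x * g x))%:E + (g x ^+ 2)%:E))%E).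
  apply: integrableD => //; apply: integrableD => //.
  by under eq_fun do rewrite EFinM; apply: integrableZl => //; exact: square_integrable_mul.
by apply/funext => x; rewrite -!EFinD; congr EFin; ring.
Qed.

Lemma square_integrable_cst c : square_integrable (cst c).
Proof.
split => //.
by apply: (bounded_measurable_integrable mu (f := cst (c ^+ 2))); exact: bounded_measurable_cst.
Qed.

Lemma square_integrableZ c f : square_integrable f -> square_integrable (fun x => c * f x).
Proof.
move=> [mf f2]; split; first exact: measurable_funM.
by under eq_fun do rewrite exprMn EFinM; exact: integrableZl.
Qed.

Lemma square_integrable_sub_mean f : square_integrable f ->
  let g x := f x - \int[mu]_y f y in
  square_integrable g /\ \int[mu]_x g x = 0.
Proof.
move=> sf; split.
  by apply: square_integrableD => //; exact: square_integrable_cst.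
rewrite RintegralB//.
- by rewrite Rintegral_probability_cst subrr.
- exact: square_integrable_integrable.
- by apply: (bounded_measurable_integrable mu); exact: bounded_measurable_cst.
Qed.

Lemma partial_sum_sub f c n w :
  partial_sum X (fun x => f x - c) n w = partial_sum X f n w - n%:R * c.
Proof. by rewrite /partial_sum sumrB sumr_const card_ord mulr_natl. Qed.

Lemma partial_sum_tail f (c : R) n : square_integrable f -> \int[mu]_x f x = 0 -> 0 < c ->
  let A := [set w | `|partial_sum X f n w| < c] in
  measurable A /\
  (P (~` A) <= ((c ^+ 2)^-1 * (n%:R * \int[mu]_x (f x ^+ 2)))%:E)%E.
Proof.
move=> sf f0 c0; have [mf f2] := sf.
pose h w := partial_sum X f n w ^+ 2.
have mh : measurable_fun setT h.
  by apply: measurable_funX; exact: measurable_partial_sum.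
have AE : [set w | `|partial_sum X f n w| < c] = [set w | h w < c ^+ 2].
  apply/seteqP; split => w /=; rewrite /h -[X in X < c ^+ 2](real_normK (num_real _));
    by rewrite ltr_pXn2r// ?nnegrE ?ltW.
split.
  rewrite AE -[X in measurable X]setTI -(_ : h @^-1` `]-oo, c ^+ 2[ = [set w | h w < c ^+ 2]).
    exact: mh.
  by apply/seteqP; split => w /=; rewrite in_itv.
rewrite AE EFinM -(second_moment_partial_sum indep law mf f2 _ f0); last first.
  exact: square_integrable_integrable.
by apply: markov_ge0 => //; [move=> w; exact: sqr_ge0|rewrite exprn_gt0].
Qed.

Lemma weak_law f (e : R) : square_integrable f -> 0 < e -> with_high_probability P
  (fun n => [set w | `|n%:R^-1 * partial_sum X f n w - \int[mu]_x f x| < e]).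
Proof.
move=> sf e0 eta eta0; have [sg g0] := square_integrable_sub_mean sf.
set g := fun x => _ in sg g0.
pose v := \int[mu]_x (g x ^+ 2).
have v0 : 0 <= v by apply: Rintegral_ge0 => x _; exact: sqr_ge0.
near=> n.
have n0 : 0 < n%:R :> R.
  by rewrite ltr0n; near: n; exact: nbhs_infty_gt.
have [mA PA] := @partial_sum_tail g (n%:R * e) n sg g0 (mulr_gt0 n0 e0).
eexists; split; [exact: mA| |].
  move=> w /=; rewrite /g partial_sum_sub => h.
  rewrite (_ : _ - _ = n%:R^-1 * (partial_sum X f n w - n%:R * \int[mu]_x f x)); last first.
    by field; rewrite gt_eqF.
  by rewrite normrM ger0_norm ?invr_ge0 ?ltW// ltr_pdivrMl.
apply: (le_trans PA); rewrite lee_fin -/v.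
have -> : ((n%:R * e) ^+ 2)^-1 * (n%:R * v) = v / e ^+ 2 / n%:R.
  by field; rewrite !gt_eqF.
rewrite ler_pdivrMr// [eta * _]mulrC -ler_pdivrMr//.
by near: n; exact: nbhs_infty_ger.
Unshelve. all: end_near. Qed.

Lemma partial_sum_tight f (eta : R) : square_integrable f -> \int[mu]_x f x = 0 ->
  0 < eta -> exists2 C : R, 0 < C & eventually_likely P eta
  (fun n => [set w | `|partial_sum X f n w| < C * Num.sqrt n%:R]).
Proof.
move=> sf f0 eta0.
pose v := \int[mu]_x (f x ^+ 2).
have v0 : 0 <= v by apply: Rintegral_ge0 => x _; exact: sqr_ge0.
(* By Chebyshev the exceptional probability is at most v / C^2; taking v + 1 in place of v keeps C
   positive for a degenerate f. *)
pose C := Num.sqrt ((v + 1) / eta).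
have C0 : 0 < C by rewrite sqrtr_gt0 divr_gt0// ltr_wpDl.
exists C => //; near=> n.
have n0 : 0 < n%:R :> R.
  by rewrite ltr0n; near: n; exact: nbhs_infty_gt.
have c0 : 0 < C * Num.sqrt n%:R by rewrite mulr_gt0// sqrtr_gt0.
have [mA PA] := @partial_sum_tail f _ n sf f0 c0.
eexists; split; [exact: mA|by []|].
apply: (le_trans PA); rewrite lee_fin -/v exprMn !sqr_sqrtr ?ler0n//; last first.
  by rewrite divr_ge0 ?addr_ge0// ltW.
have -> : ((v + 1) / eta * n%:R)^-1 * (n%:R * v) = eta * (v / (v + 1)).
  by field; rewrite !gt_eqF// ltr_wpDl.
by rewrite ler_piMr ?(ltW eta0)// ler_pdivrMr ?ltr_wpDl// mul1r lerDl.
Unshelve. all: end_near. Qed.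

(** Cramer-Wold: for fixed a and b the exponent is a normalized sum of the scalar variables a g1 + b
    g2, whose variance is the squared norm of the row vector (a, b) A. *)
Lemma plane_clt_cos (g1 g2 : T -> R) (A : 'M[R]_2) :
  square_integrable g1 -> square_integrable g2 ->
  \int[mu]_x g1 x = 0 -> \int[mu]_x g2 x = 0 ->
  \int[mu]_x (g1 x ^+ 2) = A 0 0 ^+ 2 + A 0 1 ^+ 2 ->
  \int[mu]_x (g1 x * g2 x) = A 0 0 * A 1 0 + A 0 1 * A 1 1 ->
  \int[mu]_x (g2 x ^+ 2) = A 1 0 ^+ 2 + A 1 1 ^+ 2 ->
  forall c a b : R,
  \int[P]_w cos (c + (a * ((Num.sqrt n%:R)^-1 * partial_sum X g1 n w) +
     b * ((Num.sqrt n%:R)^-1 * partial_sum X g2 n w))) @[n --> \oo] -->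
  \int[plane_gauss]_z cos (c + (a * (mx_app A z).1 + b * (mx_app A z).2)).
Proof.
move=> s1 s2 z1 z2 v11 v12 v22 c a b.
pose f x := a * g1 x + b * g2 x.
have sa : square_integrable (fun x => a * g1 x) by exact: square_integrableZ.
have sb : square_integrable (fun x => b * g2 x) by exact: square_integrableZ.
have sf : square_integrable f by exact: square_integrableD.
have f0 : \int[mu]_x f x = 0.
  rewrite RintegralD//; try exact: square_integrable_integrable.
  rewrite !RintegralZl//; try exact: square_integrable_integrable.
  by rewrite z1 z2 !mulr0 addr0.
have E z : cos (c + (a * (mx_app A z).1 + b * (mx_app A z).2)) =
    cos (c + ((a * A 0 0 + b * A 1 0) * z.1 + (a * A 0 1 + b * A 1 1) * z.2)).
  by rewrite /mx_app/=; congr cos; ring.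
under eq_Rintegral do rewrite E.
rewrite plane_gauss_cos_moment.
have v : \int[mu]_x (f x ^+ 2) =
    (a * A 0 0 + b * A 1 0) ^+ 2 + (a * A 0 1 + b * A 1 1) ^+ 2.
  have Ef x : f x ^+ 2 = a ^+ 2 * g1 x ^+ 2 + (2 * a * b * (g1 x * g2 x) + b ^+ 2 * g2 x ^+ 2).
    by rewrite /f; ring.
  have i1 : mu.-integrable setT (EFin \o (fun x => a ^+ 2 * g1 x ^+ 2)).
    by rewrite /comp; under eq_fun do rewrite EFinM; apply: integrableZl => //; case: s1.
  have i2 : mu.-integrable setT (EFin \o (fun x => b ^+ 2 * g2 x ^+ 2)).
    by rewrite /comp; under eq_fun do rewrite EFinM; apply: integrableZl => //; case: s2.
  have i12 : mu.-integrable setT (EFin \o (fun x => 2 * a * b * (g1 x * g2 x))).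
    rewrite /comp; under eq_fun do rewrite EFinM.
    by apply: integrableZl => //; exact: square_integrable_mul.
  under eq_Rintegral do rewrite Ef.
  rewrite RintegralD//; last first.
    by rewrite /comp; under eq_fun do rewrite EFinD; exact: integrableD.
  rewrite RintegralD// !RintegralZl//; [|by case: s2|exact: square_integrable_mul|by case: s1].
  by rewrite v11 v12 v22; ring.
rewrite -v.
have [mf f2] := sf; have f1 := square_integrable_integrable sf.
have := @cos_partial_sum_cvg _ _ _ _ _ _ _ _ indep law _ mf f2 f1 f0 c.
rewrite (_ : (fun n => \int[P]_w cos (c + _)) = fun n => \int[P]_w cos (c + (a * ((Num.sqrt n%:R)^-1 * partial_sum X g1 n w) +
     b * ((Num.sqrt n%:R)^-1 * partial_sum X g2 n w))))//.
apply/funext => n; apply: eq_Rintegral => w _; congr (cos (c + _)).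
rewrite /partial_sum !mulr_sumr -big_split/=; apply: eq_bigr => i _.
by rewrite /f; ring.
Qed.

End LimitTheorems.

(** * Folded angles *)

(* [lra] unfolds [pi] to a multiple of a smaller constant, so it is abstracted first. *)
Ltac pi_lra :=
  match goal with
  | |- context [@pi ?R] => generalize dependent (@pi R); intros; lra
  | H : context [@pi ?R] |- _ => generalize dependent (@pi R); intros; lra
  end.

Section AngleTheory.
Context {R : realType}.
Variable alpha : R.
Hypothesis halpha : 2 * pi < alpha.

Let pi0 : (0 : R) < (pi : R). Proof. exact: pi_gt0. Qed.
Let hpa : (2 : R) * (pi : R) < alpha. Proof. exact: halpha. Qed.
Let alpha0 : 0 < alpha. Proof. by apply: lt_trans halpha; rewrite mulr_gt0. Qed.

Let pia : pi <= alpha / 2.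
Proof. by rewrite ler_pdivlMr// mulrC ltW. Qed.

Lemma angle_abs_le (n : int) (x : R) : angle_abs alpha x <= `|n%:~R * alpha + x|.
Proof. by apply: ge_inf; [exists 0 => _ [m _ <-]|exists n]. Qed.

Lemma angle_abs_ge0 x : 0 <= angle_abs alpha x.
Proof.
by apply: lb_le_inf; [exists `|0%:~R * alpha + x|; exists 0|move=> _ [m _ <-]].
Qed.

(** For n <> 0 the representative n alpha + z has absolute value at least alpha - |z|. *)
Lemma angle_abs_ge (c z : R) : c <= `|z| -> c <= alpha - `|z| -> c <= angle_abs alpha z.
Proof.
move=> c1 c2; apply: lb_le_inf; first by exists `|0%:~R * alpha + z|; exists 0.
move=> _ [n _ <-]; have [->|n0] := eqVneq n 0; first by rewrite mul0r add0r.
have n1 : alpha <= `|n%:~R * alpha|.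
  rewrite normrM (ger0_norm (ltW alpha0)) ler_peMl ?(ltW alpha0)//.
  by rewrite -intr_norm -[X in X <= _](_ : 1%:~R = 1)// ler_int -gtz0_ge1 normr_gt0.
have := ler_normB (n%:~R * alpha + z) z; rewrite addrK; lra.
Qed.

Lemma angle_abs_small (y : R) : `|y| <= alpha / 2 -> angle_abs alpha y = `|y|.
Proof.
move=> y2; apply/eqP; rewrite eq_le; apply/andP; split.
  by have := angle_abs_le 0 y; rewrite mul0r add0r.
by apply: angle_abs_ge => //; lra.
Qed.

Lemma angle_repr_shift (n : int) (x : R) : angle_abs alpha (n%:~R * alpha + x) = angle_abs alpha x.
Proof.
rewrite /angle_abs; congr inf; apply/seteqP; split => _ [m _ <-].
  by exists (m + n) => //; rewrite rmorphD/= mulrDl addrA.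
by exists (m - n) => //; rewrite rmorphB/= mulrBl addrA subrK.
Qed.

(** Rounding x / alpha to the nearest integer. Most facts below are reduced to this representative,
    on which [angle_abs] is the absolute value. *)
Lemma angle_repr_exists (x : R) : exists n : int, `|n%:~R * alpha + x| <= alpha / 2.
Proof.
pose k := Num.floor (x / alpha + 1 / 2); exists (- k).
have /andP[k1 k2] := floor_itv (x / alpha + 1 / 2).
rewrite -/k in k1 k2.
have h1 : k%:~R * alpha <= x + alpha / 2.
  by rewrite -ler_pdivlMr// mulrDl (_ : alpha / 2 / alpha = 1 / 2)//; field; rewrite gt_eqF.
have h2 : x + alpha / 2 < (k%:~R + 1) * alpha.
  rewrite -ltr_pdivrMr// mulrDl (_ : alpha / 2 / alpha = 1 / 2).
    by rewrite -(_ : (k + 1)%:~R = k%:~R + 1 :> R)//; rewrite rmorphD.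
  by field; rewrite gt_eqF.
by rewrite rmorphN/= mulNr ler_norml; apply/andP; split; lra.
Qed.

Lemma angle_absN x : angle_abs alpha (- x) = angle_abs alpha x.
Proof.
have [n hn] := angle_repr_exists x.
rewrite -(angle_repr_shift n x) (angle_abs_small hn) -(angle_repr_shift (- n) (- x)).
by rewrite rmorphN/= mulNr -opprD angle_abs_small ?normrN.
Qed.

Lemma angle_abs_triangle x y : angle_abs alpha (x + y) <= angle_abs alpha x + `|y|.
Proof.
have [n hn] := angle_repr_exists x.
rewrite -(angle_repr_shift n x) (angle_abs_small hn).
apply: (le_trans (angle_abs_le n _)); rewrite addrA; exact: ler_normD.
Qed.

Lemma angle_absD x y :
  angle_abs alpha (x + y) <= angle_abs alpha x + angle_abs alpha y.
Proof.
have [n hn] := angle_repr_exists y.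
rewrite -(angle_repr_shift n (x + y)) -(angle_repr_shift n y) (angle_abs_small hn).
by rewrite addrCA; exact: angle_abs_triangle.
Qed.

Lemma angle_repr_unique (x y z : R) : - pi <= y <= pi -> - pi <= z <= pi ->
  angle_repr alpha x y -> angle_repr alpha x z -> z = y.
Proof.
rewrite -!ler_norml => hy hz [n yn] [m zm].
have [mn|mn] := eqVneq m n; first by rewrite zm mn.
exfalso; have D : z - y = (m - n)%:~R * alpha by rewrite zm yn rmorphB/=; ring.
have h1 : 1 <= `|(m - n)%:~R| :> R.
  by rewrite -intr_norm -[X in X <= _](_ : 1%:~R = 1)// ler_int -gtz0_ge1 normr_gt0 subr_eq0.
have h2 : alpha <= `|(m - n)%:~R| * alpha by rewrite ler_peMl ?(ltW alpha0).
have := ler_normB z y; rewrite D normrM (ger0_norm (ltW alpha0)).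
by pi_lra.
Qed.

Definition fold_angle (x : R) : R :=
  if angle_abs alpha x <= pi then angle_val alpha x else pi.

Lemma fold_angle_small (n : int) (x : R) : `|n%:~R * alpha + x| <= pi ->
  fold_angle x = n%:~R * alpha + x.
Proof.
move=> hn; rewrite /fold_angle (le_trans (angle_abs_le n x))//.
rewrite /angle_val; set y := n%:~R * alpha + x.
have hy : - pi <= y <= pi by rewrite -ler_norml.
have ry : angle_repr alpha x y by exists n.
case: xgetP => [z _ [hz rz]|/(_ y)]; first exact: angle_repr_unique hy hz ry rz.
by move=> h; exfalso; exact: h.
Qed.

Lemma fold_angle_big (x : R) : pi < angle_abs alpha x -> fold_angle x = pi.
Proof. by rewrite ltNge /fold_angle => /negbTE ->. Qed.

Definition fcos x : R := cos (fold_angle x).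
Definition fsin x : R := sin (fold_angle x).

Lemma fcos_sin2 x : fcos x ^+ 2 + fsin x ^+ 2 = 1.
Proof. exact: cos2Dsin2. Qed.

Lemma fcos_small y : `|y| <= pi -> fcos y = cos y.
Proof. by move=> y1; rewrite /fcos (@fold_angle_small 0) mul0r add0r. Qed.

Lemma fsin_small y : `|y| <= pi -> fsin y = sin y.
Proof. by move=> y1; rewrite /fsin (@fold_angle_small 0) mul0r add0r. Qed.

Lemma fcos_big x : pi <= angle_abs alpha x -> fcos x = -1.
Proof.
rewrite le_eqVlt => /predU1P[E|h]; last by rewrite /fcos fold_angle_big// cospi.
have [n hn] := angle_repr_exists x.
have := angle_abs_small hn; rewrite angle_repr_shift -E => hp.
rewrite /fcos (@fold_angle_small n) -?hp//.
by rewrite -cos_norm -hp cospi.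
Qed.

Lemma fsin_big x : pi <= angle_abs alpha x -> fsin x = 0.
Proof.
by move=> /fcos_big h; apply/eqP; rewrite -sqrf_eq0; have := fcos_sin2 x; rewrite h; pi_lra.
Qed.

(** The first coordinate sees an angle through its distance to 0 alone; shift invariance and
    evenness follow, as does the formula for the metric. *)
Lemma fcosE x : fcos x = cos (Num.min (angle_abs alpha x) pi).
Proof.
case: (leP (angle_abs alpha x) pi) => [h|/ltW h]; last by rewrite fcos_big ?cospi.
have [n hn] := angle_repr_exists x.
have E := angle_abs_small hn; rewrite angle_repr_shift in E.
by rewrite /fcos (@fold_angle_small n) -?E// E cos_norm.
Qed.

Lemma fcos_shift (n : int) x : fcos (n%:~R * alpha + x) = fcos x.
Proof. by rewrite !fcosE angle_repr_shift. Qed.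

Lemma fold_angle_shift (n : int) x : fold_angle (n%:~R * alpha + x) = fold_angle x.
Proof.
have [h|h] := leP (angle_abs alpha x) pi; last by rewrite !fold_angle_big ?angle_repr_shift.
have [k hk] := angle_repr_exists x.
have E := angle_abs_small hk; rewrite angle_repr_shift in E.
rewrite (@fold_angle_small k x) -?E// (@fold_angle_small (k - n)).
  by rewrite rmorphB/= mulrBl addrA subrK.
by rewrite rmorphB/= mulrBl addrA subrK -E.
Qed.

Lemma fsin_shift (n : int) x : fsin (n%:~R * alpha + x) = fsin x.
Proof. by rewrite /fsin fold_angle_shift. Qed.

Lemma fcosN x : fcos (- x) = fcos x.
Proof. by rewrite !fcosE angle_absN. Qed.

Lemma fcos_le1 x : fcos x <= 1. Proof. exact: cos_le1. Qed.
Lemma fcos_geN1 x : -1 <= fcos x. Proof. exact: cos_geN1. Qed.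
Lemma fsin_max x : `|fsin x| <= 1. Proof. exact: sin_max. Qed.
Lemma fcos_max x : `|fcos x| <= 1. Proof. exact: cos_max. Qed.

Lemma cos_le_antitone (a b : R) : 0 <= a -> a <= b -> b <= pi -> cos b <= cos a.
Proof.
move=> a0 ab bpi; move: ab; rewrite le_eqVlt => /predU1P[->//|ab].
by apply/ltW; rewrite ltr_cos// in_itv/= ?a0 ?(ltW ab)//= ?bpi ?(le_trans (ltW ab))// (le_trans a0)// ltW.
Qed.

(** The right side is the cosine of the planar angle between the direction psi and the folded
    direction of x. Folding does not increase angular distances, and cosine decreases on [0, pi].
    Strict inequality may occur when y and psi are more than pi apart, or when y lies in the
    shadow. *)
Lemma fcos_tangent (x psi : R) : `|psi| <= pi ->
  fcos (x - psi) <= cos psi * fcos x + sin psi * fsin x.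
Proof.
move=> hpsi; have [n hn] := angle_repr_exists x.
rewrite -(fcos_shift n (x - psi)) addrA -(fcos_shift n x) -(fsin_shift n x).
move: (n%:~R * alpha + x) hn => y hn.
have [hy|hy] := leP `|y| pi.
  rewrite (fcos_small hy) (fsin_small hy) -cosB -(cosN (psi - y)) opprB.
  rewrite fcosE; have [d1|d1] := leP (angle_abs alpha (y - psi)) pi; last first.
    by rewrite cospi; exact: cos_geN1.
  have [small|big] := leP `|y - psi| pi.
    by rewrite angle_abs_small ?cos_norm// (le_trans small)// pia.
  have b2 : `|y - psi| <= 2 * pi.
    by apply: (le_trans (ler_normB _ _)); pi_lra.
  have E : cos (y - psi) = cos (2 * pi - `|y - psi|).
    rewrite -(cos_norm (y - psi)) -(cosN `|_|) -(cosD2pi (- `|y - psi|)); congr cos; ring.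
  rewrite E; apply: cos_le_antitone => //; first by pi_lra.
  by apply: angle_abs_ge; [pi_lra|rewrite lerD2r; exact: (ltW hpa)].
have hy' : pi <= angle_abs alpha y by rewrite angle_abs_small// ltW.
rewrite (fcos_big hy') (fsin_big hy') mulr0 addr0 mulrN1 fcosE -cosDpi -(cosN (psi + pi)).
have -> : cos (- (psi + pi)) = cos (pi - `|psi|).
  have [p0|p0] := leP 0 psi.
    rewrite ger0_norm// -(cosD2pi (- (psi + pi))); congr cos; ring.
  by rewrite ltr0_norm// cosN opprK addrC.
have h : pi - `|psi| <= angle_abs alpha (y - psi).
  have := angle_abs_triangle (y - psi) psi; rewrite subrK; pi_lra.
apply: cos_le_antitone; [pi_lra| |by rewrite ge_min lexx orbT].
by rewrite le_min h/= gerBl.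
Qed.

(** The distances from x to 0 and to psi add up to at least pi, so the two cosines have a sum of at
    most 0. *)
Lemma fcos_opposite (x psi : R) : pi <= angle_abs alpha psi ->
  fcos (x - psi) <= - fcos x.
Proof.
move=> hpsi; rewrite !fcosE.
set a := Num.min (angle_abs alpha x) pi; set b := Num.min _ pi.
have h : pi <= angle_abs alpha x + angle_abs alpha (x - psi).
  have := angle_absD x (- (x - psi)); rewrite angle_absN.
  by rewrite opprB addrC subrK; exact: le_trans.
have a0 : 0 <= a by rewrite le_min angle_abs_ge0 ltW.
have b0 : 0 <= b by rewrite le_min angle_abs_ge0 ltW.
have api : a <= pi by rewrite ge_min lexx orbT.
have bpi : b <= pi by rewrite ge_min lexx orbT.
have ab : pi - a <= b.
  rewrite le_min; apply/andP; split; last by pi_lra.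
  rewrite /a; case: (leP (angle_abs alpha x) pi) => _; last by rewrite subrr angle_abs_ge0.
  by pi_lra.
have -> : - cos a = cos (pi - a).
  by rewrite addrC cosDpi cosN.
by apply: cos_le_antitone => //; pi_lra.
Qed.

(** Transfers Lipschitz bounds and measurability from the first folded coordinate to the second. The
    two maxima are the positive and the negative part of [fsin], and both vanish on the shadow. *)
Lemma sin_fcos_half (x : R) :
  fsin x = Num.max 0 (fcos (x - pi / 2)) - Num.max 0 (fcos (x + pi / 2)).
Proof.
have pi2 : `|pi / 2| <= pi :> R by have := pi0; rewrite ger0_norm; pi_lra.
have h1 : fcos (x - pi / 2) <= fsin x.
  by have := fcos_tangent x pi2; rewrite cos_pihalf sin_pihalf mul0r add0r mul1r.
have h2 : fcos (x + pi / 2) <= - fsin x.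
  have := @fcos_tangent x (- (pi / 2)); rewrite normrN opprK => /(_ pi2).
  by rewrite cosN sinN cos_pihalf sin_pihalf mul0r add0r mulN1r.
have [n hn] := angle_repr_exists x.
have hs := fsin_shift n x.
have hm := fcos_shift n (x - pi / 2); have hp := fcos_shift n (x + pi / 2).
rewrite !addrA in hm hp; move: (n%:~R * alpha + x) hs hm hp hn => y hs hm hp hn.
have [hy|hy] := leP `|y| pi; last first.
  have s0 : fsin x = 0 by rewrite -hs fsin_big// angle_abs_small// ltW.
  rewrite s0 in h1 h2 *; rewrite oppr0 in h2.
  by rewrite !max_l// subrr.
have [y0|y0] := leP 0 y.
  have s0 : 0 <= fsin x by rewrite -hs fsin_small// sin_ge0_pi// y0/= -[y]ger0_norm.
  rewrite [X in _ - X]max_l; last by apply: le_trans h2 _; rewrite oppr_le0.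
  rewrite subr0; have -> : fcos (x - pi / 2) = fsin x; last by rewrite max_r.
  rewrite -hm -hs fcos_small ?fsin_small ?cosBpihalf//.
  by rewrite ger0_norm// in hy; rewrite ler_norml; apply/andP; split; pi_lra.
have s0 : fsin x <= 0.
  rewrite -hs fsin_small// -[y]opprK sinN oppr_le0 sin_ge0_pi// oppr_ge0 (ltW y0)/=.
  by rewrite -[- y]ltr0_norm.
rewrite [X in X - _]max_l; last exact: le_trans h1 _.
have -> : fcos (x + pi / 2) = - fsin x; last by rewrite max_r ?sub0r ?opprK// oppr_ge0.
rewrite -hp -hs fcos_small ?fsin_small ?cosDpihalf//.
by rewrite ltr0_norm// in hy; rewrite ler_norml; apply/andP; split; pi_lra.
Qed.

Lemma norm_sin_le (x : R) : `|sin x| <= `|x|.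
Proof.
have h (y : R) : 0 <= y -> `|sin y| <= y.
  move=> y0; rewrite ler_norml lerNl -subr_ge0 -[X in _ && X]subr_ge0 opprK.
  apply/andP; split; move: y y0.
    apply: (@ge0_from_derive _ (fun x => x + sin x) (fun x => 1 + cos x)).
    - by move=> y _; have := cos_geN1 y; lra.
    - by rewrite sin0 addr0.
  apply: (@ge0_from_derive _ (fun x => x - sin x) (fun x => 1 - cos x)).
  - by move=> y _; have := cos_le1 y; lra.
  - by rewrite sin0 subr0.
have [x0|/ltW x0] := leP 0 x; first by rewrite (ger0_norm x0); exact: h.
by rewrite -normrN -sinN (ler0_norm x0); apply: h; rewrite oppr_ge0.
Qed.

Lemma one_minus_cos_le_sqr (x : R) : 1 - cos x <= x ^+ 2.
Proof. by have := cos_taylor2 x; rewrite ler_norml => /andP[]; lra. Qed.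

Lemma one_minus_cos_le (x : R) : 1 - cos x <= 2 * `|x|.
Proof.
have [x1|x1] := leP 1 `|x|; first by have := cos_geN1 x; lra.
apply: (le_trans (one_minus_cos_le_sqr x)); rewrite -(real_normK (num_real x)) expr2.
by apply: ler_pM => //; lra.
Qed.

Lemma fcos_lipschitz x y : `|fcos x - fcos y| <= 2 * `|x - y|.
Proof.
have h u v : fcos u - fcos v <= 2 * `|u - v|.
  have [big|small] := leP 1 `|u - v|.
    by have := fcos_le1 u; have := fcos_geN1 v; lra.
  have uv : `|v - u| <= pi by rewrite distrC (le_trans (ltW small))//; have := @pi_ge2 R; lra.
  have := fcos_tangent v uv; rewrite opprB addrCA subrr addr0.
  have := norm_sin_le (v - u); have := fsin_max v; have := fcos_max v.
  have := one_minus_cos_le_sqr (v - u).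
  have : (v - u) ^+ 2 <= `|u - v|.
    by rewrite -(real_normK (num_real (v - u))) distrC expr2 ler_piMl// ltW.
  have : sin (v - u) * fsin v <= `|sin (v - u)|.
    by apply: (le_trans (ler_norm _)); rewrite normrM ler_piMr// fsin_max.
  have : (cos (v - u) - 1) * fcos v <= 1 - cos (v - u).
    have a1 : 0 <= 1 - cos (v - u) by rewrite subr_ge0 cos_le1.
    have a2 : 0 <= fcos v + 1 by have := fcos_geN1 v; lra.
    by have := mulr_ge0 a1 a2; lra.
  rewrite (distrC v u); lra.
rewrite ler_norml; have := h x y; have := h y x; rewrite (distrC y x) => h1 h2.
by apply/andP; split; lra.
Qed.

Lemma fsin_lipschitz x y : `|fsin x - fsin y| <= 4 * `|x - y|.
Proof.
have mx (a b : R) : `|Num.max 0 a - Num.max 0 b| <= `|a - b|.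
  rewrite ler_norml; have := ler_norm (a - b); have := ler_norm (b - a); rewrite (distrC b a).
  by case: (leP 0 a) => ?; case: (leP 0 b) => ?; move=> *; apply/andP; split; lra.
rewrite !sin_fcos_half.
have h1 := le_trans (mx (fcos (x - pi / 2)) (fcos (y - pi / 2))) (fcos_lipschitz _ _).
have h2 := le_trans (mx (fcos (y + pi / 2)) (fcos (x + pi / 2))) (fcos_lipschitz _ _).
rewrite (_ : x - pi / 2 - (y - pi / 2) = x - y) in h1; last by ring.
rewrite (_ : y + pi / 2 - (x + pi / 2) = y - x) in h2; last by ring.
rewrite (distrC y x) in h2.
set a := Num.max 0 (fcos (x - _)) in h1 *; set b := Num.max 0 (fcos (y - _)) in h1 *.
set c := Num.max 0 (fcos (x + _)) in h2 *; set e := Num.max 0 (fcos (y + _)) in h2 *.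
have -> : a - c - (b - e) = (a - b) + (e - c) by ring.
by apply: (le_trans (ler_normD _ _)); lra.
Qed.

(** Angular conditions whose negations describe [shadow_plus] and [shadow_minus] away from the
    origin; the sign tells which boundary ray belongs to the shadow. *)
Definition window_plus (x : R) := exists2 y, angle_repr alpha x y & - pi <= y < pi.
Definition window_minus (x : R) := exists2 y, angle_repr alpha x y & - pi < y <= pi.

(* The angles at distance in (0, e) from [pi] or [- pi], written with [fcos] so
   that measurability in the kale is evident. *)
Definition near_antipode (e x : R) :=
  (cos e < fcos (x - pi) < 1) || (cos e < fcos (x + pi) < 1).

Lemma fsinN x : fsin (- x) = - fsin x.
Proof.
rewrite !sin_fcos_half opprB (_ : - x - pi / 2 = - (x + pi / 2)); last by ring.
by rewrite (_ : - x + pi / 2 = - (x - pi / 2)) ?fcosN//; ring.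
Qed.

Lemma window_minusN x : window_minus (- x) <-> window_plus x.
Proof.
have rN u y : angle_repr alpha u y -> angle_repr alpha (- u) (- y).
  by move=> [n ->]; exists (- n); rewrite rmorphN/= mulNr opprD.
split=> -[y ry /andP[y1 y2]].
  by exists (- y); [rewrite -[x]opprK; exact: rN|rewrite lerNl opprK y2 ltrNl].
by exists (- y); [exact: rN|rewrite ltrNl opprK y2 lerNl].
Qed.

Lemma near_antipodeN e x : near_antipode e (- x) = near_antipode e x.
Proof.
rewrite /near_antipode orbC (_ : - x + pi = - (x - pi)); last by ring.
by rewrite (_ : - x - pi = - (x + pi)) ?fcosN//; ring.
Qed.

(** Unless the turn by psi carries x across a boundary ray, [fsin] follows the rotation formula in
    the window and stays 0 in the shadow, where the last term cancels - sin psi fcos x = sin psi.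
    For psi > 0 the ray at pi turns into the window and the ray at - pi into the shadow, which is
    why the half-open [window_minus] gives the exact count. *)
Lemma fsin_expansion_pos (e x psi : R) : 0 < e <= alpha / 2 - pi -> e <= pi ->
  0 <= psi < e -> ~~ near_antipode e x ->
  fsin (x - psi) = cos psi * fsin x - sin psi * fcos x - sin psi * `[< ~ window_minus x >]%:R.
Proof.
move=> /andP[e0 ea] epi /andP[psi0 psie].
have [n hn] := angle_repr_exists x.
have wx y : window_minus x -> angle_repr alpha x y -> - pi <= y <= pi -> - pi < y.
  move=> [z rz /andP[z1 z2]] ry hy.
  by rewrite -(angle_repr_unique hy (_ : - pi <= z <= pi) ry rz)// (ltW z1).
have rx : angle_repr alpha x (n%:~R * alpha + x) by exists n.
have wabs : window_minus x -> angle_abs alpha x <= pi.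
  move=> [z [m zm] /andP[z1 z2]].
  have : angle_abs alpha x <= `|z| by rewrite zm; exact: angle_abs_le.
  by move/le_trans; apply; rewrite ler_norml z2 (ltW z1).
rewrite /near_antipode -(fcos_shift n (x - pi)) -(fcos_shift n (x + pi)).
rewrite (addrA _ x (- pi)) (addrA _ x pi).
rewrite -(fsin_shift n (x - psi)) -(fcos_shift n x) -(fsin_shift n x) (addrA _ x (- psi)).
rewrite -(angle_repr_shift n x) in wabs.
move: (n%:~R * alpha + x) rx hn wabs => y ry hn wabs.
have near z : 0 < `|z| -> `|z| < e -> cos e < fcos z < 1.
  move=> z0 ze; have zp : `|z| <= pi by rewrite (le_trans (ltW ze)).
  rewrite fcos_small// -(cos_norm z) -[X in _ && (_ < X)]cos0.
  by rewrite !ltr_cos ?ze ?z0// in_itv/= ?lexx ?normr_ge0 ?zp ?(ltW e0) ?epi ?pi_ge0.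
move=> /norP[nz1 nz2].
have nn1 : ~ (0 < `|y - pi| /\ `|y - pi| < e).
  by move=> [h1 h2]; move/negP: nz1; apply; exact: near.
have nn2 : ~ (0 < `|y + pi| /\ `|y + pi| < e).
  by move=> [h1 h2]; move/negP: nz2; apply; exact: near.
have [hy|hy] := leP `|y| pi; last first.
  have hyw : ~ window_minus x.
    by move=> /wabs; rewrite (angle_abs_small hn) => h; move: hy; rewrite ltNge h.
  have hb : pi <= angle_abs alpha y by rewrite (angle_abs_small hn) ltW.
  rewrite asboolT//= (fsin_big hb) (fcos_big hb).
  have [h|h] := leP pi (angle_abs alpha (y - psi)).
    by rewrite fsin_big//; ring.
  exfalso; have := angle_abs_triangle (y - psi) psi; rewrite subrK (angle_abs_small hn).
  rewrite (ger0_norm psi0) => ht.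
  have [y0|y0] := leP 0 y.
    rewrite (ger0_norm y0) in hy ht; apply: nn1; rewrite ger0_norm; by [split; pi_lra|pi_lra].
  rewrite (ltr0_norm y0) in hy ht; apply: nn2; rewrite ltr0_norm; by [split; pi_lra|pi_lra].
have [ypi|ypi] := eqVneq y (- pi).
  have hyw : ~ window_minus x.
    move=> /(wx y) /(_ ry); rewrite ypi ltxx lexx/= => h.
    by suff : false by []; apply: h; have := pi_ge0 R; lra.
  rewrite asboolT//= fsin_big; last first.
    rewrite ypi -opprD angle_absN angle_abs_small; rewrite ger0_norm; by [pi_lra|apply: addr_ge0].
  by rewrite (fsin_small hy) (fcos_small hy) ypi sinN cosN sinpi cospi; ring.
have y1 : - pi < y by rewrite lt_neqAle eq_sym ypi; move: hy; rewrite ler_norml => /andP[].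
have hyw : window_minus x.
  by exists y => //; rewrite y1; move: hy; rewrite ler_norml => /andP[].
rewrite asboolF/=; last by move/(_ hyw).
rewrite mulr0 subr0 (fsin_small hy) (fcos_small hy).
rewrite fsin_small; first by rewrite sinB; ring.
rewrite leNgt; apply/negP => big; apply: nn2.
have [yp|yp] := leP 0 (y - psi).
  by move: big; rewrite (ger0_norm yp); move: hy; rewrite ler_norml => /andP[]; pi_lra.
rewrite (ltr0_norm yp) in big; rewrite ger0_norm; by [split; pi_lra|pi_lra].
Qed.

(** Reflection x -> - x exchanges the windows and reduces negative psi to positive psi. Near the
    boundary rays each term is bounded separately: 4 |psi| from [fsin_lipschitz], 2 |psi| from 1 -
    cos psi, and |psi| from each term with sin psi, in total 8 |psi|. *)
Lemma fsin_expansion (e x psi : R) : 0 < e <= alpha / 2 - pi -> e <= pi -> `|psi| < e ->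
  `|fsin (x - psi) - (cos psi * fsin x - sin psi * fcos x -
     sin psi * (if 0 <= psi then `[< ~ window_minus x >]%:R else `[< ~ window_plus x >]%:R))|
  <= 8 * `|psi| * (near_antipode e x)%:R.
Proof.
move=> he epi hpsi; set c := (if _ then _ else _) : R.
have [hx|hx] := boolP (near_antipode e x).
  rewrite mulr1.
  have c01 : `|c| <= 1.
    by rewrite /c; case: ifP => _; case: asboolP => _; rewrite /= ?normr0 ?normr1.
  have := fsin_lipschitz (x - psi) x; rewrite addrAC subrr sub0r normrN.
  have h1 := one_minus_cos_le psi.
  have : `|(1 - cos psi) * fsin x| <= 2 * `|psi|.
    rewrite normrM ger0_norm ?subr_ge0 ?cos_le1//.
    by rewrite (le_trans _ h1)// ler_piMr ?subr_ge0 ?cos_le1 ?fsin_max.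
  have : `|sin psi * fcos x| <= `|psi|.
    rewrite normrM; apply: le_trans (norm_sin_le psi).
    by rewrite ler_piMr ?fcos_max.
  have : `|sin psi * c| <= `|psi|.
    by rewrite normrM; apply: le_trans (norm_sin_le psi); rewrite ler_piMr.
  rewrite !ler_norml => /andP[? ?] /andP[? ?] /andP[? ?] /andP[? ?].
  by apply/andP; split; lra.
rewrite mulr0 le_eqVlt normr_eq0; apply/orP; left; rewrite subr_eq0; apply/eqP.
rewrite /c; have [p0|p0] := leP 0 psi.
  by apply: fsin_expansion_pos he epi _ hx; rewrite p0 -[psi]ger0_norm.
have hx' : ~~ near_antipode e (- x) by rewrite near_antipodeN.
have := @fsin_expansion_pos e (- x) (- psi) he epi _ hx'.
rewrite oppr_ge0 (ltW p0)/= -(ltr0_norm p0) hpsi (ltr0_norm p0) => /(_ isT).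
rewrite opprK (_ : - x + psi = - (x - psi)); last by ring.
rewrite !fsinN fcosN cosN sinN (_ : (~ window_minus (- x)) = (~ window_plus x)).
  by move=> h; rewrite -[LHS]opprK h; ring.
by apply/propext; split => h1 h2; apply: h1; exact/window_minusN.
Qed.

End AngleTheory.

(** * Barycenters in the kale *)

Section KalePoints.
Context {R : realType}.
Variable alpha : R.
Hypothesis halpha : 2 * pi < alpha.
Local Notation fcos := (fcos alpha).
Local Notation fsin := (fsin alpha).
Implicit Types p q : kale alpha.

Let alpha0 : 0 < alpha.
Proof. by apply: lt_trans halpha; rewrite mulr_gt0// pi_gt0. Qed.

Lemma krad_ge0 p : 0 <= krad p.
Proof.
by rewrite /krad; case: p => -[r t] /=; rewrite /kale_coord => /orP[/andP[/ltW]|/eqP[-> _]].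
Qed.

Definition folded1 (theta : R) p : R := krad p * fcos (kang p - theta).
Definition folded2 (theta : R) p : R := krad p * fsin (kang p - theta).

Lemma foldingE theta p : folding theta p = (folded1 theta p, folded2 theta p).
Proof. by []. Qed.

Lemma polar_coord (r theta : R) : 0 < r ->
  kcoords (polar alpha r theta) = (r, theta - (Num.floor (theta / alpha))%:~R * alpha).
Proof.
move=> r0; apply: insubdK; rewrite unfold_in /kale_coord/= r0/=; apply/orP; left.
have /andP[h1 h2] := floor_itv (theta / alpha).
apply/andP; split; first by rewrite subr_ge0 -ler_pdivlMr.
rewrite ltrBlDl -[X in _ + X]mul1r -mulrDl -ltr_pdivrMr//.
by rewrite -(_ : (Num.floor (theta / alpha) + 1)%:~R = (Num.floor (theta / alpha))%:~R + 1 :> R)// rmorphD.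
Qed.

(** A pair with radius 0 and nonzero reduced angle is not canonical, and the default value of
    [insubd] is then the origin as well. *)
Lemma polar0 theta : polar alpha 0 theta = korigin alpha.
Proof.
rewrite /polar /insubd; case: insubP => //= -[c hc] /= h E; apply/val_inj => /=.
rewrite E in h hc *; move: h; rewrite /kale_coord/= ltxx/= => /eqP[->].
by [].
Qed.

Lemma krad_polar (r theta : R) : 0 <= r -> krad (polar alpha r theta) = r.
Proof.
rewrite le_eqVlt => /predU1P[<-|r0]; first by rewrite polar0.
by rewrite /krad polar_coord.
Qed.

Lemma polar_kang (r theta : R) : 0 < r ->
  exists n : int, kang (polar alpha r theta) = n%:~R * alpha + theta.
Proof.
move=> r0; rewrite /kang polar_coord//=; exists (- Num.floor (theta / alpha)).
by rewrite rmorphN/= mulNr addrC.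
Qed.

Lemma folded1_polar theta0 (r theta : R) : 0 <= r ->
  folded1 theta0 (polar alpha r theta) = r * fcos (theta - theta0).
Proof.
move=> r0; rewrite /folded1 krad_polar//.
move: r0; rewrite le_eqVlt => /predU1P[<-|r0]; first by rewrite !mul0r.
have [n ->] := polar_kang theta r0.
by rewrite -addrA fcos_shift.
Qed.

Lemma folded2_polar theta0 (r theta : R) : 0 <= r ->
  folded2 theta0 (polar alpha r theta) = r * fsin (theta - theta0).
Proof.
move=> r0; rewrite /folded2 krad_polar//.
move: r0; rewrite le_eqVlt => /predU1P[<-|r0]; first by rewrite !mul0r.
have [n ->] := polar_kang theta r0.
by rewrite -addrA fsin_shift.
Qed.

Lemma polar_krad_kang p : polar alpha (krad p) (kang p) = p.
Proof.
have := krad_ge0 p; rewrite le_eqVlt => /predU1P[r0|r0].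
  rewrite -r0 polar0; apply/val_inj; case: p r0 => -[r t] /= hc; rewrite /krad/= => r0.
  by move: hc; rewrite /kale_coord -r0 ltxx/= => /eqP[->].
apply/val_inj => /=; rewrite polar_coord// [RHS]surjective_pairing; congr pair.
have : kale_coord alpha (kcoords p) by case: (p).
rewrite /kale_coord => /orP[/andP[_ /andP[t0 t1]]|/eqP E]; last by rewrite /krad E ltxx in r0.
have -> : Num.floor (kang p / alpha) = 0.
  apply/floor_def; rewrite add0r divr_ge0 ?(ltW alpha0)//=.
  by rewrite ltr_pdivrMr// mul1r.
by rewrite mul0r subr0.
Qed.

(** One law of cosines for both cases of [kdist]: from distance pi on, [fcos] is - 1 and the
    expression is the square of the sum of the radii. *)
Definition kdist_sq p q : R :=
  krad p ^+ 2 + krad q ^+ 2 - 2 * krad p * krad q * fcos (kang p - kang q).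

Lemma kdist_sq_ge0 p q : 0 <= kdist_sq p q.
Proof.
rewrite (_ : kdist_sq p q = (krad p - krad q) ^+ 2 +
  2 * (krad p * krad q) * (1 - fcos (kang p - kang q))); last by rewrite /kdist_sq; ring.
by rewrite addr_ge0 ?sqr_ge0// mulr_ge0 ?mulr_ge0 ?krad_ge0// subr_ge0 fcos_le1.
Qed.

Lemma kdistE p q : kdist p q = Num.sqrt (kdist_sq p q).
Proof.
rewrite /kdist /kdist_sq; case: leP => h.
  rewrite fcos_big// (_ : _ - _ = (krad p + krad q) ^+ 2); last by ring.
  by rewrite sqrtr_sqr ger0_norm// addr_ge0 ?krad_ge0.
by rewrite fcosE// min_l// ltW.
Qed.

Lemma kdist_sqr p q : kdist p q ^+ 2 = kdist_sq p q.
Proof. by rewrite kdistE sqr_sqrtr// kdist_sq_ge0. Qed.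

Lemma kdist_sym p q : kdist p q = kdist q p.
Proof.
rewrite !kdistE; congr Num.sqrt; rewrite /kdist_sq -(fcosN halpha (kang p - _)) opprB; ring.
Qed.

Lemma kdist_origin q : kdist (korigin alpha) q = krad q.
Proof.
rewrite kdistE /kdist_sq {1 2}/krad/= mulr0 !mul0r subr0 expr0n add0r sqrtr_sqr.
by rewrite ger0_norm ?krad_ge0.
Qed.

(** The tangent inequality bounds the difference by a linear form in (fcos x, fsin x), a unit
    vector. Cauchy-Schwarz, written as an explicit square, bounds the form by the norm of its
    coefficients, which is the planar law of cosines. At angles of at least pi apart the sum of the
    radii suffices. *)
Let folded1_lip_half theta p q : folded1 theta q - folded1 theta p <= kdist p q.
Proof.
rewrite kdistE; have s0 := kdist_sq_ge0 p q; move: s0.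
rewrite /folded1 /kdist_sq.
have a0 := krad_ge0 p; have b0 := krad_ge0 q.
move: a0 b0; set a := krad p; set b := krad q => a0 b0.
rewrite (_ : kang q - theta = kang p - theta - (kang p - kang q)); last by ring.
set x := kang p - theta; set psi := kang p - kang q => s0.
have [h|h] := leP pi (angle_abs alpha psi).
  rewrite (fcos_big halpha h) (_ : a ^+ 2 + b ^+ 2 - _ = (a + b) ^+ 2); last by ring.
  rewrite sqrtr_sqr ger0_norm ?addr_ge0//.
  have : b * fcos (x - psi) <= b by rewrite ler_piMr ?fcos_le1.
  have : - a <= a * fcos x by rewrite -mulrN1 ler_wpM2l ?fcos_geN1.
  lra.
have [n hn] := angle_repr_exists halpha psi.
have np := angle_abs_small halpha hn; rewrite angle_repr_shift in np.
rewrite -(fcos_shift halpha (- n) (x - psi)) -(fcos_shift halpha n psi) in s0 *.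
rewrite (_ : (- n)%:~R * alpha + (x - psi) = x - (n%:~R * alpha + psi)); last first.
  by rewrite rmorphN/=; ring.
rewrite np in h; move: (n%:~R * alpha + psi) h s0 => ps h s0.
have hp : `|ps| <= pi by exact: ltW.
apply: (@le_trans _ _ ((b * cos ps - a) * fcos x + b * sin ps * fsin x)).
  by have := ler_wpM2l b0 (fcos_tangent halpha x hp); lra.
rewrite (fcos_small halpha hp) in s0 *.
apply: (le_trans (ler_norm _)); rewrite -sqrtr_sqr ler_wsqrtr//.
have h1 := fcos_sin2 alpha x; have h2 := cos2Dsin2 ps.
have E : a ^+ 2 + b ^+ 2 - 2 * a * b * cos ps = (b * cos ps - a) ^+ 2 + (b * sin ps) ^+ 2.
  by have /= := congr1 (fun z => b ^+ 2 * z) h2; lra.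
rewrite E -subr_ge0; set A := b * cos ps - a; set B := b * sin ps.
rewrite (_ : _ - _ = (A * fsin x - B * fcos x) ^+ 2) ?sqr_ge0//.
by have /= := congr1 (fun z => (A ^+ 2 + B ^+ 2) * z) h1; lra.
Qed.

Lemma folded1_lipschitz theta p q : `|folded1 theta p - folded1 theta q| <= kdist p q.
Proof.
rewrite ler_norml; apply/andP; split; last by rewrite kdist_sym; exact: folded1_lip_half.
by rewrite lerNl opprB; exact: folded1_lip_half.
Qed.

Lemma krad_lipschitz p q : `|krad p - krad q| <= kdist p q.
Proof.
rewrite kdistE -sqrtr_sqr ler_wsqrtr// -subr_ge0.
rewrite (_ : _ - _ = 2 * (krad p * krad q) * (1 - fcos (kang p - kang q))).
  by rewrite mulr_ge0 ?mulr_ge0 ?krad_ge0// subr_ge0 fcos_le1.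
by rewrite /kdist_sq; ring.
Qed.

Lemma folded2E theta p : folded2 theta p =
  Num.max 0 (folded1 (theta + pi / 2) p) - Num.max 0 (folded1 (theta - pi / 2) p).
Proof.
rewrite /folded2 /folded1 (sin_fcos_half halpha) mulrBr !maxr_pMr ?krad_ge0// mulr0.
by rewrite !opprD !opprK !addrA.
Qed.

Lemma folded1_le theta p : `|folded1 theta p| <= krad p.
Proof. by rewrite normrM ger0_norm ?krad_ge0// ler_piMr ?krad_ge0// fcos_max. Qed.

Lemma folded2_le theta p : `|folded2 theta p| <= krad p.
Proof. by rewrite normrM ger0_norm ?krad_ge0// ler_piMr ?krad_ge0// fsin_max. Qed.

(** Preimages of open half-lines are [kdist]-open, hence among the generators of the
    sigma-algebra. *)
Lemma kopen_measurable_fun (f : kale alpha -> R) :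
  (forall p q, `|f p - f q| <= kdist p q) -> measurable_fun setT f.
Proof.
move=> fL; apply: (measurability _ (RGenInftyO.measurableE R)) => //.
move=> _ [_ [c ->] <-]; rewrite setTI; apply: sub_gen_smallest => p /=.
rewrite in_itv/= => pc; exists (c - f p); first by rewrite subr_gt0.
move=> q pq; rewrite /= in_itv/=.
have := le_lt_trans (fL p q) pq; rewrite ltr_norml => /andP[]; lra.
Qed.

Lemma measurable_krad : measurable_fun setT (@krad R alpha).
Proof. by apply: kopen_measurable_fun => p q; exact: krad_lipschitz. Qed.

Lemma measurable_folded1 theta : measurable_fun setT (folded1 theta).
Proof. by apply: kopen_measurable_fun => p q; exact: folded1_lipschitz. Qed.

Lemma measurable_folded2 theta : measurable_fun setT (folded2 theta).
Proof.
rewrite (_ : folded2 theta = fun p => Num.max 0 (folded1 (theta + pi / 2) p) -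
    Num.max 0 (folded1 (theta - pi / 2) p)); last by apply/funext => p; exact: folded2E.
by apply: measurable_funB; apply: measurable_maxr => //; exact: measurable_folded1.
Qed.

End KalePoints.

(** * Folded moments as functions of the angle *)

Section Profile.
Context {R : realType}.
Variable alpha : R.
Hypothesis halpha : 2 * pi < alpha.
Local Notation fcos := (fcos alpha).
Local Notation fsin := (fsin alpha).
Implicit Types p q : kale alpha.

Let alpha0 : 0 < alpha.
Proof. by apply: lt_trans halpha; rewrite mulr_gt0// pi_gt0. Qed.

Lemma folded1_tangent theta psi p : `|psi| <= pi ->
  folded1 (theta + psi) p <= cos psi * folded1 theta p + sin psi * folded2 theta p.
Proof.
move=> h; rewrite /folded1 /folded2 opprD addrA.
by have := ler_wpM2l (krad_ge0 p) (fcos_tangent halpha (kang p - theta) h); lra.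
Qed.

Lemma folded1_opposite theta psi p : pi <= angle_abs alpha psi ->
  folded1 (theta + psi) p <= - folded1 theta p.
Proof.
move=> h; rewrite /folded1 opprD addrA.
by have := ler_wpM2l (krad_ge0 p) (fcos_opposite halpha (kang p - theta) h); lra.
Qed.

Lemma folded1_angle_lipschitz x y p : `|folded1 x p - folded1 y p| <= 4 * krad p * `|x - y|.
Proof.
rewrite /folded1 -mulrBr normrM (ger0_norm (krad_ge0 p)).
have := ler_wpM2l (krad_ge0 p) (fcos_lipschitz halpha (kang p - x) (kang p - y)).
rewrite (_ : kang p - x - (kang p - y) = y - x); last by ring.
rewrite (distrC y) => h.
by have := mulr_ge0 (krad_ge0 p) (normr_ge0 (x - y)); lra.
Qed.

Lemma folded2_angle_lipschitz x y p : `|folded2 x p - folded2 y p| <= 4 * krad p * `|x - y|.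
Proof.
rewrite /folded2 -mulrBr normrM (ger0_norm (krad_ge0 p)).
have := ler_wpM2l (krad_ge0 p) (fsin_lipschitz halpha (kang p - x) (kang p - y)).
rewrite (_ : kang p - x - (kang p - y) = y - x); last by ring.
by rewrite (distrC y) mulrA (mulrC 4 (krad p)).
Qed.

Lemma folded1_shift (n : int) theta p : folded1 (n%:~R * alpha + theta) p = folded1 theta p.
Proof.
rewrite /folded1 opprD addrCA -(fcos_shift halpha n) addrA; congr (_ * fcos _); ring.
Qed.

(* [M] and [m] stand for the two coordinates of a folded first moment as functions of the angle. *)
Record kale_profile (M m : R -> R) : Prop := KaleProfile {
  profile_tangent : forall theta psi, `|psi| <= pi ->
    M (theta + psi) <= cos psi * M theta + sin psi * m theta ;
  profile_opposite : forall theta psi, pi <= angle_abs alpha psi ->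
    M (theta + psi) <= - M theta ;
  profile_lipschitz : exists2 L : R, 0 <= L & forall x y,
    `|M x - M y| <= L * `|x - y| /\ `|m x - m y| <= L * `|x - y| ;
  profile_shift : forall (n : int) theta, M (n%:~R * alpha + theta) = M theta }.

Variables M m : R -> R.
Hypothesis prof : kale_profile M m.

Lemma profile_max : exists theta, forall theta', M theta' <= M theta.
Proof.
have [L L0 ML] := profile_lipschitz prof.
have cM : continuous M.
  move=> x; apply/cvgrPdist_lt => e e0.
  have L1 : 0 < L + 1 by lra.
  exists (e / (L + 1)) => /=; first exact: divr_gt0.
  move=> y; rewrite /= => xy; have [h _] := ML x y; apply: (le_lt_trans h).
  apply: (@le_lt_trans _ _ ((L + 1) * `|x - y|)); first by rewrite ler_wpM2r// lerDl.
  by rewrite mulrC -ltr_pdivlMr.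
have [c cin cmax] := @EVT_max R M 0 alpha (ltW alpha0) (continuous_subspaceT cM).
exists c => theta; rewrite -(profile_shift prof (- Num.floor (theta / alpha)) theta).
apply: cmax; rewrite in_itv/= rmorphN/= mulNr addrC.
have /andP[h1 h2] := floor_itv (theta / alpha).
apply/andP; split; first by rewrite subr_ge0 -ler_pdivlMr.
rewrite lerBlDl -[X in _ + X]mul1r -mulrDl -ler_pdivrMr//.
by apply/ltW; rewrite -(_ : (Num.floor (theta / alpha) + 1)%:~R = (Num.floor (theta / alpha))%:~R + 1 :> R)// rmorphD.
Qed.

Let small_trig (psi : R) : 0 < psi < 1 -> [/\ psi <= pi, 0 < sin psi & 0 <= cos psi].
Proof.
move=> /andP[p0 p1]; have p2 := @pi_ge2 R.
have psi2 : psi <= pi by rewrite (le_trans (ltW p1))// (le_trans _ p2)// ler1n.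
have ph : 1 <= pi / 2 :> R by rewrite ler_pdivlMr// mul1r.
split => //.
  by apply: sin_gt0_pi; rewrite p0/= (lt_le_trans p1)// (le_trans _ p2)// ler1n.
apply: cos_ge0_pihalf; rewrite (le_trans (ltW p1))// andbT.
by rewrite (le_trans _ (ltW p0))// oppr_le0 (le_trans _ ph).
Qed.

(** The tangent inequality based at theta bounds M from above and says nothing at a maximum. Based
    at theta + s psi with s = 1 or - 1 and looking back at theta, it forces s m (theta + s psi) <=
    0, and the Lipschitz bound lets psi tend to 0. *)
Lemma profile_critical theta : (forall theta', M theta' <= M theta) -> 0 <= M theta ->
  m theta = 0.
Proof.
move=> tmax M0; have [L L0 ML] := profile_lipschitz prof.
have h s (psi : R) : (s = 1 \/ s = -1) -> 0 < psi < 1 -> s * m (theta + s * psi) <= 0.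
  move=> hs hpsi; have [psi2 sin0 cos0] := small_trig hpsi.
  have := @profile_tangent _ _ prof (theta + s * psi) (- (s * psi)).
  rewrite addrK cosN sinN.
  have -> : cos (s * psi) = cos psi by case: hs => ->; rewrite ?mul1r ?mulN1r ?cosN.
  have -> : sin (s * psi) = s * sin psi.
    by case: hs => ->; rewrite ?mul1r ?mulN1r ?sinN.
  have -> : `|- (s * psi)| = psi.
    case/andP: hpsi => p0 _.
    by case: hs => ->; rewrite ?mul1r ?mulN1r ?opprK ?normrN gtr0_norm.
  move=> /(_ psi2) ht.
  have := ler_wpM2l cos0 (tmax (theta + s * psi)).
  have : cos psi * M theta <= M theta by rewrite ler_piMl// cos_le1.
  move=> h1 h2; rewrite leNgt; apply/negP => h3.
  by have := mulr_gt0 sin0 h3; lra.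
have lim (a : R) : (forall psi : R, 0 < psi < 1 -> a <= L * psi) -> a <= 0.
  move=> ha; apply/ler_addgt0Pr => e e0; rewrite add0r.
  pose psi := Num.min (1 / 2) (e / (L + 1)).
  have L1 : 0 < L + 1 by lra.
  have p0 : 0 < psi by rewrite lt_min !divr_gt0.
  have p1 : psi < 1 by rewrite gt_min; apply/orP; left; lra.
  apply: (le_trans (ha psi _)); first by rewrite p0 p1.
  apply: (@le_trans _ _ ((L + 1) * (e / (L + 1)))).
    by apply: ler_pM => //; [exact: ltW|rewrite lerDl|rewrite ge_min lexx orbT].
  by rewrite mulrC divfK ?gt_eqF.
have up : m theta <= 0.
  apply: lim => psi hpsi; have := h 1 psi (or_introl erefl) hpsi; rewrite !mul1r.
  have [_] := ML (theta + psi) theta; rewrite addrAC subrr add0r.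
  by case/andP: hpsi => p0 _; rewrite (gtr0_norm p0) ler_norml => /andP[]; lra.
have dn : - m theta <= 0.
  apply: lim => psi hpsi; have := h (-1) psi (or_intror erefl) hpsi; rewrite !mulN1r.
  have [_] := ML (theta - psi) theta; rewrite addrAC subrr add0r normrN.
  by case/andP: hpsi => p0 _; rewrite (gtr0_norm p0) ler_norml => /andP[]; lra.
by apply/eqP; rewrite eq_le up -oppr_le0.
Qed.

(** With m = 0 at the maximizer, the tangent inequality settles angles up to pi and
    [profile_opposite] those beyond. This is the comparison that turns the Frechet function into a
    law of cosines. *)
Lemma profile_le_fcos theta0 theta : (forall theta', M theta' <= M theta0) -> 0 <= M theta0 ->
  M theta <= M theta0 * fcos (theta - theta0).
Proof.
move=> tmax M0; have m0 := profile_critical tmax M0.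
have [n hn] := angle_repr_exists halpha (theta - theta0).
have E : M theta = M (theta0 + (n%:~R * alpha + (theta - theta0))).
  by rewrite -(profile_shift prof n); congr M; ring.
rewrite E -(fcos_shift halpha n); move: (n%:~R * alpha + (theta - theta0)) hn => psi hn.
have [h|h] := leP `|psi| pi.
  by rewrite (fcos_small halpha h) mulrC; have := profile_tangent prof theta0 h; rewrite m0 mulr0 addr0.
have ha : pi <= angle_abs alpha psi by rewrite angle_abs_small// ltW.
by rewrite (fcos_big halpha ha) mulrN1; exact: (profile_opposite prof).
Qed.

End Profile.

(** * Empirical moments and the barycenter *)

Section Empirical.
Context {R : realType}.
Variable alpha : R.
Hypothesis halpha : 2 * pi < alpha.
Local Notation fcos := (fcos alpha).
Local Notation fsin := (fsin alpha).
Variables (N : nat) (x : nat -> kale alpha).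

Definition empirical (f : kale alpha -> R) : R := N%:R^-1 * \sum_(i < N) f (x i).

Let n0 : 0 <= N%:R^-1 :> R. Proof. by rewrite invr_ge0. Qed.

Lemma empirical_le f g : (forall p, f p <= g p) -> empirical f <= empirical g.
Proof. by move=> fg; rewrite ler_wpM2l//; apply: ler_sum => i _. Qed.

Lemma empirical_eq f g : f =1 g -> empirical f = empirical g.
Proof. by move=> fg; congr (_ * _); apply: eq_bigr => i _. Qed.

Lemma empiricalD f g : empirical (fun p => f p + g p) = empirical f + empirical g.
Proof. by rewrite /empirical big_split/= mulrDr. Qed.

Lemma empiricalZ c f : empirical (fun p => c * f p) = c * empirical f.
Proof. by rewrite /empirical -mulr_sumr mulrCA. Qed.

Lemma empiricalN f : empirical (fun p => - f p) = - empirical f.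
Proof. by rewrite /empirical sumrN mulrN. Qed.

Lemma empirical_norm f : `|empirical f| <= empirical (fun p => `|f p|).
Proof.
rewrite /empirical normrM (ger0_norm n0) ler_wpM2l//; exact: ler_norm_sum.
Qed.

Lemma empirical_ge0 f : (forall p, 0 <= f p) -> 0 <= empirical f.
Proof. by move=> f0; rewrite mulr_ge0//; apply: sumr_ge0 => i _. Qed.

Lemma empirical_lipschitz f g (c : R) : (forall p, `|f p - g p| <= 4 * krad p * c) ->
  `|empirical f - empirical g| <= 4 * empirical (@krad R alpha) * c.
Proof.
move=> h; rewrite -empiricalN -empiricalD; apply: (le_trans (empirical_norm _)).
rewrite mulrAC -empiricalZ; apply: empirical_le => p.
by apply: (le_trans (h p)); rewrite mulrAC.
Qed.

Local Notation M := (fun theta => empirical (folded1 theta)).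
Local Notation m := (fun theta => empirical (folded2 theta)).

Lemma empirical_profile : kale_profile alpha M m.
Proof.
split.
- move=> theta psi h; rewrite -!empiricalZ -empiricalD.
  by apply: empirical_le => p; exact: folded1_tangent.
- move=> theta psi h; rewrite -empiricalN.
  by apply: empirical_le => p; exact: folded1_opposite.
- exists (4 * empirical (@krad R alpha)).
    by rewrite mulr_ge0// empirical_ge0// => p; exact: krad_ge0.
  move=> y z; split; apply: empirical_lipschitz => p.
    exact: folded1_angle_lipschitz.
  exact: folded2_angle_lipschitz.
- by move=> n theta; apply: empirical_eq => p; exact: folded1_shift.
Qed.

Hypothesis N0 : (0 < N)%N.

Let NR : N%:R != 0 :> R. Proof. by rewrite pnatr_eq0 -lt0n. Qed.

Lemma frechetE q : frechet N x q = krad q ^+ 2 / 2 - krad q * M (kang q) +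
  empirical (fun p => krad p ^+ 2) / 2.
Proof.
have E p : kdist q p ^+ 2 = krad q ^+ 2 + (krad p ^+ 2 + - 2 * krad q * folded1 (kang q) p).
  by rewrite (kdist_sqr halpha) /kdist_sq /folded1 -(fcosN halpha (kang q - _)) opprB; ring.
rewrite /frechet; under eq_bigr do rewrite E.
rewrite !big_split/= sumr_const card_ord -mulr_sumr /empirical -mulr_natr.
by field.
Qed.

Lemma frechet_polar (r theta : R) : 0 <= r ->
  frechet N x (polar alpha r theta) = r ^+ 2 / 2 - r * M theta +
  empirical (fun p => krad p ^+ 2) / 2.
Proof.
move=> r0; rewrite frechetE krad_polar//; congr (_ - _ + _).
move: r0; rewrite le_eqVlt => /predU1P[<-|r0]; first by rewrite !mul0r.
have [n ->] := polar_kang halpha theta r0.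
by rewrite (profile_shift empirical_profile).
Qed.

Local Notation b := (barycenter N x).

(** The variance inequality of spaces of nonpositive curvature. It makes c a minimizer and forces
    every other minimizer to be at distance 0. *)
Let growth_of (c : kale alpha) :=
  forall q, frechet N x c + kdist q c ^+ 2 / 2 <= frechet N x q.

Let growth_origin theta : (forall theta', M theta' <= M theta) -> M theta <= 0 ->
  growth_of (korigin alpha).
Proof.
move=> tmax M0 q; rewrite (kdist_sym halpha) (kdist_origin halpha) !frechetE.
have -> : krad (korigin alpha) = 0 by [].
have := mulr_ge0 (krad_ge0 q) (_ : 0 <= - M (kang q)).
rewrite oppr_ge0 => /(_ (le_trans (tmax _) M0)); lra.
Qed.

Let growth_polar theta : (forall theta', M theta' <= M theta) -> 0 < M theta ->
  growth_of (polar alpha (M theta) theta).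
Proof.
move=> tmax M0 q; have M0' := ltW M0.
rewrite (kdist_sqr halpha) /kdist_sq frechet_polar// frechetE krad_polar//.
have E : krad q * M theta * fcos (kang q - kang (polar alpha (M theta) theta)) =
    krad q * (M theta * fcos (kang q - theta)).
  have [n ->] := polar_kang halpha theta M0.
  rewrite -mulrA -(fcosN halpha (_ - _)) -(fcosN halpha (kang q - theta)) !opprB.
  by rewrite -addrA (fcos_shift halpha).
have := ler_wpM2l (krad_ge0 q) (profile_le_fcos halpha empirical_profile (kang q) tmax M0').
rewrite -E; lra.
Qed.

(** [barycenter] is some minimizer, so growth places it at distance 0 from c; the 1-Lipschitz
    coordinates and the radius then agree, and so do all squared distances. *)
Let growth_transfer c : growth_of c ->
  growth_of b /\ (forall theta, folded1 theta b = folded1 theta c).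
Proof.
move=> gc.
have cmin q : frechet N x c <= frechet N x q.
  by apply: le_trans (gc q); rewrite lerDl divr_ge0// sqr_ge0.
have bmin q : frechet N x b <= frechet N x q.
  rewrite /barycenter; case: xgetP => [y -> hy|/(_ c)]; first exact: hy.
  by move=> h; exfalso; exact: h.
have d0 : kdist b c = 0.
  have := gc b; have := bmin c => h1 h2.
  apply/eqP; rewrite -sqrf_eq0 eq_le sqr_ge0 andbT; lra.
have f1 theta : folded1 theta b = folded1 theta c.
  apply/eqP; rewrite -subr_eq0 -normr_le0 -d0; exact: folded1_lipschitz.
have kr : krad b = krad c.
  by apply/eqP; rewrite -subr_eq0 -normr_le0 -d0; exact: krad_lipschitz.
split => // q.
have -> : kdist q b ^+ 2 = kdist q c ^+ 2.
  rewrite !(kdist_sqr halpha) /kdist_sq kr; congr (_ - _).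
  have E (z : kale alpha) : 2 * krad q * krad z * fcos (kang q - kang z) = 2 * krad q * folded1 (kang q) z.
    by rewrite /folded1 -(fcosN halpha (kang q - kang z)) opprB; ring.
  by have := E b; have := E c; rewrite kr f1 => -> ->.
by apply: le_trans (gc q); rewrite lerD2r.
Qed.

Lemma barycenter_growth q :
  frechet N x b + kdist q b ^+ 2 / 2 <= frechet N x q.
Proof.
have [theta tmax] := profile_max halpha empirical_profile.
have [M0|M0] := ltP 0 (M theta).
  by have [h _] := growth_transfer (growth_polar tmax M0); exact: h.
by have [h _] := growth_transfer (growth_origin tmax M0); exact: h.
Qed.

Lemma barycenter_folded1 theta : (forall theta', M theta' <= M theta) -> 0 < M theta ->
  forall theta0, folded1 theta0 b = M theta * fcos (theta - theta0).
Proof.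
move=> tmax M0 theta0; have [_ ->] := growth_transfer (growth_polar tmax M0).
by rewrite (folded1_polar halpha)// ltW.
Qed.

Lemma barycenter_folded2 theta : (forall theta', M theta' <= M theta) -> 0 < M theta ->
  forall theta0, folded2 theta0 b = M theta * fsin (theta - theta0).
Proof.
move=> tmax M0 theta0.
rewrite (folded2E halpha) !(barycenter_folded1 tmax M0) -(folded2_polar halpha _ _ (ltW M0)).
by rewrite (folded2E halpha) !(folded1_polar halpha _ _ (ltW M0)).
Qed.

End Empirical.

(** * Measurability of the barycenter *)

Section BarycenterMeasurable.
Context {R : realType}.
Variable alpha : R.
Hypothesis halpha : 2 * pi < alpha.
Local Notation fcos := (fcos alpha).
Variable N : nat.
Hypothesis N0 : (0 < N)%N.
Variable theta : R.
Implicit Types x : nat -> kale alpha.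
Local Notation b x := (barycenter N x).
Local Notation M x := (fun t => empirical N x (folded1 t)).

(* Infima over rational points of the Frechet function tilted by [s] times the
   folded coordinate: their derivative in [s] at [0] recovers that coordinate
   of the barycenter. *)
Definition tilted_frechet (s : R) (z : R * R) x : R :=
  `|z.1| ^+ 2 / 2 - `|z.1| * M x z.2 + empirical N x (fun p => krad p ^+ 2) / 2 -
  s * (`|z.1| * fcos (z.2 - theta)).

Definition tilted_inf (s : R) x : R :=
  inf (range (fun n => tilted_frechet s (rational_point n) x)).

Let tiltedE s z x : tilted_frechet s z x =
  frechet N x (polar alpha `|z.1| z.2) - s * folded1 theta (polar alpha `|z.1| z.2).
Proof. by rewrite frechet_polar// folded1_polar. Qed.

(** Moving a distance D away from the barycenter gains at most s D by the tilt and costs D^2 / 2 by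
    growth, so the net gain is at most s^2 / 2. *)
Let tilted_ge s z x : 0 <= s ->
  frechet N x (b x) - s * folded1 theta (b x) - s ^+ 2 / 2 <= tilted_frechet s z x.
Proof.
move=> s0; rewrite tiltedE; set q := polar _ _ _.
have := barycenter_growth halpha x N0 q.
have /ler_normlP[_ h] := folded1_lipschitz halpha theta q (b x).
have := ler_wpM2l s0 h; have := sqr_ge0 (kdist q (b x) - s); lra.
Qed.

Let tilted_inf_ge s x : 0 <= s ->
  frechet N x (b x) - s * folded1 theta (b x) - s ^+ 2 / 2 <= tilted_inf s x.
Proof.
move=> s0; apply: lb_le_inf; first by eexists; exists 0%N.
by move=> _ [n _ <-]; exact: tilted_ge.
Qed.

Let tilted_lbound s x : 0 <= s ->
  has_lbound (range (fun n => tilted_frechet s (rational_point n) x)).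
Proof.
move=> s0; exists (frechet N x (b x) - s * folded1 theta (b x) - s ^+ 2 / 2).
by move=> _ [n _ <-]; exact: tilted_ge.
Qed.

(** The barycenter need not have rational coordinates, so its tilted value is approached along
    rational points; the absolute value in [tilted_frechet] makes each of them an admissible
    radius. *)
Let tilted_inf_le s x : 0 <= s ->
  tilted_inf s x <= frechet N x (b x) - s * folded1 theta (b x).
Proof.
move=> s0; set r0 := krad (b x); set t0 := kang (b x).
have r00 : 0 <= r0 := krad_ge0 (b x).
have -> : frechet N x (b x) - s * folded1 theta (b x) = tilted_frechet s (r0, t0) x.
  by rewrite tiltedE /= ger0_norm// polar_krad_kang.
have [L L0 ML] := profile_lipschitz (empirical_profile halpha N x).
apply/ler_addgt0Pr => e e0.
(* Sum of the moduli of continuity of the terms: r^2 / 2, then M times the radius in r and in the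
   angle, then the tilt in r and in the angle. *)
pose K := r0 + 1 + `|M x t0| + (r0 + 1) * L + s + 2 * (s * (r0 + 1)).
have r1 : 0 <= r0 + 1 by lra.
have K0 : 0 < K.
  have := mulr_ge0 r1 L0; have := mulr_ge0 s0 r1; have := normr_ge0 (M x t0).
  rewrite /K; lra.
pose del := Num.min 1 (e / K).
have del0 : 0 < del by rewrite lt_min ltr01 divr_gt0.
have del1 : del <= 1 by rewrite ge_min lexx.
have delK : del * K <= e by rewrite -ler_pdivlMr// ge_min lexx orbT.
have [n [n1 n2]] := rational_point_dense (r0, t0) del0.
apply: (@le_trans _ _ (tilted_frechet s (rational_point n) x)).
  by apply: ge_inf; [exact: tilted_lbound|exists n].
move: (rational_point n) n1 n2 => [z1 t] /= n1 n2.
rewrite /tilted_frechet/= (ger0_norm r00).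
set r := `|z1|.
have rd : `|r - r0| <= del.
  by rewrite -(ger0_norm r00) distrC (le_trans (ler_dist_dist _ _))// ltW.
have rr : 0 <= r <= r0 + 1.
  by rewrite normr_ge0/=; move: rd; rewrite ler_norml => /andP[]; lra.
have /andP[r2 r3] := rr.
have [hM _] := ML t0 t.
have dt : `|t0 - t| <= del by rewrite ltW.
have hM' : r * `|M x t0 - M x t| <= (r0 + 1) * (L * del).
  by apply: ler_pM => //; apply: (le_trans hM); rewrite ler_wpM2l.
have hc : r * `|fcos (t0 - theta) - fcos (t - theta)| <= (r0 + 1) * (2 * del).
  apply: ler_pM => //; apply: (le_trans (fcos_lipschitz halpha _ _)).
  by rewrite ler_wpM2l// (_ : _ - _ - _ = t0 - t)//; ring.
have {}hM' : - (r * (M x t - M x t0)) <= (r0 + 1) * (L * del).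
  by apply: le_trans hM'; rewrite -mulrN opprB ler_wpM2l// ler_norm.
have {}hc : - (s * (r * (fcos (t - theta) - fcos (t0 - theta)))) <= s * ((r0 + 1) * (2 * del)).
  rewrite -mulrN ler_wpM2l//; apply: le_trans hc.
  by rewrite -mulrN opprB ler_wpM2l// ler_norm.
have hm : - ((r - r0) * M x t0) <= del * `|M x t0|.
  apply: le_trans (ler_norm _) _; rewrite normrN normrM; exact: ler_wpM2r.
have hf : - (s * ((r - r0) * fcos (t0 - theta))) <= s * del.
  rewrite -mulrN ler_wpM2l//; apply: le_trans (ler_norm _) _.
  rewrite normrN normrM -[leRHS]mulr1; apply: ler_pM => //; exact: fcos_max.
have h2 : r ^+ 2 / 2 - r0 ^+ 2 / 2 <= del * (r0 + 1).
  rewrite (_ : _ - _ = (r - r0) * ((r + r0) / 2)); last by field.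
  apply: (@le_trans _ _ (del * ((r + r0) / 2))); last by apply: ler_wpM2l; [exact: ltW|lra].
  by apply: ler_wpM2r; [lra|exact: le_trans (ler_norm _) rd].
move: delK hM' hc hm hf h2; rewrite /K; lra.
Qed.

(** At s = 0 the bounds on the infimum coincide, and at s = 1 / (n + 1) they differ by s^2 / 2, so
    the difference quotient is within s / 2 of the coordinate. *)
Let tilted_diff_cvg x :
  n.+1%:R * (tilted_inf 0 x - tilted_inf n.+1%:R^-1 x) @[n --> \oo] --> folded1 theta (b x).
Proof.
apply/cvgrPdist_le => e e0; near=> n.
have n0 : 0 < n.+1%:R :> R by rewrite ltr0n.
have : n.+1%:R^-1 <= e by rewrite ltW//; near: n; exact: near_infty_natSinv_lt (PosNum e0).
set s := n.+1%:R^-1 => se.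
have s0 : 0 <= s by rewrite invr_ge0 ltW.
have h1 := tilted_inf_ge x s0; have h2 := tilted_inf_le x s0.
have h3 := tilted_inf_ge x (lexx 0); have h4 := tilted_inf_le x (lexx 0).
have E : n.+1%:R * s = 1 by rewrite mulfV// gt_eqF.
set D := tilted_inf 0 x - tilted_inf s x.
have l1 : s * folded1 theta (b x) <= D by rewrite /D; lra.
have l2 : D <= s * folded1 theta (b x) + s * s / 2 by rewrite /D; lra.
clearbody D.
have u1 : folded1 theta (b x) <= n.+1%:R * D.
  by have := ler_wpM2l (ltW n0) l1; rewrite mulrA E mul1r.
have u2 : n.+1%:R * D <= folded1 theta (b x) + s / 2.
  have := ler_wpM2l (ltW n0) l2.
  rewrite (_ : _ * (_ + _) = n.+1%:R * s * (folded1 theta (b x) + s / 2)); last by ring.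
  by rewrite E mul1r.
by rewrite ler_norml; apply/andP; split; lra.
Unshelve. all: by end_near.
Qed.

Context {d : measure_display} {Omega : measurableType d}.
Variable p : nat -> Omega -> kale alpha.
Hypothesis mp : forall n, measurable_fun setT (p n).

Let measurable_empirical (f : kale alpha -> R) : measurable_fun setT f ->
  measurable_fun setT (fun w => empirical N (fun n => p n w) f).
Proof.
move=> mf; apply: measurable_funM => //; apply: measurable_sum => i.
exact: measurableT_comp.
Qed.

Let measurable_tilted_inf s : 0 <= s ->
  measurable_fun setT (fun w => tilted_inf s (fun n => p n w)).
Proof.
move=> s0.
pose h n w := tilted_frechet s (rational_point n) (fun n => p n w).
rewrite (_ : (fun w => _) = fun w => infs (h ^~ w) 0).
  apply: measurable_fun_infs => [w _|n]; first exact: tilted_lbound.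
  apply: measurable_funB => //; apply: measurable_funD => //.
    apply: measurable_funB => //; apply: measurable_funM => //.
    by apply: measurable_empirical; exact: measurable_folded1.
  apply: measurable_funM => //; apply: measurable_empirical.
  by apply: measurable_funX; exact: measurable_krad.
apply/funext => w; rewrite /infs /tilted_inf; congr inf.
by apply/seteqP; split => _ [n _ <-]; exists n.
Qed.

Lemma measurable_folded1_barycenter :
  measurable_fun setT (fun w => folded1 theta (b (fun n => p n w))).
Proof.
apply: (@measurable_fun_cvg _ _ _ setT (fun n w => n.+1%:R *
  (tilted_inf 0 (fun i => p i w) - tilted_inf n.+1%:R^-1 (fun i => p i w)))).
  move=> n; apply: measurable_funM => //; apply: measurable_funB;
    by apply: measurable_tilted_inf.
by move=> w _; exact: tilted_diff_cvg.
Qed.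

End BarycenterMeasurable.

Section RescaledMeasurable.
Context {R : realType}.
Variable alpha : R.
Hypothesis halpha : 2 * pi < alpha.
Variables (mu : probability (kale alpha) R) (d : measure_display) (Omega : measurableType d).
Variable p : nat -> Omega -> kale alpha.
Hypothesis mp : forall n, measurable_fun setT (p n).

Lemma measurable_folded2_barycenter N theta : (0 < N)%N ->
  measurable_fun setT (fun w => folded2 theta (barycenter N (fun n => p n w))).
Proof.
move=> N0; under eq_fun do rewrite (folded2E halpha).
by apply: measurable_funB; apply: measurable_maxr => //; exact: measurable_folded1_barycenter.
Qed.

Lemma measurable_rescaled N : (0 < N)%N ->
  measurable_fun setT (rescaled mu p N).
Proof.
move=> N0; have m2 := measurable_folded2_barycenter (mean_ang mu) N0.
apply/measurable_fun_pairP; split; apply: measurable_funM => //.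
  apply: measurable_funB => //; exact: measurable_folded1_barycenter.
apply: measurable_funM => //; apply: measurable_funD => //.
rewrite /kappa; apply: measurable_fun_ifT => //; first exact: measurable_fun_ltr.
by apply: measurable_fun_ifT => //; exact: measurable_fun_ltr.
Qed.

End RescaledMeasurable.

(** * Folded moments of a measure *)

Section Weights.
Context {R : realType}.
Variable alpha : R.
Hypothesis halpha : 2 * pi < alpha.
Local Notation fcos := (fcos alpha).
Local Notation fsin := (fsin alpha).
Implicit Types p : kale alpha.

Lemma fcos_eq1 (x : R) : fcos x = 1 -> angle_repr alpha x 0.
Proof.
have [n hn] := angle_repr_exists halpha x; rewrite -(fcos_shift halpha n) => h; exists n.
apply/eqP; rewrite eq_sym; move: (_ + x) hn h => y hn h.
have [hy|hy] := leP `|y| pi.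
  have E : cos `|y| = cos 0 by rewrite cos_norm cos0 -h (fcos_small halpha).
  have := cos_inj _ _ E; rewrite !in_itv/= normr_ge0 hy lexx pi_ge0.
  by move=> /(_ isT isT)/eqP; rewrite normr_eq0.
have := h; rewrite (fcos_big halpha); last by rewrite (angle_abs_small halpha)// ltW.
by move=> /eqP; rewrite -subr_eq0 -opprD oppr_eq0 gt_eqF// addr_gt0.
Qed.

(** [fcos x = -1] is the closed shadow, and the second condition removes its boundary ray at pi.
    Conditions on [fcos] are comparisons of first coordinates with the radius, hence measurable. *)
Lemma window_minusE (x : R) : `[< ~ window_minus alpha x >] = (fcos x == -1) && (fcos (x - pi) != 1).
Proof.
have [w|w] := pselect (window_minus alpha x).
  rewrite asboolF; last by move/(_ w).
  apply/esym/negbTE; rewrite negb_and negbK; apply/orP.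
  have [y [n ->]] := w; rewrite -(fcos_shift halpha n x) -(fcos_shift halpha n (x - pi)).
  rewrite (addrA _ x (- pi)); move: (_ + x) => {n w}y /andP[y1 y2].
  rewrite (fcos_small halpha); last by rewrite ler_norml y2 (ltW y1).
  have [<-|h] := eqVneq y pi; [right|left].
    by rewrite subrr (fcos_small halpha) ?cos0// normr0 pi_ge0.
  apply/eqP => E; move/eqP: h; apply.
  have yp : `|y| <= pi by rewrite ler_norml y2 (ltW y1).
  have E' : cos `|y| = cos pi by rewrite cos_norm E cospi.
  have := cos_inj _ _ E'; rewrite !in_itv/= normr_ge0 yp lexx pi_ge0 => /(_ isT isT) h.
  have [y0|y0] := leP 0 y; first by rewrite -(ger0_norm y0).
  by move: y1; rewrite -h ltr0_norm// opprK ltxx.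
rewrite asboolT//; apply/esym/andP; split; last first.
  apply/eqP => /fcos_eq1 [n E]; apply: w; exists pi; last first.
    by rewrite lexx andbT; have := pi_gt0 R; lra.
  by exists n; pi_lra.
have [n hn] := angle_repr_exists halpha x; rewrite -(fcos_shift halpha n).
have [hy|hy] := leP `|n%:~R * alpha + x| pi; last first.
  by rewrite (fcos_big halpha)// (angle_abs_small halpha)// ltW.
have ny : ~ (- pi < n%:~R * alpha + x).
  move=> h; apply: w; exists (n%:~R * alpha + x); first by exists n.
  by rewrite h; move: hy; rewrite ler_norml => /andP[].
rewrite (_ : _ + x = - pi); last first.
  apply/eqP; rewrite eq_le; move: hy; rewrite ler_norml => /andP[-> _]; rewrite andbT.
  by rewrite leNgt; exact/negP.
by rewrite (fcosN halpha)// (fcos_small halpha) ?cospi// ger0_norm ?pi_ge0.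
Qed.

Lemma window_plusE (x : R) : `[< ~ window_plus alpha x >] = (fcos x == -1) && (fcos (x + pi) != 1).
Proof.
have -> : (~ window_plus alpha x) = (~ window_minus alpha (- x)).
  by apply/propext; split => h1 h2; apply: h1; exact/window_minusN.
by rewrite window_minusE (fcosN halpha)// -opprD (fcosN halpha).
Qed.

Definition minus_weight theta p : R :=
  krad p * `[< ~ window_minus alpha (kang p - theta) >]%:R.
Definition plus_weight theta p : R :=
  krad p * `[< ~ window_plus alpha (kang p - theta) >]%:R.
Definition antipode_weight e theta p : R :=
  krad p * (near_antipode alpha e (kang p - theta))%:R.

Let mul_bool_ge0 p (c : bool) : 0 <= krad p * c%:R <= krad p.
Proof. by case: c; rewrite ?mulr1 ?mulr0 ?lexx ?krad_ge0. Qed.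

Lemma minus_weight_le theta p : 0 <= minus_weight theta p <= krad p.
Proof. exact: mul_bool_ge0. Qed.
Lemma plus_weight_le theta p : 0 <= plus_weight theta p <= krad p.
Proof. exact: mul_bool_ge0. Qed.
Lemma antipode_weight_le e theta p : 0 <= antipode_weight e theta p <= krad p.
Proof. exact: mul_bool_ge0. Qed.

Let krad_pos p : (krad p == 0) || (0 < krad p).
Proof. by have := krad_ge0 p; rewrite le_eqVlt eq_sym. Qed.

Let measurable_weight sg t : measurable_fun setT (fun p => krad p *
  ((fcos (kang p - sg) == -1) && (fcos (kang p - t) != 1))%:R).
Proof.
(* Multiplying the conditions by the radius turns them into comparisons of 1-Lipschitz functions; at
   the origin, whose angle is a convention, the factor [krad p] vanishes anyway. *)
rewrite (_ : (fun p => _) = fun p => if folded1 sg p == - krad p then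
  (if folded1 t p == krad p then 0 else krad p) else 0).
  apply: measurable_fun_ifT => //.
    apply: measurable_fun_eqr; first exact: measurable_folded1.
    by apply: measurable_funN; exact: measurable_krad.
  apply: measurable_fun_ifT => //; last exact: measurable_krad.
  apply: measurable_fun_eqr; first exact: measurable_folded1.
  exact: measurable_krad.
apply/funext => p; have /orP[/eqP k0|k0] := krad_pos p.
  by rewrite k0 mul0r; case: ifP => // _; case: ifP.
have hk u (y : R) : (fcos (kang p - u) == y) = (folded1 u p == y * krad p).
  by rewrite /folded1 mulrC (inj_eq (mulIf _))// gt_eqF.
rewrite !hk mulN1r mul1r; case: (_ == _) => /=; last by rewrite mulr0.
by case: (_ == _) => /=; rewrite ?mulr0 ?mulr1.
Qed.

Lemma measurable_minus_weight theta : measurable_fun setT (minus_weight theta).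
Proof.
have h := measurable_weight theta (theta + pi).
rewrite /minus_weight; under eq_fun do rewrite window_minusE.
by under eq_fun do rewrite -addrA -opprD.
Qed.

Lemma measurable_plus_weight theta : measurable_fun setT (plus_weight theta).
Proof.
have h := measurable_weight theta (theta - pi).
rewrite /plus_weight; under eq_fun do rewrite window_plusE.
have E p : kang p - theta + pi = kang p - (theta - pi) by ring.
by under eq_fun do rewrite E.
Qed.

Lemma measurable_antipode_weight e theta : measurable_fun setT (antipode_weight e theta).
Proof.
rewrite (_ : antipode_weight e theta = fun p =>
    let C := if cos e * krad p < folded1 (theta - pi) p then
      (if folded1 (theta - pi) p < krad p then krad p else 0) else 0 in
    if cos e * krad p < folded1 (theta + pi) p then
      (if folded1 (theta + pi) p < krad p then krad p else C) else C).
  have mk := @measurable_krad R alpha halpha.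
  have mf t := @measurable_folded1 R alpha halpha t.
  have mc : measurable_fun setT (fun p => cos e * krad p) by exact: measurable_funM.
  by repeat (apply: measurable_fun_ifT => //; try exact: measurable_fun_ltr).
apply/funext => p /=; rewrite /antipode_weight /near_antipode.
have -> : kang p - theta - pi = kang p - (theta + pi) by ring.
have -> : kang p - theta + pi = kang p - (theta - pi) by ring.
have /orP[/eqP k0|k0] := krad_pos p.
  by rewrite k0 mul0r; do !case: ifP.
have h1 u (y : R) : (y < fcos (kang p - u)) = (y * krad p < folded1 u p).
  by rewrite /folded1 mulrC ltr_pM2l.
have h2 u : (fcos (kang p - u) < 1) = (folded1 u p < krad p).
  by rewrite /folded1 -[X in _ = (_ < X)]mulr1 ltr_pM2l.
rewrite !h1 !h2; do !case: (_ < _) => //=; by rewrite ?mulr1 ?mulr0.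
Qed.

(** The strict bound by 1 in [near_antipode] omits the boundary rays themselves, so each fixed angle
    eventually leaves the shrinking sets. *)
Lemma near_antipode_cvg (x : R) :
  \forall n \near \oo, ~~ near_antipode alpha n.+1%:R^-1 x.
Proof.
have cvc : cos (n.+1%:R^-1 : R) @[n --> \oo] --> cos (0 : R).
  apply: continuous_cvg; first exact: continuous_cos.
  exact: (@cvg_harmonic R).
have h (z : R) : \forall n \near \oo, ~~ (cos n.+1%:R^-1 < z < 1).
  have [z1|z1] := ltP z 1; last by near=> n; rewrite andbF.
  near=> n; rewrite andbT -leNgt ltW//.
  by near: n; apply: (cvgr_gt (cos 0) cvc); rewrite cos0.
by apply: filterS2 (h (fcos (x - pi))) (h (fcos (x + pi))) => n h1 h2; rewrite negb_or h1.
Unshelve. all: by end_near.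
Qed.

Lemma folded2_expansion e theta psi p : 0 < e <= alpha / 2 - pi -> e <= pi -> `|psi| < e ->
  `|folded2 (theta + psi) p - (cos psi * folded2 theta p - sin psi * folded1 theta p -
     sin psi * (if 0 <= psi then minus_weight theta p else plus_weight theta p))|
  <= 8 * `|psi| * antipode_weight e theta p.
Proof.
move=> he epi hpsi.
have := ler_wpM2l (krad_ge0 p) (fsin_expansion halpha (kang p - theta) he epi hpsi).
rewrite -[X in X * `|_|](ger0_norm (krad_ge0 p)) -normrM.
rewrite /folded2 /folded1 /minus_weight /plus_weight /antipode_weight.
rewrite (_ : kang p - (theta + psi) = kang p - theta - psi); last by ring.
rewrite (_ : krad p * (8 * _ * _) = 8 * `|psi| * (krad p * (near_antipode alpha e (kang p - theta))%:R)); last by ring.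
by move=> h; apply: le_trans h; rewrite le_eqVlt; apply/orP; left; apply/eqP; congr (`| _ |); case: ifP => _; ring.
Qed.

Let polar_window (W : R -> Prop) theta p :
  (forall n x, W (n%:~R * alpha + x) <-> W x) -> 
  (~` [set p | exists r theta', [/\ p = polar alpha r theta', 0 < r & W (theta' - theta)]]) p
  <-> (krad p = 0 \/ ~ W (kang p - theta)).
Proof.
move=> WS; split.
  move=> h; have /orP[/eqP|k0] := krad_pos p; [by left|right => w; apply: h].
  by exists (krad p), (kang p); rewrite polar_krad_kang.
move=> h [r [t [E r0 w]]]; case: h => [k0|nw].
  by have := r0; rewrite -(krad_polar halpha t (ltW r0)) -E k0 ltxx.
by apply: nw; rewrite E; have [n ->] := polar_kang halpha t r0; rewrite -addrA; apply/WS.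
Qed.

Let window_shift (c : R -> bool) n x :
  (exists2 y, angle_repr alpha (n%:~R * alpha + x) y & c y) <->
  (exists2 y, angle_repr alpha x y & c y).
Proof.
split=> -[y [m E] cy]; exists y => //.
  by exists (m + n); rewrite E rmorphD/=; ring.
by exists (m - n); rewrite E rmorphB/=; ring.
Qed.

(** The origin lies in the shadow whatever [W] says about its canonical angle, but the integrand
    [krad] is 0 there. *)
Let shadow_integral (W : R -> Prop) (mu : probability (kale alpha) R) theta :
  (forall n x, W (n%:~R * alpha + x) <-> W x) ->
  \int[mu]_(p in ~` [set p | exists r theta',
    [/\ p = polar alpha r theta', 0 < r & W (theta' - theta)]]) kdist (korigin alpha) p =
  \int[mu]_p (krad p * `[< ~ W (kang p - theta) >]%:R).
Proof.
move=> WS; rewrite Rintegral_mkcond; apply: eq_Rintegral => p _.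
rewrite patchE kdist_origin//; have h := polar_window theta p WS.
have [k0|k0] := eqVneq (krad p) 0; first by rewrite k0 mul0r; case: ifP.
case: asboolP => w; rewrite ?mulr1 ?mulr0.
  by rewrite mem_set//; apply/h; right.
by rewrite memNset// => /h[/eqP|//]; rewrite (negbTE k0).
Qed.

Lemma w_minusE (mu : probability (kale alpha) R) theta :
  w_minus mu theta = \int[mu]_p minus_weight theta p.
Proof. exact: shadow_integral (window_shift _). Qed.

Lemma w_plusE (mu : probability (kale alpha) R) theta :
  w_plus mu theta = \int[mu]_p plus_weight theta p.
Proof. exact: shadow_integral (window_shift _). Qed.

End Weights.

(** * Folded moments and the mean of the measure *)

Section MeanOfMeasure.
Context {R : realType}.
Variable alpha : R.
Hypothesis halpha : 2 * pi < alpha.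
Variable mu : probability (kale alpha) R.
Hypothesis mu2 : kale_square_integrable mu.

Lemma square_integrable_krad : square_integrable mu (@krad R alpha).
Proof.
have mk := measurable_krad halpha.
split => //; apply/integrableP; split; first by apply/measurable_EFinP; exact: measurable_funX.
move: mu2; rewrite /kale_square_integrable; under eq_integral do rewrite (kdist_origin halpha).
by under [in X in _ -> X]eq_integral do rewrite abse_EFin ger0_norm ?sqr_ge0//.
Qed.

Lemma square_integrable_le (f : kale alpha -> R) : measurable_fun setT f -> (forall p, `|f p| <= krad p) ->
  square_integrable mu f.
Proof.
move=> mf fk; split => //; have [mk k2] := square_integrable_krad.
apply: le_integrable k2 => //; first by apply/measurable_EFinP; exact: measurable_funX.
move=> p _; rewrite !abse_EFin lee_fin !normrX (ger0_norm (krad_ge0 p)).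
by rewrite lerXn2r// nnegrE ?normr_ge0 ?krad_ge0.
Qed.

Lemma square_integrable_folded1 theta : square_integrable mu (folded1 theta).
Proof.
by apply: square_integrable_le => [|p]; [exact: measurable_folded1|exact: folded1_le].
Qed.

Lemma square_integrable_folded2 theta : square_integrable mu (folded2 theta).
Proof.
by apply: square_integrable_le => [|p]; [exact: measurable_folded2|exact: folded2_le].
Qed.

Let weight_norm (f : kale alpha -> R) : (forall p, 0 <= f p <= krad p) -> forall p, `|f p| <= krad p.
Proof. by move=> h p; have /andP[h1 h2] := h p; rewrite ger0_norm. Qed.

Lemma square_integrable_plus_weight theta : square_integrable mu (plus_weight theta).
Proof.
apply: square_integrable_le; first exact: measurable_plus_weight.
exact: weight_norm (plus_weight_le theta).
Qed.

Lemma square_integrable_minus_weight theta : square_integrable mu (minus_weight theta).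
Proof.
apply: square_integrable_le; first exact: measurable_minus_weight.
exact: weight_norm (minus_weight_le theta).
Qed.

Lemma square_integrable_antipode_weight e theta :
  square_integrable mu (antipode_weight e theta).
Proof.
apply: square_integrable_le; first exact: measurable_antipode_weight.
exact: weight_norm (antipode_weight_le e theta).
Qed.

Let int1 theta := square_integrable_integrable (square_integrable_folded1 theta).
Let int2 theta := square_integrable_integrable (square_integrable_folded2 theta).
Let intk := square_integrable_integrable square_integrable_krad.

Let integrable_scale (c : R) (f : kale alpha -> R) : mu.-integrable setT (EFin \o f) ->
  mu.-integrable setT (EFin \o (fun p => c * f p)).
Proof. by move=> fi; rewrite /comp; under eq_fun do rewrite EFinM; exact: integrableZl. Qed.

Let lip_of (f g : kale alpha -> R) (c : R) : mu.-integrable setT (EFin \o f) ->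
  mu.-integrable setT (EFin \o g) -> 0 <= c -> (forall p, `|f p - g p| <= 4 * krad p * c) ->
  `|\int[mu]_p f p - \int[mu]_p g p| <= 4 * (\int[mu]_p krad p) * c.
Proof.
move=> fi gi c0 fg; rewrite -RintegralB//.
have fgi : mu.-integrable setT (EFin \o (fun p => f p - g p)).
  by rewrite /comp; under eq_fun do rewrite EFinB; exact: integrableB.
apply: (le_trans (le_normr_Rintegral _ fgi)) => //.
rewrite mulrAC -RintegralZl//; apply: le_Rintegral => //.
- exact: integrable_norm.
- exact: integrable_scale.
- by move=> p _; rewrite mulrAC.
Qed.

Lemma moment_profile : kale_profile alpha (fun theta => \int[mu]_p folded1 theta p)
  (fun theta => \int[mu]_p folded2 theta p).
Proof.
split.
- move=> theta psi h; rewrite -!RintegralZl// -RintegralD//; [|exact: integrable_scale..].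
  apply: le_Rintegral => //; last by move=> p _; exact: folded1_tangent.
  by rewrite /comp; under eq_fun do rewrite EFinD; apply: integrableD => //; exact: integrable_scale.
- move=> theta psi h; rewrite -mulN1r -RintegralZl//.
  apply: le_Rintegral => //; first exact: integrable_scale.
  by move=> p _; rewrite mulN1r; exact: folded1_opposite.
- exists (4 * \int[mu]_p krad p).
    by rewrite mulr_ge0//; apply: Rintegral_ge0 => p _; exact: krad_ge0.
  move=> y z; split; apply: lip_of => //.
    by move=> p; exact: folded1_angle_lipschitz.
  by move=> p; exact: folded2_angle_lipschitz.
- by move=> n theta; apply: eq_Rintegral => p _; exact: folded1_shift.
Qed.

Lemma antipode_weight_cvg theta :
  \int[mu]_p antipode_weight n.+1%:R^-1 theta p @[n --> \oo] --> (0 : R).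
Proof.
rewrite (_ : 0 = \int[mu]_p (cst 0 p) :> R); last by rewrite Rintegral_cst// mul0r.
apply: dominated_Rintegral_cvg.
- by move=> n; exact: measurable_antipode_weight.
- exact: intk.
- by move=> n; exact: weight_norm (antipode_weight_le _ _).
- move=> p; apply: cvg_near_cst.
  have := near_antipode_cvg alpha (kang p - theta); apply: filterS => n h.
  by rewrite /antipode_weight (negbTE h) mulr0.
Qed.

Hypothesis mu_nonsticky : kale_nonsticky mu.
Local Notation thetas := (mean_ang mu).
Local Notation rs := (mean_rad mu).

Lemma mean_ang_max theta : \int[mu]_p folded1 theta p <= \int[mu]_p folded1 thetas p.
Proof.
have [t ht] := profile_max halpha moment_profile.
(* [mean_ang] is a choice with a default value; the maximizer from [profile_max] excludes the
   default case. *)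
by have := @xgetPex _ (0 : R) _ (ex_intro _ t ht : exists t, [set theta | forall theta',
    (folded_moment mu theta').1 <= (folded_moment mu theta).1] t); exact.
Qed.

Lemma mean_rad_gt0 : 0 < rs.
Proof.
have [[t tK] h] := mu_nonsticky.
by apply: lt_le_trans (h _ tK) _; exact: mean_ang_max.
Qed.

Lemma moment2_mean : \int[mu]_p folded2 thetas p = 0.
Proof.
by apply: (profile_critical moment_profile mean_ang_max); exact: ltW mean_rad_gt0.
Qed.

Lemma folding_mean : folding thetas (kale_mean mu) = (rs, 0).
Proof.
have r0 := ltW mean_rad_gt0; rewrite foldingE (folded1_polar halpha)// (folded2_polar halpha)//.
by rewrite subrr (fcos_small halpha) ?(fsin_small halpha) ?normr0 ?pi_ge0// cos0 sin0 mulr1 mulr0.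
Qed.

Definition centered_folding (i : 'I_2) (p : kale alpha) : R :=
  if i == 0 then folded1 thetas p - rs else folded2 thetas p.

Lemma square_integrable_centered_folding i : square_integrable mu (centered_folding i).
Proof.
rewrite /centered_folding; case: (i == 0); last exact: square_integrable_folded2.
exact: (square_integrable_sub_mean (square_integrable_folded1 thetas)).1.
Qed.

Lemma centered_folding_mean i : \int[mu]_p centered_folding i p = 0.
Proof.
rewrite /centered_folding; case: (i == 0); last exact: moment2_mean.
exact: (square_integrable_sub_mean (square_integrable_folded1 thetas)).2.
Qed.

Lemma mean_covE i j :
  mean_cov mu i j = \int[mu]_p (centered_folding i p * centered_folding j p).
Proof.
rewrite mxE /Rintegral; congr fine; rewrite folding_mean.
have mf : measurable_fun setT (folding thetas : kale alpha -> R * R).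
  by apply/measurable_fun_pairP; split; [exact: measurable_folded1|exact: measurable_folded2].
have mc k : measurable_fun setT (fun y : R * R => plane_coord (y - (rs, 0)) k).
  rewrite /plane_coord; case: (k == 0) => /=; apply: measurable_funB => //.
have E k p : plane_coord (folding thetas p - (rs, 0)) k = centered_folding k p.
  by rewrite /plane_coord /centered_folding foldingE; case: (k == 0) => //=; rewrite subr0.
rewrite integral_pushforward//.
- by apply: eq_integral => p _; rewrite /comp !E.
- by apply/measurable_EFinP; exact: measurable_funM.
- rewrite preimage_setT /comp; under eq_fun do rewrite !E.
  by apply: square_integrable_mul; exact: square_integrable_centered_folding.
Qed.

End MeanOfMeasure.

(** * The rescaled barycenter *)

Section LocalEstimate.
Context {R : realType}.
Variable alpha : R.
Hypothesis halpha : 2 * pi < alpha.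

(** A positive cosine gives |psi| <= pi / 2 < 2, so the cubic Taylor error of sine is at most (4 /
    6) |psi| and one third of |psi| remains. *)
Lemma norm_le_3sin (psi : R) : `|psi| <= pi -> 0 < cos psi -> `|psi| <= 3 * `|sin psi|.
Proof.
move=> psipi c0.
have h : `|psi| <= pi / 2.
  rewrite leNgt; apply/negP => h; have := c0; rewrite -(cos_norm psi) ltNge => /negP; apply.
  rewrite -(@cos_pihalf R); apply: cos_le_antitone => //; last exact: ltW.
  by rewrite divr_ge0// pi_ge0.
have p2 : `|psi| <= 2 by rewrite (le_trans h)//; apply/ltW; exact: pihalf_lt2.
have := sin_taylor3 psi; have : `|psi| ^+ 3 <= 4 * `|psi|.
  rewrite exprSr ler_wpM2r// expr2 (_ : 4 = 2 * 2 :> R); last by ring.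
  by apply: ler_pM.
have : `|psi| <= `|sin psi| + `|sin psi - psi|.
  rewrite distrC (le_trans _ (ler_normD _ _))// (_ : _ + _ = psi)//; ring.
lra.
Qed.

(** The tangent inequality is used from both ends. Based at the maximizer, where m vanishes, it
    gives M theta <= M (theta + psi) cos psi; based at theta it bounds M (theta + psi). Together
    they yield sin^2 psi M (theta + psi) <= |sin psi| |m theta|, and positivity of cos psi converts
    sines to angles. *)
Lemma profile_maximizer_near (M m : R -> R) (theta : R) : kale_profile alpha M m ->
  0 < M theta -> exists psi, [/\ forall theta', M theta' <= M (theta + psi),
    `|psi| * M theta <= 3 * `|m theta|, M theta <= M (theta + psi) * cos psi,
    M (theta + psi) <= M theta + `|m theta| * `|psi| & m (theta + psi) = 0].
Proof.
move=> prof M0; have [t tmax] := profile_max halpha prof.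
have [n hn] := angle_repr_exists halpha (t - theta).
set psi := _ + _ in hn.
have Mt : M (theta + psi) = M t.
  by rewrite -(profile_shift prof n t); congr M; rewrite /psi; ring.
have max' theta' : M theta' <= M (theta + psi) by rewrite Mt.
have psipi : `|psi| <= pi.
  rewrite leNgt; apply/negP => h.
  have : pi <= angle_abs alpha psi by rewrite (angle_abs_small halpha)// ltW.
  move=> /(profile_opposite prof theta); have := max' theta; lra.
have r0 : 0 < M (theta + psi) := lt_le_trans M0 (max' theta).
have m0 := profile_critical prof max' (ltW r0).
have c1 : M theta <= M (theta + psi) * cos psi.
  have := profile_tangent prof (theta + psi) (_ : `|- psi| <= pi).
  by rewrite normrN addrK m0 mulr0 addr0 cosN mulrC => /(_ psipi).
have c2 := profile_tangent prof theta psipi.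
have cos0 : 0 < cos psi by rewrite -(pmulr_rgt0 _ r0); exact: lt_le_trans c1.
have s1 : sin psi * m theta <= `|sin psi| * `|m theta| by rewrite -normrM ler_norm.
have sp := norm_le_3sin psipi cos0.
exists psi; split => //; last first.
  apply: (le_trans c2); apply: lerD; first by rewrite ler_piMl ?cos_le1// ltW.
  apply: (le_trans s1); rewrite mulrC ler_wpM2l//; exact: norm_sin_le.
have [p0|p0] := eqVneq psi 0; first by rewrite p0 normr0 mul0r mulr_ge0.
have sn0 : 0 < `|sin psi|.
  by rewrite -(pmulr_rgt0 _ (ltr0n R 3)); apply: lt_le_trans sp; rewrite normr_gt0.
have c3 : cos psi * M theta <= cos psi * (M (theta + psi) * cos psi) by rewrite ler_pM2l.
have key : `|sin psi| * (M (theta + psi) * `|sin psi|) <= `|sin psi| * `|m theta|.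
  have E : `|sin psi| * `|sin psi| = 1 - cos psi ^+ 2.
    by rewrite -expr2 (real_normK (num_real _)) -(cos2Dsin2 psi); ring.
  rewrite mulrCA E; lra.
rewrite ler_pM2l// in key.
apply: (@le_trans _ _ (3 * `|sin psi| * M (theta + psi))); last by lra.
by apply: ler_pM => //; exact: ltW.
Qed.

Lemma empirical_folded2_expansion (N : nat) (x : nat -> kale alpha) e theta psi :
  0 < e <= alpha / 2 - pi -> e <= pi -> `|psi| < e ->
  `|empirical N x (folded2 (theta + psi)) - (cos psi * empirical N x (folded2 theta) -
     sin psi * (empirical N x (folded1 theta) +
     (if 0 <= psi then empirical N x (minus_weight theta)
      else empirical N x (plus_weight theta))))|
  <= 8 * `|psi| * empirical N x (antipode_weight e theta).
Proof.
move=> he epi hpsi; rewrite -empiricalZ.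
set W := fun p : kale alpha => if 0 <= psi then minus_weight theta p else plus_weight theta p.
have -> : (if 0 <= psi then empirical N x (minus_weight theta)
      else empirical N x (plus_weight theta)) = empirical N x W.
  by rewrite /W; case: ifP.
rewrite -empiricalD -!empiricalZ -!empiricalN -!empiricalD -empiricalN -empiricalD.
apply: (le_trans (empirical_norm _ _ _)); apply: empirical_le => p.
have := folded2_expansion halpha theta p he epi hpsi; rewrite -/(W p).
by rewrite mulrDr (opprD (sin psi * _)) addrA.
Qed.

(** The deterministic core. Both errors are products of |m2|, which is of order N^(-1/2), and of dl,
    which is arbitrarily small; thus they vanish after multiplication by sqrt N. The hypothesis on 6
    |m2| places the empirical maximizer within e of theta, where the expansion of the second moment
    is valid. *)
Lemma barycenter_estimate (N : nat) (x : nat -> kale alpha) (theta r wp wm e dl : R) :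
  let m1 := empirical N x (folded1 theta) in
  let m2 := empirical N x (folded2 theta) in
  let b := barycenter N x in
  let kap (y : R) := if y < 0 then wp / r else if 0 < y then wm / r else 0 in
  (0 < N)%N -> 0 < r -> 0 <= wp -> 0 <= wm ->
  0 < e <= alpha / 2 - pi -> e <= pi -> dl <= r / 2 -> 6 * `|m2| < e * r ->
  `|m1 - r| <= dl -> `|m2| <= dl ->
  `|empirical N x (plus_weight theta) - wp| <= dl ->
  `|empirical N x (minus_weight theta) - wm| <= dl ->
  empirical N x (antipode_weight e theta) <= 2 * dl ->
  `|folded1 theta b - m1| <= 6 / r * `|m2| * dl /\
  `|(1 + kap (folded2 theta b)) * folded2 theta b - m2| <=
    6 / r * `|m2| * ((23 + 4 * (wp / r + wm / r)) * dl).
Proof.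
move=> m1 m2 b kap N0 r0 wp0 wm0 he epi dlr dle h1 h2 hp hm hz.
have dl0 : 0 <= dl := le_trans (normr_ge0 _) h1.
have m1r : r / 2 <= m1 by move: h1; rewrite ler_norml => /andP[]; lra.
have m10 : 0 < m1 by lra.
have prof := empirical_profile halpha N x.
have [psi [tmax psim c1 c2 m0]] := profile_maximizer_near prof m10.
have M0 := lt_le_trans m10 (tmax theta).
rewrite /b (barycenter_folded1 halpha N0 tmax M0) (barycenter_folded2 halpha N0 tmax M0).
move: c1 c2 m0 psim; rewrite -/m1 -/m2; set rN := empirical _ _ (folded1 (theta + psi)) => c1 c2 m0 psim.
rewrite (_ : theta + psi - theta = psi); last by ring.
have psi6 : `|psi| <= 6 / r * `|m2|.
  have : `|psi| * (r / 2) <= `|psi| * m1 by rewrite ler_wpM2l.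
  move=> h; rewrite mulrAC ler_pdivlMr//; lra.
have psim2 : `|psi| * r <= 6 * `|m2|.
  by move: psi6; rewrite mulrAC ler_pdivlMr.
have psidl : `|psi| * r <= 6 * dl by lra.
have psie : `|psi| < e by rewrite -(ltr_pM2r r0) (le_lt_trans psim2).
have psi3 : `|psi| <= 3.
  by rewrite -(ler_pM2r r0) (le_trans psidl)//; lra.
have psipi : `|psi| <= pi := le_trans (ltW psie) epi.
rewrite (fcos_small halpha psipi) (fsin_small halpha psipi).
have rN0 : 0 < rN by exact: M0.
have rNc : rN * cos psi <= rN by rewrite ler_piMr ?cos_le1// ltW.
have m2p : `|m2| * `|psi| <= 3 * dl.
  by rewrite mulrC; apply: ler_pM.
split.
  rewrite ger0_norm ?subr_ge0//; apply: (@le_trans _ _ (`|m2| * `|psi|)); first by lra.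
  rewrite mulrC; apply: (le_trans (ler_wpM2r _ psi6)) => //.
  by rewrite ler_wpM2l// mulr_ge0// divr_ge0// ltW.
set k := kap _; set K := wp / r + wm / r.
have kp0 : 0 <= wp / r by rewrite divr_ge0// ltW.
have km0 : 0 <= wm / r by rewrite divr_ge0// ltW.
pose w := if 0 <= psi then wm else wp.
pose W := if 0 <= psi then empirical N x (minus_weight theta)
  else empirical N x (plus_weight theta).
have hW : `|W - w| <= dl by rewrite /W /w; case: ifP.
have k0 : 0 <= k <= K.
  rewrite /k /kap /K; case: ifP => _; [|case: ifP => _]; apply/andP; split; lra.
(* The second coordinate rN sin psi of the barycenter has the sign of psi, so the case chosen by
   kappa matches the weight in the expansion. For psi = 0 kappa is 0 and may differ from w / r, but
   then sin psi = 0. *)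
have sgn : psi = 0 \/ k * r = w.
  have [p0|p0|p0] := ltgtP 0 psi; [right|right|by left].
    have s0 : 0 < sin psi.
      apply: sin_gt0_pi; rewrite p0/= lt_neqAle (le_trans (ler_norm _) psipi) andbT.
      apply/eqP => E; have := lt_le_trans m10 c1; rewrite E cospi.
      by rewrite mulrN1 oppr_gt0 ltNge (ltW rN0).
    rewrite /k /kap ltNge mulr_ge0 ?ltW//= mulr_gt0//.
    by rewrite /w (ltW p0) divfK// gt_eqF.
  have s0 : sin psi < 0.
    rewrite -[psi]opprK sinN oppr_lt0; apply: sin_gt0_pi; rewrite oppr_gt0 p0/=.
    rewrite lt_neqAle -(ltr0_norm p0) psipi andbT.
    apply/eqP => E; have := lt_le_trans m10 c1; rewrite -cos_norm E cospi.
    by rewrite mulrN1 oppr_gt0 ltNge (ltW rN0).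
  by rewrite /k /kap pmulr_rlt0// s0 /w leNgt p0/= divfK// gt_eqF.
have := empirical_folded2_expansion N x theta he epi psie; rewrite m0 -/m1 -/m2 -/W sub0r normrN.
set z := empirical _ _ (antipode_weight _ _) in hz * => err.
have p0 := normr_ge0 psi.
have m20 := normr_ge0 m2.
have [/andP[k0' kK] Km] := (k0, addr_ge0 kp0 km0).
rewrite -/K in Km.
(* The expansion of the second moment at the maximizer, where this moment is 0, is inserted; the
   remaining factors of sin psi are differences that are small with dl. *)
have D : (1 + k) * (rN * sin psi) - m2 = sin psi * ((1 + k) * (rN - m1) + (k * (m1 - r) +
    (k * r - W))) - (cos psi * m2 - sin psi * (m1 + W)) - (1 - cos psi) * m2 by ring.
rewrite D.
have b1 : `|(1 + k) * (rN - m1)| <= (1 + K) * (3 * dl).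
  rewrite normrM ger0_norm; last by lra.
  rewrite (ger0_norm (_ : 0 <= rN - m1)); last by rewrite subr_ge0; exact: tmax.
  by apply: ler_pM; rewrite ?subr_ge0 ?tmax//; lra.
have b2 : `|k * (m1 - r)| <= K * dl by rewrite normrM ger0_norm//; apply: ler_pM.
have b3 : `|sin psi * (k * r - W)| <= `|psi| * dl.
  case: sgn => [->|->]; first by rewrite sin0 mul0r normr0 mul0r.
  by rewrite normrM (distrC w); apply: ler_pM => //; exact: norm_sin_le.
have b4 : `|(1 - cos psi) * m2| <= `|psi| * (3 * dl).
  rewrite normrM ger0_norm ?subr_ge0 ?cos_le1//.
  apply: (@le_trans _ _ (`|psi| ^+ 2 * `|m2|)).
    by rewrite ler_wpM2r// (real_normK (num_real _)) one_minus_cos_le_sqr.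
  by rewrite expr2 -mulrA ler_wpM2l// mulrC.
have b5 : `|psi| * z <= `|psi| * (2 * dl) by rewrite ler_wpM2l.
have b6 : `|sin psi * ((1 + k) * (rN - m1) + k * (m1 - r))| <=
    `|psi| * ((1 + K) * (3 * dl) + K * dl).
  rewrite normrM; apply: ler_pM => //; first exact: norm_sin_le.
  by apply: (le_trans (ler_normD _ _)); exact: lerD.
(* The constant collects 3 (1 + K) + K from the radius terms, 1 from the weight, 8 times 2 from the
   angles near the boundary rays and 3 from 1 - cos psi. *)
apply: (@le_trans _ _ (`|psi| * ((23 + 4 * K) * dl))); last first.
  by rewrite ler_wpM2r// mulr_ge0//; lra.
rewrite (addrA ((1 + k) * _)) (mulrDr (sin psi)).
apply: (le_trans (ler_normB _ _)).
have := ler_normB (sin psi * ((1 + k) * (rN - m1) + k * (m1 - r)) + sin psi * (k * r - W))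
  (cos psi * m2 - sin psi * (m1 + W)).
have := ler_normD (sin psi * ((1 + k) * (rN - m1) + k * (m1 - r))) (sin psi * (k * r - W)).
move: err b3 b4 b5 b6; lra.
Qed.

End LocalEstimate.

Section RescaledBarycenter.
Context {R : realType}.
Variable alpha : R.
Hypothesis halpha : 2 * pi < alpha.
Local Notation RR := (measurableTypeR R * measurableTypeR R)%type.
Variable mu : probability (kale alpha) R.
Hypothesis mu_nonsticky : kale_nonsticky mu.
Hypothesis mu2 : kale_square_integrable mu.
Context {d : measure_display} {Omega : measurableType d} (P : probability Omega R).
Variable p : nat -> {RV P >-> kale alpha}.
Hypothesis p_independent : mutually_independent P p.
Hypothesis p_law : identically_distributed p mu.
Local Notation thetas := (mean_ang mu).
Local Notation rs := (mean_rad mu).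

Definition rescaled_moment (n : nat) (w : Omega) : R * R :=
  ((Num.sqrt n%:R)^-1 * partial_sum p (centered_folding mu 0) n w,
   (Num.sqrt n%:R)^-1 * partial_sum p (centered_folding mu 1) n w).

(* Measurability of the barycenter is known for [0 < n] only. *)
Let X n w := if n is m.+1 then rescaled mu p m.+1 w else (0, 0).

Let mX n : measurable_fun setT (X n : Omega -> RR).
Proof.
case: n => [|n]; first exact: measurable_cst.
exact: (measurable_rescaled halpha mu (p := fun n => p n) (fun n => measurable_funPT (p n)) (ltn0Sn n)).
Qed.

Let mV n : measurable_fun setT (rescaled_moment n : Omega -> RR).
Proof.
have h i : measurable_fun setT (partial_sum p (centered_folding mu i) n).
  by apply: measurable_partial_sum; have [] := square_integrable_centered_folding halpha mu2 i.
by apply/measurable_fun_pairP; split; apply: measurable_funM => //; exact: h.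
Qed.

Let r0 : 0 < rs := mean_rad_gt0 halpha mu2 mu_nonsticky.

(** The choices depend on one another in this order: [C] by tightness for half of eta, [dl] from
    [C], the width [ez] of the neighbourhoods of the boundary rays from [dl], and [dl2] from [ez].
    All weak laws then share the other half of eta. *)
Let rescaled_close (e : R) : 0 < e -> with_high_probability P
  (fun n => [set w | `|(X n w).1 - (rescaled_moment n w).1| < e /\
                     `|(X n w).2 - (rescaled_moment n w).2| < e]).
Proof.
move=> e0 eta eta0; rewrite (splitr eta).
have eta2 : 0 < eta / 2 by rewrite divr_gt0.
pose wp := w_plus mu thetas; pose wm := w_minus mu thetas.
have wp0 : 0 <= wp.
  by rewrite /wp w_plusE//; apply: Rintegral_ge0 => q _; have /andP[] := plus_weight_le thetas q.
have wm0 : 0 <= wm.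
  by rewrite /wm w_minusE//; apply: Rintegral_ge0 => q _; have /andP[] := minus_weight_le thetas q.
have s2 := square_integrable_folded2 halpha mu2 thetas.
have m20 := moment2_mean halpha mu2 mu_nonsticky.
have [C C0 tight] := partial_sum_tight p_independent p_law s2 m20 eta2.
pose K := 23 + 4 * (wp / rs + wm / rs).
have K23 : 23 <= K by rewrite /K lerDl mulr_ge0// addr_ge0// divr_ge0// ltW.
have K0 : 0 < K by lra.
pose B := 6 / rs * C * K.
have B0 : 0 < B by rewrite !mulr_gt0// invr_gt0.
pose dl := Num.min (rs / 2) (e / B / 2).
have dl0 : 0 < dl by rewrite lt_min !divr_gt0.
have dlr : dl <= rs / 2 by rewrite ge_min lexx.
have dlB : B * dl < e.
  rewrite mulrC -ltr_pdivlMr//; apply: (@le_lt_trans _ _ (e / B / 2)).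
    by rewrite ge_min lexx orbT.
  by have := divr_gt0 e0 B0; lra.
(* Dominated convergence makes the integral of the antipode weight smaller than [dl]; with a
   deviation of at most [dl] for the empirical average, this gives the bound 2 dl of
   [barycenter_estimate]. *)
have [ez [ez1 ez2 ez3]] : exists ez : R, [/\ 0 < ez <= alpha / 2 - pi, ez <= pi &
    \int[mu]_q antipode_weight ez thetas q < dl].
  have a0 : 0 < Num.min (alpha / 2 - pi) pi.
    by rewrite lt_min pi_gt0 andbT subr_gt0 ltr_pdivlMr// mulrC.
  have near1 := near_infty_natSinv_lt (PosNum a0).
  have near2 : \forall n \near \oo, \int[mu]_q antipode_weight n.+1%:R^-1 thetas q < dl.
    exact: (cvgr_lt _ (antipode_weight_cvg halpha mu2 thetas)).
  have [n _ /(_ n (leqnn n)) [/= h1 h2]] := filterI near1 near2.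
  exists n.+1%:R^-1; split => //.
    by rewrite invr_gt0 ltr0n/= ltW// (lt_le_trans h1)// ge_min lexx.
  by rewrite ltW// (lt_le_trans h1)// ge_min lexx orbT.
have ez0 : 0 < ez by case/andP: ez1.
(* The second entry ensures 6 |m2| < ez rs. *)
pose dl2 := Num.min dl (ez * rs / 6).
have dl20 : 0 < dl2 by rewrite lt_min dl0 divr_gt0// mulr_gt0.
have wl f (c : R) : square_integrable mu f -> 0 < c -> with_high_probability P
    (fun n => [set w | `|n%:R^-1 * partial_sum p f n w - \int[mu]_x f x| < c]).
  by move=> sf c0; exact: weak_law.
have L1 := wl _ _ (square_integrable_folded1 halpha mu2 thetas) dl0.
have L2 := wl _ _ s2 dl20.
have Lp := wl _ _ (square_integrable_plus_weight halpha mu2 thetas) dl0.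
have Lm := wl _ _ (square_integrable_minus_weight halpha mu2 thetas) dl0.
have Lz := wl _ _ (square_integrable_antipode_weight halpha mu2 ez thetas) dl0.
have all := with_high_probabilityI L1 (with_high_probabilityI L2
  (with_high_probabilityI Lp (with_high_probabilityI Lm Lz))).
apply: eventually_likelyS (eventually_likelyI tight (all _ eta2)).
near=> n; move=> w /= [ht [h1 [h2 [hp [hm hz]]]]].
have n0 : (0 < n)%N by near: n; exact: nbhs_infty_gt.
have nR : 0 < n%:R :> R by rewrite ltr0n.
set s := Num.sqrt n%:R : R in ht *.
have s0 : 0 < s by rewrite sqrtr_gt0.
have sE : s^-1 = s * n%:R^-1.
  by rewrite -[n%:R in RHS](sqr_sqrtr (ltW nR)) -/s expr2 invfM mulrA mulfV ?mul1r// gt_eqF.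
have XE : X n w = rescaled mu p n w by rewrite /X -(prednK n0).
pose x i := p i w.
have E f : n%:R^-1 * partial_sum p f n w = empirical n x f by [].
rewrite E m20 subr0 in h2; rewrite E -w_plusE// in hp; rewrite E -w_minusE// in hm.
rewrite E in hz; rewrite E in h1.
have m2dl : `|empirical n x (folded2 thetas)| < dl.
  by rewrite (lt_le_trans h2)// ge_min lexx.
have m2ez : 6 * `|empirical n x (folded2 thetas)| < ez * rs.
  by rewrite mulrC -ltr_pdivlMr// (lt_le_trans h2)// ge_min lexx orbT.
have z2 : empirical n x (antipode_weight ez thetas) <= 2 * dl.
  by move: hz; rewrite ltr_norml => /andP[_]; lra.
have [D1 D2] := barycenter_estimate halpha n0 r0 wp0 wm0 ez1 ez2 dlr m2ez (ltW h1) (ltW m2dl)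
  (ltW hp) (ltW hm) z2.
have V1 : s^-1 * partial_sum p (centered_folding mu 0) n w = s * (empirical n x (folded1 thetas) - rs).
  rewrite sE -mulrA.
  have -> : partial_sum p (centered_folding mu 0) n w =
    partial_sum p (folded1 thetas) n w - n%:R * rs by exact: partial_sum_sub.
  by rewrite mulrBr mulKf// gt_eqF.
have V2 : s^-1 * partial_sum p (centered_folding mu 1) n w =
    s * empirical n x (folded2 thetas) by rewrite sE -mulrA.
have sm2 : s * `|empirical n x (folded2 thetas)| < C.
  rewrite -E normrM ger0_norm ?invr_ge0 ?ler0n// mulrA -sE mulrC.
  by rewrite ltr_pdivrMr.
(* Tightness, in the form sqrt n |m2| < C, turns an error of order |m2| dl into at most B dl < e
   after rescaling. *)
have fin (a c : R) : c <= K -> `|a| <= 6 / rs * `|empirical n x (folded2 thetas)| * (c * dl) ->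
    `|s * a| < e.
  move=> cK ha; rewrite normrM (gtr0_norm s0); apply: le_lt_trans dlB.
  have r6 : 0 <= 6 / rs by rewrite divr_ge0// ltW.
  apply: (@le_trans _ _ (s * (6 / rs * `|empirical n x (folded2 thetas)| * (K * dl)))).
    rewrite ler_pM2l//; apply: (le_trans ha).
    by apply: ler_wpM2l; [exact: mulr_ge0|rewrite ler_pM2r].
  rewrite (_ : s * _ = 6 / rs * (s * `|empirical n x (folded2 thetas)|) * (K * dl)); last by ring.
  rewrite /B -(mulrA _ K dl); apply: ler_wpM2r; first by rewrite mulr_ge0// ltW.
  by apply: ler_wpM2l => //; exact: ltW.
rewrite XE V1 V2; split.
  rewrite /rescaled foldingE [X in `|X - _|]/= -/s -mulrBr; apply: (fin _ 1); first by lra.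
  rewrite mul1r; apply: le_trans D1; rewrite le_eqVlt; apply/orP; left; apply/eqP.
  by congr (`| _ |); rewrite /x; ring.
rewrite /rescaled/= -/s -mulrBr; apply: (fin _ K) => //.
Unshelve. all: by end_near.
Qed.

Lemma rescaled_weak_convergence (A : 'M[R]_2) (phi : R * R -> R) :
  A *m A^T = mean_cov mu -> continuous phi -> (exists M, forall z, `|phi z| <= M) ->
  \int[P]_w phi (rescaled mu p n w) @[n --> \oo] --> \int[plane_gauss]_z phi (mx_app A z).
Proof.
move=> AS cphi bphi.
have cov i j : \int[mu]_q (centered_folding mu i q * centered_folding mu j q) =
    A i 0 * A j 0 + A i 1 * A j 1.
  rewrite -(mean_covE halpha mu2 mu_nonsticky) -AS !mxE big_ord_recr big_ord1/= !mxE.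
  by congr (A i _ * A j _ + A i _ * A j _); exact/val_inj.
have sg := square_integrable_centered_folding halpha mu2.
have zg := centered_folding_mean halpha mu2 mu_nonsticky.
have mA : measurable_fun setT (mx_app A : RR -> RR) := measurable_mx_app A.
have ccos : forall c a b : R, \int[P]_w cos (c + (a * (rescaled_moment n w).1 +
    b * (rescaled_moment n w).2)) @[n --> \oo] -->
    \int[plane_gauss]_z cos (c + (a * (mx_app A z).1 + b * (mx_app A z).2)).
  apply: (plane_clt_cos p_independent p_law (sg 0) (sg 1) (zg 0) (zg 1)).
  - by under eq_Rintegral do rewrite expr2; rewrite cov.
  - by rewrite cov.
  - by under eq_Rintegral do rewrite expr2; rewrite cov.
have cX : \int[P]_w phi (X n w) @[n --> \oo] --> \int[plane_gauss]_z phi (mx_app A z).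
  (* The closeness of the two sequences is used at the level of lower limits for Lipschitz
     functions, before these are upgraded to weak convergence. *)
  apply: (weak_convergence mX mA) => // psi L M L0 mpsi psiM psiL e e0.
  apply: (slutsky_liminf mV mX rescaled_close L0 mpsi psiM psiL _ e0) => e' e'0.
  exact: (lipschitz_liminf mV mA ccos L0 mpsi psiM psiL e'0).
apply: cvg_trans cX; apply: near_eq_cvg; near=> n.
have n0 : (0 < n)%N by near: n; exact: nbhs_infty_gt.
by rewrite /X -(prednK n0).
Unshelve. all: by end_near.
Qed.

End RescaledBarycenter.

Theorem theorem1p15 (R : realType) (alpha : R) (halpha : 2 * pi < alpha)
    (mu : probability (kale alpha) R)
    (mu_nondegenerate : kale_nondegenerate mu)
    (mu_nonsticky : kale_nonsticky mu)
    (mu_square_integrable : kale_square_integrable mu)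
    (d : measure_display) (Omega : measurableType d) (P : probability Omega R)
    (p : nat -> {RV P >-> kale alpha})
    (p_independent : mutually_independent P p)
    (p_law : identically_distributed p mu)
    (g : probability (R * R)%type R)
    (g_normal : centered_normal (mean_cov mu) g)
    (phi : R * R -> R)
    (phi_continuous : continuous phi)
    (phi_bounded : exists M : R, forall z : R * R, `|phi z| <= M) :
  (\int[rescaled_law mu P p N]_z (phi z)%:E)%E @[N --> \oo]
    --> (\int[g]_z (phi z)%:E)%E.
Proof.
have [A AS gA] := g_normal.
have bphi := bounded_continuous_plane phi_continuous phi_bounded.
have [mphi [M phiM]] := bphi.
have push d1 (T : measurableType d1) (m : probability T R) (f : T -> R * R) :
    measurable_fun setT (f : T -> measurableTypeR R * measurableTypeR R)%type ->
    (\int[pushforward m f]_z (phi z)%:E)%E = (\int[m]_w phi (f w))%:E.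
  move=> mf; have b : bounded_measurable (fun w => phi (f w)).
    by split; [exact: measurableT_comp mphi mf|exists M => w].
  rewrite EFin_Rintegral; last exact: bounded_measurable_integrable.
  rewrite integral_pushforward//; first exact/measurable_EFinP.
  by rewrite preimage_setT; exact: bounded_measurable_integrable.
have gE : (\int[g]_z (phi z)%:E)%E = (\int[plane_gauss]_z phi (mx_app A z))%:E.
  rewrite -push; last exact: measurable_mx_app.
  by apply: eq_measure_integral => [|mA W mW _]; [exact: measurable_mx_app|exact: gA].
rewrite gE.
have cvg := rescaled_weak_convergence halpha mu_nonsticky mu_square_integrable p_independent
  p_law AS phi_continuous phi_bounded.
(* The change of variables rests on measurability of the rescaled barycenter, which has been
   established for n > 0. *)
have ev : \forall n \near \oo, (\int[rescaled_law mu P p n]_z (phi z)%:E)%E =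
    (\int[P]_w phi (rescaled mu p n w))%:E.
  near=> n; have n0 : (0 < n)%N by near: n; exact: nbhs_infty_gt.
  apply: push; exact: (measurable_rescaled halpha mu (fun n => measurable_funPT (p n)) n0).
apply: cvg_EFin; first by apply: filterS ev => n ->.
apply: cvg_trans cvg; apply: near_eq_cvg.
by apply: filterS ev => n /= ->.
Unshelve. all: by end_near.
Qed.
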